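(* Let $G$ be an outerplanar graph of order $n$. If $n\ge 3$ is odd and $n\neq 13$, then $$\rho_2(G)\le\rho_2\big(2(K_1\vee P_{\frac{n-3}{2}})\bullet K_1\big).$$ Equality holds if and only if $G\cong 2(K_1\vee P_{\frac{n-3}{2}})\bullet K_1$ and $2(K_1\vee P_{\frac{n-3}{2}})\bullet K_1$ is still an outerplanar graph. For $n=13$, the extremal graph is of the form $2G_1\bullet K_1$ if $2G_1\bullet K_1$ is still an outerplanar graph.
   Context: All graphs are finite, simple and undirected. $\rho_2(G)$ is the second largest eigenvalue of the adjacency matrix of $G$, and ''extremal graph'' means a graph attaining the maximum of $\rho_2$ among outerplanar graphs of the given order. $P_k$ is the path on $k$ vertices ($P_0$ is empty, so $K_1\vee P_0=K_1$); $G\vee H$ is the join (all edges between $G$ and $H$ are added to the disjoint union). For a graph $H$, $2H\bullet K_1$ denotes the set of connected graphs obtained from two disjoint copies of $H$ by adding one additional vertex and adding some edges from vertices of the two copies to this additional vertex; the notation is also used for a member of this set, so that $G\cong 2H\bullet K_1$ means that $G$ is isomorphic to a graph of this form. $G_1$ is the graph on the six vertices $a,b,c,d,e,f$ with edges $ab,bc,cd,ea,eb,ec,ed,fb,fc$ (i.e. $K_1\vee P_4$ plus a vertex adjacent to the two middle vertices of the $P_4$).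
   Formalization: The equality characterization and the n=13 statement are given for connected G only, since otherwise they fail: 3K_1 attains equality for n=3, the disjoint union of two blocks and K_1 attains it in general, and 2G_1 ∪ K_1 is extremal for n=13. *)

(* Defs.v *)
From HB Require Import structures.
From mathcomp Require Import all_boot all_order all_algebra.
From mathcomp Require Import polyrcf.
From mathcomp Require Import reals.

Set Implicit Arguments.
Unset Strict Implicit.
Unset Printing Implicit Defensive.

Import Order.TTheory GRing.Theory Num.Theory.

Record sgraph := SGraph {
  svertex :> finType;
  sedge : rel svertex;
  sedge_sym : symmetric sedge;
  sedge_irrefl : irreflexive sedge }.

Arguments sedge {G} : rename.
Arguments SGraph {svertex sedge}.

Definition isograph (G H : sgraph) : Prop :=
  exists2 f : G -> H, bijective f & forall x y, sedge (f x) (f y) = sedge x y.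

Notation "G '≅' H" := (isograph G H) (at level 70, no associativity).

Definition connected_graph (G : sgraph) : Prop :=
  forall x y : G, connect sedge x y.

Section Path.
Variable k : nat.

Definition path_rel (i j : 'I_k) : bool :=
  ((i : nat).+1 == j) || ((j : nat).+1 == i).

Fact path_rel_sym : symmetric path_rel.
Proof. by move=> i j; rewrite /path_rel orbC. Qed.

Fact path_rel_irrefl : irreflexive path_rel.
Proof. by move=> i; rewrite /path_rel orbb gtn_eqF. Qed.

Definition path_graph : sgraph := SGraph path_rel_sym path_rel_irrefl.
End Path.

Definition K1 : sgraph :=
  @SGraph unit (fun _ _ => false) (fun _ _ => erefl) (fun _ => erefl).

Section JoinAndUnion.
Variables G H : sgraph.

(* The parameter b is the adjacency between the two sides. *)
Definition sum_rel (b : bool) (u v : G + H) : bool :=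
  match u, v with
  | inl x, inl y => sedge x y
  | inr x, inr y => sedge x y
  | _, _ => b
  end.

Fact sum_rel_sym b : symmetric (sum_rel b).
Proof. by move=> [x|x] [y|y] //=; rewrite sedge_sym. Qed.

Fact sum_rel_irrefl b : irreflexive (sum_rel b).
Proof. by move=> [x|x] /=; rewrite sedge_irrefl. Qed.

Definition join_graph : sgraph :=
  SGraph (sum_rel_sym true) (sum_rel_irrefl true).
Definition disjoint_union : sgraph :=
  SGraph (sum_rel_sym false) (sum_rel_irrefl false).
End JoinAndUnion.

Section AddVertex.
Variables (G : sgraph) (S : {set G}).

(* [None] is the additional vertex, and S is its neighbourhood. *)
Definition add_vertex_rel (u v : option G) : bool :=
  match u, v with
  | Some x, Some y => sedge x y
  | Some x, None | None, Some x => x \in S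
  | None, None => false
  end.

Fact add_vertex_rel_sym : symmetric add_vertex_rel.
Proof. by move=> [x|] [y|] //=; rewrite sedge_sym. Qed.

Fact add_vertex_rel_irrefl : irreflexive add_vertex_rel.
Proof. by move=> [x|] //=; rewrite sedge_irrefl. Qed.

Definition add_vertex : sgraph :=
  SGraph add_vertex_rel_sym add_vertex_rel_irrefl.
End AddVertex.

(* M belongs to the set 2H • K_1. *)
Definition in_two_bullet (H M : sgraph) : Prop :=
  connected_graph M /\
  exists S : {set disjoint_union H H}, M ≅ add_vertex S.

Definition fan (k : nat) : sgraph := join_graph K1 (path_graph k).

(* The vertices a, b, c, d, e, f are numbered 0, 1, 2, 3, 4, 5. *)
Definition G1_edges : seq (nat * nat) :=
  [:: (0, 1); (1, 2); (2, 3); (4, 0); (4, 1); (4, 2); (4, 3); (5, 1); (5, 2)].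

Definition G1_rel (i j : 'I_6) : bool :=
  ((i : nat, j : nat) \in G1_edges) || ((j : nat, i : nat) \in G1_edges).

Fact G1_rel_sym : symmetric G1_rel.
Proof. by move=> i j; rewrite /G1_rel orbC. Qed.

Fact G1_rel_irrefl : irreflexive G1_rel.
Proof. by case=> [[|[|[|[|[|[|]]]]]]]. Qed.

Definition G1 : sgraph := SGraph G1_rel_sym G1_rel_irrefl.

(* Plane embeddings are encoded by combinatorial maps: a rotation system on    *)
(* the darts (oriented edges) gives the cyclic order of the edges around each  *)
(* vertex, the faces are the orbits of the face-tracing permutation, and the   *)
(* embedding is spherical exactly when Euler's formula holds.                  *)
Section CombinatorialMaps.
Variable G : sgraph.

Definition dart : finType := {d : G * G | sedge d.1 d.2}.

Definition tail (d : dart) : G := (val d).1.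

Fact rev_dart_subproof (d : dart) : sedge (val d).2 (val d).1.
Proof. by rewrite sedge_sym; case: d. Qed.

Definition rev_dart (d : dart) : dart :=
  exist (fun d : G * G => sedge d.1 d.2) ((val d).2, (val d).1)
    (rev_dart_subproof d).

Definition rotation_system (rot : dart -> dart) : Prop :=
  injective rot /\ forall d d', fconnect rot d d' = (tail d == tail d').

Definition face_step (rot : dart -> dart) (d : dart) : dart := rot (rev_dart d).

Definition non_isolated : {set G} := [set x | [exists y, sedge x y]].

(* V + F = E + 2C. Each component is embedded in its own sphere, so that F     *)
(* counts the faces component by component; isolated vertices have no dart     *)
(* and are left out of V and C.                                                *)
Definition spherical (rot : dart -> dart) : Prop :=
  #|non_isolated| + fcard (face_step rot) predT =
  #|dart|./2 + (n_comp sedge non_isolated).*2.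

(* Any face of a spherical map can be taken as the outer one, and a plane      *)
(* embedding of G consists of plane embeddings of its components placed in     *)
(* each other's outer face. Hence all vertices of G lie on the outer face iff  *)
(* each component has a face incident with all the vertices of the component.  *)
Definition outer_vertices (rot : dart -> dart) : Prop :=
  forall x, x \in non_isolated ->
  exists o : dart, forall y, connect sedge x y ->
  exists2 d, fconnect (face_step rot) o d & tail d = y.

Definition outerplanar : Prop :=
  exists rot : dart -> dart,
    [/\ rotation_system rot, spherical rot & outer_vertices rot].
End CombinatorialMaps.

Local Open Scope ring_scope.

Section Spectrum.
Variable R : realType.

Definition adjacency (G : sgraph) : 'M[R]_#|G| :=
  \matrix_(i, j) (sedge (enum_val i) (enum_val j))%:R.

(* Real eigenvalues with (algebraic) multiplicity, in nonincreasing order;     *)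
(* these are all the eigenvalues when A is symmetric.                          *)
Definition eigenvalues n (A : 'M[R]_n) : seq R :=
  sort >=%R (flatten [seq nseq (mup x (char_poly A)) x
                     | x <- rootsR (char_poly A)]).

Definition rho2 (G : sgraph) : R := nth 0 (eigenvalues (adjacency G)) 1.

Definition extremal (G : sgraph) : Prop :=
  outerplanar G /\
  forall H : sgraph, outerplanar H -> #|H| = #|G| -> rho2 H <= rho2 G.
End Spectrum.

(* Main.v *)
(* A graph with at least two vertices has two nonnegative nonzero vectors with *)
(* disjoint supports and Rayleigh quotients at least [rho2]: the positive and  *)
(* negative parts of an eigenvector, or two eigenvectors without sign changes. *)
(* If n = 2m + 1, one support has at most m vertices, so [rho2] is at most the *)
(* largest spectral radius of an outerplanar graph of order m, which is that   *)
(* of the fan (of [G1] if m = 6) and of no other graph. By interlacing,        *)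
(* [rho2] of a bullet graph equals the spectral radius of its block. In case   *)
(* of equality in a connected graph both supports induce the block and no edge *)
(* joins them, so that one vertex remains.                                     *)
(* For the spectral radius, outerplanarity gives a circular ordering of the    *)
(* vertices without crossing edges. For m <= 12 the vertices are eliminated    *)
(* one at a time from all triangulated m-gons; for m >= 13 one counts the      *)
(* walks from a vertex where the Perron vector is largest.                     *)

(* Write [n = 2m + 1], and let [lam] be the largest eigenvalue of [extremal_block m], which is the
   fan of order [m], or [G1] when [m = 6].

   Spectral half. [two_signs] yields two nonnegative vectors with disjoint supports and Rayleigh
   quotients at least [rho2]. One support fits into [m] vertices, and [block_unique], applied to an
   induced subgraph of order [m] containing it, bounds the quotient by [lam]; this is
   [rho2_le_block]. Conversely [rho2_bullet] gives every graph made of two blocks and one more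
   vertex the second eigenvalue [lam], whatever the neighbourhood of that vertex. If a connected
   graph attains [lam], an eigenvector for [rho2] changes sign ([connected_mixed]), its positive and
   negative parts live on two blocks with no edge between them, and one vertex is left over
   ([rho2_eq_block]).

   Combinatorial half. A crossing pair of chords of an outer face would let one cut the map into a
   map of negative genus, so [outerplanar_noncrossing] replaces rotation systems by a circular order
   of the vertices without crossing edges. [extremal_embedding] then shows that a non-crossing graph
   of order [m] with a Rayleigh quotient at least [lam] is a subgraph of the block. Below order 6
   every triangulated polygon is a fan. For orders 6 to 12 all triangulations are enumerated, and
   those other than the block are bounded by eliminating vertices from the quadratic form in
   fixed-point arithmetic.

   From order 13 on, scale the Perron vector to have its largest entry 1 at a hub, and expand
   [rho (rho - 2)] by walks of length two from the hub. The neighbours of the hub contribute at most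
   0, with a definite loss at the first and the last of them; the non-neighbours contribute at most
   [4 / rho] each on average ([outer_walks_all]). Compared with the fan ([fan_top_lower]), this
   leaves no room for a non-neighbour, and a dominating vertex forces a subgraph of the fan. *)
From Stdlib Require Import NArith.
Require Import Defs.
From mathcomp Require Import all_boot all_order all_algebra all_fingroup spectral.
From mathcomp Require Import polyrcf complex reals zify ring lra.

Set Implicit Arguments.
Unset Strict Implicit.
Unset Printing Implicit Defensive.

Import Order.TTheory GRing.Theory Num.Theory.

(** * Genus of a pair of permutations *)

Section Classes.
Variable T : finType.
Implicit Types e : rel T.

Definition nclasses e := #|[set fingraph.root e x | x in T]|.

Lemma nclasses_invariant e (T' : finType) (f : T -> T') :
  (forall x y, e x y -> f x = f y) -> #|[set f x | x in T]| <= nclasses e.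
Proof.
move=> fE; have fc x y : connect e x y -> f x = f y.
  move=> /connectP[p + ->]; elim: p x => //= z p IH x /andP[/fE -> /IH].
  by [].
have -> : [set f x | x in T] = f @: [set fingraph.root e x | x in T].
  apply/setP => y; apply/imsetP/imsetP => [[x _ ->]|[_ /imsetP[x _ ->] ->]].
    by exists (fingraph.root e x); [apply/imsetP; exists x | exact/fc/connect_root].
  by exists (fingraph.root e x).
exact: leq_imset_card.
Qed.

Lemma nclasses_sub e e' : connect_sym e' -> subrel e (connect e') ->
  nclasses e' <= nclasses e.
Proof.
by move=> sym' sub; apply: nclasses_invariant => x y /sub /(fingraph.rootP sym').
Qed.

(** The hypothesis says that [e] lies in the equivalence generated by [e'] and the single pair
    [(x, y)], expressed through invariant functions. One extra pair merges at most two classes. *)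
Lemma nclasses_join e e' x y : connect_sym e' ->
  (forall f : T -> T, (forall z w, connect e' z w -> f z = f w) ->
    f x = f y -> forall z w, e z w -> f z = f w) ->
  nclasses e' <= nclasses e + ~~ connect e' x y.
Proof.
move=> sym' sub; have [cxy|ncxy] /= := boolP (connect e' x y).
  rewrite addn0; apply: nclasses_invariant; apply: sub => [z w|];
    exact/fingraph.rootP.
pose f z := if fingraph.root e' z == fingraph.root e' y then fingraph.root e' x
            else fingraph.root e' z.
have fP z w : connect e' z w -> f z = f w.
  by rewrite /f => /(fingraph.rootP sym') ->.
have fxy : f x = f y by rewrite /f eqxx; case: ifP.
have fE := sub f fP fxy.
apply: leq_trans (_ : #|fingraph.root e' y |: [set f x | x in T]| <= _); last first.
  by rewrite cardsU1 addnC leq_add ?nclasses_invariant // leq_b1.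
apply: subset_leq_card; apply/subsetP => _ /imsetP[z _ ->].
rewrite !inE; have [//|ne] /= := eqVneq (fingraph.root e' z) (fingraph.root e' y).
by apply/imsetP; exists z => //; rewrite /f (negPf ne).
Qed.

End Classes.

Section Genus.
Variable T : finType.
Implicit Types s a : {perm T}.

(** Its classes are the orbits of the group generated by [s] and [a], hence the components of the
    map with rotation [s] and edge reversal [a]. *)
Definition perm2_rel s a : rel T :=
  fun x y => (y \in porbit s x) || (y \in porbit a x).

Lemma perm2_rel_sym s a : connect_sym (perm2_rel s a).
Proof.
by apply: sym_connect_sym => x y; rewrite /perm2_rel !(porbit_sym _ x).
Qed.

Lemma porbit_ind s (e : rel T) : (forall x, connect e x (s x)) ->
  forall x y, y \in porbit s x -> connect e x y.
Proof.
move=> es x _ /porbitP[i ->]; elim: i => [|i IH]; first by rewrite expg0 perm1.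
by rewrite expgSr permM; apply: connect_trans IH _.
Qed.

Lemma porbits1 : #|porbits (1 : {perm T})%g| = #|T|.
Proof.
rewrite /porbits card_imset // => x y /eqP; rewrite eq_porbit_mem.
by case/porbitP => i ->; rewrite expg1n perm1.
Qed.

(* Riemann-Hurwitz for permutations: the genus is nonnegative. Multiplying   *)
(* by one transposition of [a] at a time, a transposition joining two classes *)
(* also joins two cycles of the product.                                      *)
Lemma genus_ge0 s a :
  #|porbits s| + #|porbits a| + #|porbits (a * s)%g|
    <= #|T| + (nclasses (perm2_rel s a)).*2.
Proof.
have [k] := ubnP (#|T| - #|porbits a|); elim: k a => // k IH a ak.
have [a1|/forallPn[x axx]] := boolP [forall x, a x == x].
  have -> : a = 1%g by apply/permP => x; rewrite perm1; apply/eqP; exact: (forallP a1).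
  rewrite mul1g porbits1 addnAC [_ + #|T|]addnC leq_add2l addnn leq_double.
  apply: (nclasses_invariant (f := porbit s)) => x y /orP[|]; first by rewrite -eq_porbit_mem eq_sym => /eqP.
  by case/porbitP => i ->; rewrite expg1n perm1.
set y := a x in axx; pose a' := (tperm x y * a)%g.
have aE : a = (tperm x y * a')%g by rewrite mulgA tperm2 mul1g.
have := porbits_mul_tperm a x y; rewrite -/a' /=.
have yx : x \in porbit a y by rewrite porbit_sym (mem_porbit a 1).
rewrite yx /= addn0 eq_sym axx addn1 => ca'.
have leT (b : {perm T}) : #|porbits b| <= #|T|.
  by rewrite /porbits; apply: leq_trans (leq_imset_card _ _) _; rewrite max_card.
have ar t p : p < t -> t - p < k.+1 -> t - p.+1 < k by lia.
have ltk : #|T| - #|porbits a'| < k by rewrite ca'; apply: ar ak; rewrite -ca'.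
have {IH ltk} := IH _ ltk; rewrite ca'.
have := porbits_mul_tperm (a' * s)%g x y; rewrite /= mulgA -aE eq_sym axx.
set e' := perm2_rel s a'; set e := perm2_rel s a.
have sym' := perm2_rel_sym s a'.
have st z : connect e' z (s z) by rewrite connect1 // /e' /perm2_rel (mem_porbit s 1).
have at' z : connect e' z (a' z).
  by rewrite connect1 // /e' /perm2_rel (mem_porbit a' 1) orbT.
have : nclasses e' <= nclasses e + ~~ connect e' x y.
  apply: nclasses_join => // f fP fxy z w.
  have inv (b : {perm T}) : (forall z, f (b z) = f z) ->
      w \in porbit b z -> f z = f w.
    move=> fb /porbitP[i ->]; elim: i => [|i IHi]; first by rewrite expg0 perm1.
    by rewrite expgSr permM fb.
  case/orP; apply: inv => {}z; first by rewrite (fP _ _ (st z)).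
  by rewrite aE permM -(fP _ _ (at' _)); case: tpermP => [->|->|].
have [cxy|ncxy] /= := boolP (connect e' x y).
  have ar2 t v u f f' c c' b : c' <= c + 0 -> f + b = f' + 1 ->
    v + u.+1 + f' <= t + c'.*2 -> v + u + f <= t + c.*2 by lia.
  exact: ar2.
have -> : x \notin porbit (a' * s)%g y.
  apply: contra ncxy => h; rewrite sym'; apply: porbit_ind h => z.
  by rewrite permM; apply: connect_trans (at' z) (st _).
have ar2 t v u f f' c c' : c' <= c + 1 -> f + 2 = f' + 1 ->
  v + u.+1 + f' <= t + c'.*2 -> v + u + f <= t + c.*2 by lia.
exact: ar2.
Qed.

End Genus.

(** Arithmetic on positions along the outer face: hypotheses about cardinals are dropped and the
    length [L] is generalized, so that [lia] meets only variables. *)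
Ltac nlia L :=
  intros;
  repeat match goal with
  | H : context [card] |- _ => clear H
  end;
  repeat match goal with
  | H : is_true (leq _ _) |- _ => revert H
  | H : @eq nat _ _ |- _ => revert H
  end;
  generalize L; clear; intros; lia.

(** * Cutting a planar map along a chord of its outer face *)

Section NoCrossing.
Variable T : finType.
Implicit Types s a t : {perm T}.

Lemma porbits_mul_tperm_r s x y :
  #|porbits (s * tperm x y)%g| + (x \notin porbit s y).*2
    = #|porbits s| + (x != y).
Proof.
have pV (u : {perm T}) : porbits u^-1 = porbits u.
  by apply: eq_imset => z; rewrite porbitV.
have := porbits_mul_tperm s^-1%g x y.
by rewrite /= pV porbitV -{1}[tperm x y]tpermV -invMg pV.
Qed.

Lemma perm_run s t x n :
  (forall k, 0 < k <= n -> t ((s ^+ k)%g x) = (s ^+ k)%g x) ->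
  ((s * t) ^+ n)%g x = (s ^+ n)%g x.
Proof.
elim: n => [|n IH] ts; first by rewrite !expg0.
rewrite !expgSr !permM IH => [|k /andP[k0 kn]]; last by rewrite ts // k0 ltnW.
by have := ts n.+1; rewrite expgSr !permM => ->; rewrite ?leqnn.
Qed.

Variables (s a : {perm T}) (o : T).
Let f := (a * s)%g.
Let E i := (f ^+ i)%g o.
Let L := #|porbit f o|.

Lemma orbit_inj i j : i < L -> j < L -> E i = E j -> i = j.
Proof.
move=> iL jL; have tE k : k < L -> nth o (traject f o L) k = E k.
  by move=> kL; rewrite nth_traject // /E permX.
rewrite -(tE i) // -(tE j) // => /eqP.
by rewrite nth_uniq ?size_traject ?uniq_traject_porbit // => /eqP.
Qed.

Lemma orbit_period i : E (i + L) = E i.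
Proof. by rewrite /E addnC expgD permM [(f ^+ L)%g o]permX iter_porbit. Qed.

Lemma orbitS i : f (E i) = E i.+1.
Proof. by rewrite /E expgSr [RHS]permM. Qed.

(* Cut the map along the closed curve made of the edge [x] and an arc of the *)
(* outer face joining its two ends: this splits both end vertices, so that   *)
(* the number of vertices and faces grows by 2, and the edge [y] keeps the   *)
(* two sides connected, against the genus inequality.                         *)
Lemma no_crossing ia ib ic id x y :
  #|T| + (nclasses (perm2_rel s a)).*2
    < #|porbits s| + #|porbits a| + #|porbits f| + 2 ->
  ia < ib -> ib < ic -> ic < id -> id < L ->
  (forall i, i < L -> E i \in porbit s (E ia) -> ia <= i) ->
  (forall i, i < L -> E i \in porbit s (E ic) -> ic <= i) ->
  E ib \notin porbit s (E ia) -> E ib \notin porbit s (E ic) ->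
  E id \notin porbit s (E ia) -> E id \notin porbit s (E ic) ->
  E ic \notin porbit s (E ia) ->
  x \in porbit s (E ia) -> a x \in porbit s (E ic) ->
  y \in porbit s (E ib) -> a y \in porbit s (E id) -> False.
Proof.
move=> planar ab bc cd dL fsta fstc Nba Nbc Nda Ndc Nca xa xc yb yd.
set pa := E ia in fsta Nba Nda Nca xa; set pc := E ic in fstc Nbc Ndc Nca xc.
(* [t2] cuts the vertex of [pa] into the cycles through [pa] and through [x]; [t1] cuts the vertex
   of [pc] into those through [pc] and through [s0], the dart after [a x]. If [pc = s0] the second
   cut is void, and a face is gained instead of a vertex. *)
pose s0 := f x; pose t1 := tperm pc s0; pose t2 := tperm pa x.
pose s' := (s * (t1 * t2))%g; pose f' := (f * (t1 * t2))%g.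
have f'E : f' = (a * s')%g by rewrite /f' /f /s' !mulgA.
have inA z w : z \in porbit s pa -> (w \in porbit s z) = (w \in porbit s pa).
  by rewrite -eq_porbit_mem => /eqP ->.
have inC z w : z \in porbit s pc -> (w \in porbit s z) = (w \in porbit s pc).
  by rewrite -eq_porbit_mem => /eqP ->.
have s0c : s0 \in porbit s pc.
  by rewrite /s0 /f permM porbit_sym -(porbit_perm _ 1) expg1 porbit_sym in xc *.
have disj z : z \in porbit s pa -> z \in porbit s pc -> False.
  move=> za zc; move/negP: Nca; apply.
  by rewrite -(inA z) // inC // porbit_id.
have paa : pa \in porbit s pa := porbit_id s pa.
have pcc : pc \in porbit s pc := porbit_id s pc.
have neq z w : z \in porbit s pa -> w \in porbit s pc -> z != w.
  by move=> za zc; apply/eqP => zw; apply: (disj z) => //; rewrite zw.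
have tfix z : z != pa -> z != x -> z != pc -> z != s0 -> (t1 * t2)%g z = z.
  move=> h1 h2 h3 h4.
  by rewrite permM /t1 tpermD 1?eq_sym // /t2 tpermD 1?eq_sym.
have f'pre z : f z = pc -> f' z = s0.
  move=> fz; rewrite /f' permM fz permM /t1 tpermL /t2.
  by rewrite tpermD ?neq.
have f'x : f' x = pc.
  by rewrite /f' permM -/s0 permM /t1 tpermR /t2 tpermD ?neq.
have f'pa z : f z = pa -> f' z = x.
  move=> fz; rewrite /f' permM fz permM /t1 tpermD; first by rewrite /t2 tpermL.
    by rewrite eq_sym neq.
  by rewrite eq_sym neq.
have aL : ia < L by nlia L.
have bL : ib < L by nlia L.
have cL : ic < L by nlia L.
(* The face step sends [x] to [s0], a dart of the vertex of [pc], which the outer walk first meets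
   at [ic]. *)
have xpos k : k < L -> x = E k -> ic <= k.+1.
  move=> kL xk; have [kL'|] := ltnP k.+1 L; last by nlia L.
  by apply: fstc kL' _; rewrite -orbitS -xk.
have Epa k : ia < k -> k < L + ia -> E k != pa.
  move=> k1 k2; apply/eqP => Ek; have [kL|Lk] := ltnP k L.
    by have := orbit_inj kL aL Ek; nlia L.
  have kL' : k - L < L by nlia L.
  by move: Ek; rewrite -(subnK Lk) orbit_period => /(orbit_inj kL' aL); nlia L.
have Epc k : k < L -> E k = pc -> k = ic by move=> kL /(orbit_inj kL cL).
have Ns0 k : k < ic -> E k != s0.
  move=> kc; apply/eqP => Ek; have kL : k < L by nlia L.
  by have := fstc k kL; rewrite Ek => /(_ s0c); nlia L.
have Npc k : k < ic -> E k != pc.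
  move=> kc; apply/eqP => Ek; have kL : k < L by nlia L.
  by have := Epc k kL Ek; nlia L.
have V' : #|porbits s'| = #|porbits s| + (pc != s0) + (pa != x).
  have := porbits_mul_tperm_r s pc s0; rewrite porbit_sym s0c /= addn0 => <-.
  have := porbits_mul_tperm_r (s * t1)%g pa x.
  suff -> : pa \in porbit (s * t1)%g x by rewrite /s' mulgA /= addn0 => ->.
  rewrite porbit_sym; case/porbitP: xa => n xn; apply/porbitP; exists n.
  rewrite perm_run // => k _; rewrite /t1 tpermD //.
    by rewrite eq_sym neq // mem_porbit.
  by rewrite eq_sym neq // mem_porbit.
have F' : #|porbits s| + #|porbits f| + 2 <= #|porbits s'| + #|porbits f'|.
  have ft1 := porbits_mul_tperm_r f pc s0.
  have := porbits_mul_tperm_r (f * t1)%g pa x.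
  have -> : (f * t1 * tperm pa x)%g = f' by rewrite /f' mulgA.
  have oE k : E k \in porbit f o by apply: mem_porbit.
  have sameo z w : z \in porbit f o -> (w \in porbit f z) = (w \in porbit f o).
    by rewrite -eq_porbit_mem => /eqP ->.
  have xne : pa != x.
    by apply/eqP => xE; have := xpos ia aL (esym xE); nlia L.
  have ar (P P' Q Q' Q1 m1 m2 b1 : nat) : P' = P + b1 + true ->
      Q1 + m1.*2 = Q + b1 -> Q' + m2.*2 = Q1 + true ->
      m1 + m2 <= b1 -> P + Q + 2 <= P' + Q' by clear; lia.
  rewrite xne in V' *; move/(ar _ _ _ _ _ _ _ _ V' ft1); apply.
  have [s0E|s0ne] /= := eqVneq pc s0.
    have xE : x = E ic.-1.
      apply: (@perm_inj _ f); rewrite orbitS prednK; last by nlia L.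
      by rewrite -/s0 -s0E.
    have -> : t1 = 1%g by rewrite /t1 -s0E tperm1.
    by rewrite mulg1 -s0E porbit_id xE porbit_sym sameo // oE.
  have [so|nso] := boolP (s0 \in porbit f o).
    by rewrite sameo // oE leq_b1.
  (* Here [s0] is not on the outer face: [t1] merges two faces, after which [pa] and [x] share one,
     and [t2] splits it again. *)
  have pcs : pc \notin porbit f s0.
    apply: contra nso => h; rewrite -(sameo pc) ?oE //.
    by rewrite porbit_sym.
  rewrite pcs; suff -> : pa \in porbit (f * t1)%g x by [].
  have s0i : s0 \in porbit (f * t1)%g pa.
    apply/porbitP; exists (ic - ia); have -> : ic - ia = (ic.-1 - ia).+1 by nlia L.
    have EE k : (f ^+ k)%g pa = E (ia + k) by rewrite /pa /E -permM -expgD.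
    rewrite expgSr permM perm_run => [|k /andP[k0 kn]].
      have -> : (f ^+ (ic.-1 - ia))%g pa = E ic.-1 by rewrite EE; congr E; nlia L.
      rewrite permM orbitS prednK; last by nlia L.
      by rewrite /t1 tpermL.
    by rewrite EE /t1 tpermD // eq_sym ?Npc ?Ns0 //; nlia L.
  have xi : x \in porbit (f * t1)%g s0.
    have [n xn nmin] : exists2 n, (f ^+ n)%g s0 = x &
        forall k, 0 < k <= n -> (f ^+ k)%g s0 != s0.
      have ex : exists n, (f ^+ n)%g s0 == x.
        have : x \in porbit f s0 by rewrite porbit_sym (mem_porbit f 1).
        by case/porbitP => n ->; exists n.
      case: (ex_minnP ex) => n /eqP xn nmin; exists n => // k /andP[k0 kn].
      apply/eqP => ks; have /nmin : (f ^+ (n - k))%g s0 == x.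
        by rewrite -{1}ks -permM -expgD subnKC // xn.
      nlia L.
    apply/porbitP; exists n; rewrite perm_run // => k kn.
    rewrite /t1 tpermD //; last by rewrite eq_sym nmin.
    by apply: contraNneq pcs => ->; apply: mem_porbit.
  rewrite porbit_sym; move: s0i; rewrite -eq_porbit_mem => /eqP <-.
  by [].
pose e' := perm2_rel s' a.
have sym' := perm2_rel_sym s' a.
have e's z : connect e' z (s' z).
  by rewrite connect1 // /e' /perm2_rel (mem_porbit s' 1).
have e'a z : connect e' z (a z).
  by rewrite connect1 // /e' /perm2_rel (mem_porbit a 1) orbT.
have e'f z : connect e' z (f' z).
  by rewrite f'E permM; apply: connect_trans (e'a z) (e's _).
have run i j : i <= j -> (forall k, i < k <= j ->
    [&& E k != pa, E k != x, E k != pc & E k != s0]) -> connect e' (E i) (E j).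
  elim: j => [|j IH]; first by rewrite leqn0 => /eqP -> _; apply: connect0.
  rewrite leq_eqVlt => /orP[/eqP -> _|]; first exact: connect0.
  rewrite ltnS => ij avoid.
  have fj : f' (E j) = E j.+1.
    have ijj : i < j.+1 <= j.+1 by rewrite ltnS ij leqnn.
    by have /and4P[? ? ? ?] := avoid j.+1 ijj; rewrite /f' permM orbitS tfix.
  rewrite -fj; apply: connect_trans (IH ij _) (e'f _) => k /andP[k1 k2].
  by apply: avoid; rewrite k1 leqW.
have srun z w : z \notin porbit s pa -> z \notin porbit s pc ->
    w \in porbit s z -> connect e' z w.
  move=> za zc /porbitP[n ->]; elim: n => [|n IH].
    by rewrite expg0 perm1 connect0.
  apply: connect_trans IH _; have := e's ((s ^+ n)%g z).
  rewrite [s' _]permM -[s _]permM -expgSr.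
  have zn : (s ^+ n.+1)%g z \in porbit s z by apply: mem_porbit.
  rewrite tfix //.
  - by apply: contraNneq za => <-; rewrite porbit_sym.
  - apply: contraNneq za => h; rewrite -(inA _ _ xa) porbit_sym.
    by rewrite -h.
  - by apply: contraNneq zc => <-; rewrite porbit_sym.
  - apply: contraNneq zc => h; rewrite -(inC _ _ s0c) porbit_sym.
    by rewrite -h.
have Nx k : k < L -> k.+1 < ic -> E k != x.
  by move=> kL kc; apply/eqP => Ek; have := xpos k kL (esym Ek); nlia L.
have bx : E ib != x by apply: contraNneq Nba => ->.
have dx : E id != x by apply: contraNneq Nda => ->.
have c_x : connect e' x pc by have := e'f x; rewrite f'x.
have c_ab : connect e' pa (E ib).
  apply: run => [|k /andP[k1 k2]]; first exact: ltnW.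
  apply/and4P; split; [apply: Epa|case: (ltnP k ib) => h|apply: Npc|apply: Ns0]; try nlia L.
    by apply: Nx; nlia L.
  by have -> : k = ib by nlia L.
have c_bs : pc != s0 -> connect e' (E ib) s0.
  move=> s0ne.
  apply: connect_trans (run ib ic.-1 _ _) _; first by nlia L.
    move=> k /andP[k1 k2].
    apply/and4P; split; [apply: Epa| |apply: Npc|apply: Ns0]; try nlia L.
    have [kc|kc] := ltnP k.+1 ic; first by apply: Nx; nlia L.
    apply: contraNneq s0ne => h; rewrite -/s0 /s0 -h orbitS /pc.
    by apply/eqP; congr E; nlia L.
  have := e'f (E ic.-1); rewrite f'pre // orbitS prednK //; nlia L.
have c_cd : connect e' pc (E id).
  (* If [x] itself occurs on the walk from [ic] to [id], the direct way is blocked. Going on from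
     [id] past the start of the walk reaches the predecessor of [pa], which [f'] sends to [x], and
     [x] to [pc]. *)
  have [/existsP[/= [j jL] /= /and3P[/eqP xj cj jd]]|] :=
      boolP [exists j : 'I_L, [&& x == E j, ic < j & j < id]].
    have neqj k : k < L -> k != j -> E k != x.
      by move=> kL kj; apply: contraNneq kj; rewrite xj => /(orbit_inj kL jL) ->.
    have neqsj k : k < L -> id < k -> E k != s0.
      move=> kL ik; apply/eqP; rewrite /s0 xj orbitS => /orbit_inj h.
      by have := h kL (_ : j.+1 < L); rewrite [_ < L](_ : _ = true); [move=> /(_ isT); nlia L | nlia L].
    have c_dx : connect e' (E id) x.
      apply: connect_trans (run id (L + ia).-1 _ _) _; first by nlia L.
        move=> k /andP[k1 k2]; have [kL|Lk] := ltnP k L.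
          apply/and4P; split; [apply: Epa; nlia L|apply: neqj; nlia L| |exact: neqsj].
          by apply/eqP => /(Epc _ kL); nlia L.
        rewrite -(subnK Lk) orbit_period; set k' := k - L.
        have kia : k' < ia by rewrite /k'; nlia L.
        apply/and4P; split; [| apply: Nx; nlia L | apply: Npc; nlia L | apply: Ns0; nlia L].
        by apply/eqP => /(orbit_inj (ltn_trans kia aL) aL); nlia L.
      have := e'f (E (L + ia).-1); rewrite f'pa //.
      by rewrite orbitS prednK ?[L + ia]addnC ?orbit_period //; nlia L.
    by rewrite sym'; apply: connect_trans c_dx c_x.
  rewrite negb_exists => /forallP /= nox.
  have nx k : ic <= k -> k <= id -> E k != x.
    move=> k1 k2; have [->//|kd] := eqVneq k id.
    have [->|kc] := eqVneq k ic.
      by apply: contraNneq Nca; rewrite -/pc => ->.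
    have kL : k < L by nlia L.
    have ck : ic < k by rewrite ltn_neqAle eq_sym kc.
    have kd' : k < id by rewrite ltn_neqAle kd.
    by apply/eqP => kx; have := nox (Ordinal kL); rewrite /= kx eqxx ck kd'.
  apply: run => [|k /andP[k1 k2]]; first exact: ltnW.
  apply/and4P; split; [apply: Epa; nlia L|apply: nx; nlia L| |].
    have kL : k < L by nlia L.
    by apply/eqP => /(Epc _ kL); nlia L.
  have := nx k.-1; rewrite -(inj_eq (@perm_inj _ f)) orbitS prednK; last by nlia L.
  by apply; nlia L.
have c_bd : connect e' (E ib) (E id).
  apply: connect_trans (srun _ _ Nba Nbc yb) _.
  by apply: connect_trans (e'a y) _; rewrite sym'; apply: srun yd.
(* Since [y] joins the two sides, the four darts where [s] and [s'] differ lie in one class: the cut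
   does not disconnect. *)
have all4 z : z \in [:: pa; x; pc; s0] -> connect e' pc z.
  have cb : connect e' pc (E ib) by apply: connect_trans c_cd _; rewrite sym'.
  rewrite !inE => /or4P[] /eqP -> //.
  - by apply: connect_trans cb _; rewrite sym'.
  - by rewrite sym'.
  - have [<-//|s0ne] := eqVneq pc s0.
    exact: connect_trans cb (c_bs s0ne).
have e's0 z : connect e' z (s z).
  have h : s' z = (t1 * t2)%g (s z) by rewrite {1}/s' permM.
  have [sz|] := boolP (s z \in [:: pa; x; pc; s0]); last first.
    rewrite !inE !negb_or => /and4P[h1 h2 h3 h4].
    by have := e's z; rewrite h tfix.
  have : s' z \in [:: pa; x; pc; s0].
    rewrite h permM /t1; case: tpermP => [_|_|/eqP h1 /eqP h2]; rewrite /t2;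
      by case: tpermP => *; rewrite !inE ?eqxx ?orbT //; move: sz; rewrite !inE.
  move=> /all4 c1; apply: connect_trans (e's z) _.
  by apply: connect_trans (all4 _ sz); rewrite sym'.
have ncl : nclasses e' <= nclasses (perm2_rel s a).
  apply: nclasses_sub => // z w /orP[]; exact: porbit_ind.
have := genus_ge0 s' a; rewrite -f'E -/e'.
have ar (P P' Q Q' A N N' t : nat) : N' <= N -> P + Q + 2 <= P' + Q' ->
   t + N.*2 < P + A + Q + 2 -> P' + A + Q' <= t + N'.*2 -> False by clear; lia.
exact: ar ncl F' planar.
Qed.
End NoCrossing.

(** * Outerplanar embeddings are crossing-free *)

(** The vertices stand on a circle cut open into a line, and the edges are chords. *)
Definition noncrossing (G : sgraph) (pos : G -> nat) : Prop :=
  injective pos /\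
  forall a b c d, pos a < pos b -> pos b < pos c -> pos c < pos d ->
    sedge a c -> sedge b d -> False.

Lemma porbit_fconnect (T : finType) (s : {perm T}) x y :
  (y \in porbit s x) = fconnect s x y.
Proof.
apply/idP/idP => [/porbitP[i ->]|/iter_findex <-]; last first.
  by apply/porbitP; exists (findex s x y); rewrite permX.
by rewrite permX fconnect_iter.
Qed.

Section Outer.
Variables (G : sgraph) (rot : dart G -> dart G).
Hypothesis rot_sys : rotation_system rot.

Let rot_inj : injective rot := proj1 rot_sys.

Lemma rev_dartK : involutive (@rev_dart G).
Proof. by case=> [[u v] uv]; apply: val_inj. Qed.

Let s := perm rot_inj.
Let a := perm (inv_inj rev_dartK).

Lemma porbit_rot d d' : (d' \in porbit s d) = (tail d == tail d').
Proof.
rewrite porbit_fconnect -(proj2 rot_sys).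
by apply: eq_fconnect => z; rewrite permE.
Qed.

Lemma face_stepE d : face_step rot d = (a * s)%g d.
Proof. by rewrite permM !permE. Qed.

Lemma porbit_face d d' : (d' \in porbit (a * s)%g d) = fconnect (face_step rot) d d'.
Proof.
by rewrite porbit_fconnect; apply: eq_fconnect => z; rewrite -face_stepE.
Qed.

Lemma card_vertices : #|non_isolated G| <= #|porbits s|.
Proof.
pose A x := [set d : dart G | tail d == x].
rewrite -(card_in_imset (f := A)); last first.
  move=> x x'; rewrite inE => /existsP[y xy] _ /setP /(_ (exist _ (x, y) xy)).
  by rewrite !inE /tail /= eqxx => /esym /eqP.
apply: subset_leq_card; apply/subsetP => _ /imsetP[x + ->].
rewrite inE => /existsP[y xy]; apply/imsetP; exists (exist _ (x, y) xy) => //.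
by apply/setP => d; rewrite inE porbit_rot eq_sym.
Qed.

Lemma card_edges : #|dart G| <= #|porbits a|.*2.
Proof.
have -> : #|dart G| = \sum_(B in porbits a) #|[set d | porbit a d == B]|.
  rewrite -sum1_card (partition_big (porbit a) (mem (porbits a))) /=.
    by apply: eq_bigr => B _; rewrite sum1dep_card cardsE.
  by move=> d _; apply: imset_f.
rewrite -muln2 -sum_nat_const; apply: leq_sum => _ /imsetP[d _ ->].
apply: leq_trans (_ : #|[set d; a d]| <= 2); last by rewrite cards2; case: eqP.
apply: subset_leq_card; apply/subsetP => z; rewrite !inE eq_porbit_mem.
case/porbitP => i ->; elim: i => [|i]; first by rewrite expg0 perm1 eqxx.
rewrite expgSr permM => /orP[] /eqP ->; first by rewrite eqxx orbT.
by rewrite !permE rev_dartK eqxx.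
Qed.

Lemma card_faces : fcard (face_step rot) predT <= #|porbits (a * s)%g|.
Proof.
have finj : injective (face_step rot).
  by move=> d d'; rewrite !face_stepE => /perm_inj.
pose R := [set d | d \in fingraph.roots (frel (face_step rot))].
have -> : fcard (face_step rot) predT = #|R|.
  by apply: eq_card => d; rewrite !inE andbT.
rewrite -(card_in_imset (f := porbit (a * s)%g)); last first.
  move=> d d'; rewrite !inE => /eqP dr /eqP dr' /eqP.
  rewrite eq_porbit_mem porbit_sym porbit_face.
  by move=> /(fingraph.rootP (fconnect_sym finj)); rewrite dr dr'.
by apply: subset_leq_card; apply/subsetP => _ /imsetP[d _ ->]; apply: imset_f.
Qed.

Let sym_sedge : connect_sym (@sedge G) := sym_connect_sym (@sedge_sym G).

Lemma connect_dart d d' : connect sedge (tail d) (tail d') ->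
  connect (perm2_rel s a) d d'.
Proof.
case/connectP => p; elim: p d => [|y p IH] d /=.
  by move=> _ td; rewrite connect1 // /perm2_rel porbit_rot td eqxx.
case/andP => dy py lst; pose b : dart G := exist _ (tail d, y) dy.
have /connect_trans-> // : connect (perm2_rel s a) d b.
  by rewrite connect1 // /perm2_rel porbit_rot eqxx.
have /connect_trans-> // : connect (perm2_rel s a) b (a b).
  by rewrite connect1 // /perm2_rel (mem_porbit a 1) orbT.
by apply: IH; rewrite permE.
Qed.

Lemma card_components : nclasses (perm2_rel s a) <= n_comp sedge (non_isolated G).
Proof.
have sym' := perm2_rel_sym s a.
pose f d := fingraph.root sedge (tail (d : dart G)).
rewrite /nclasses.
rewrite -(card_in_imset (f := f)); last first.
  move=> _ _ /imsetP[d _ ->] /imsetP[d' _ ->] /(fingraph.rootP sym_sedge).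
  move=> /connect_dart /(fingraph.rootP sym').
  by rewrite !(fingraph.root_root sym').
apply: subset_leq_card; apply/subsetP => _ /imsetP[d _ ->].
rewrite !inE; apply/andP; split; first exact: roots_root.
rewrite /f; case/connectP: (connect_root sedge (tail d)) => p + ->.
case: (lastP p) => [_|{}p z]; first by apply/existsP; exists (val d).2; case: d.
rewrite last_rcons rcons_path => /andP[_ h].
by apply/existsP; exists (last (tail d) p); rewrite sedge_sym.
Qed.

Hypothesis sph : spherical rot.

(** Euler's formula in the form that [no_crossing] takes: two more vertices or faces without a new
    component would violate [genus_ge0]. *)
Lemma planar_bound : #|dart G| + (nclasses (perm2_rel s a)).*2
  < #|porbits s| + #|porbits a| + #|porbits (a * s)%g| + 2.
Proof.
have h1 := card_vertices; have h2 := card_edges; have h3 := card_faces.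
have h4 := card_components; move: sph; rewrite /spherical.
have ar (V V' A F F' N N' D : nat) : V <= V' -> D <= A.*2 -> F <= F' -> N <= N' ->
  V + F = D./2 + N'.*2 -> D + N.*2 < V' + A + F' + 2 by clear; lia.
exact: ar.
Qed.

Hypothesis outer : outer_vertices rot.

Let is_outer r (o : dart G) := [forall y, connect sedge r y ==>
  [exists d, fconnect (face_step rot) o d && (tail d == y)]].

Let walk r : seq G := if [pick o | is_outer r o] is Some o
  then [seq tail d | d <- traject (a * s)%g o #|porbit (a * s)%g o|] else [::].

Let N := #|dart G|.+1.
(** Components occupy disjoint intervals of length [N]; inside its component a vertex stands at its
    first occurrence on the boundary walk of the outer face. *)
Let outer_pos v :=
  enum_rank (fingraph.root sedge v) * N + index v (walk (fingraph.root sedge v)).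

Let size_walk r : size (walk r) < N.
Proof.
rewrite /walk; case: pickP => //= o _.
by rewrite size_map size_traject /N ltnS max_card.
Qed.

Let index_lt r v : index v (walk r) < N.
Proof. exact: leq_ltn_trans (index_size _ _) (size_walk r). Qed.

Let pos_div v : outer_pos v %/ N = enum_rank (fingraph.root sedge v).
Proof. by rewrite /outer_pos divnMDl // divn_small ?index_lt // addn0. Qed.

Let walk_mem v w : sedge v w -> v \in walk (fingraph.root sedge v).
Proof.
move=> vw; have vni : v \in non_isolated G by rewrite inE; apply/existsP; exists w.
have vr : connect sedge (fingraph.root sedge v) v by rewrite sym_sedge connect_root.
rewrite /walk; case: pickP => [o oP|no]; last first.
  have [o oP] := outer vni; have /negP[] := negbT (no o).
  apply/forallP => y; apply/implyP => ry.
  have [|d od dy] := oP y; first exact: connect_trans (connect_root _ _) ry.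
  by apply/existsP; exists d; rewrite od dy eqxx.
have /existsP[d /andP[od /eqP <-]] := implyP (forallP oP v) vr.
by apply: map_f; rewrite -porbit_traject porbit_face.
Qed.

Lemma outer_pos_noncrossing : noncrossing outer_pos.
Proof.
split=> [v w vw|x1 x2 x3 x4 p12 p23 p34 e13 e24].
  have rvw : fingraph.root sedge v = fingraph.root sedge w.
    by apply/enum_rank_inj/val_inj; rewrite /= -!pos_div vw.
  have [/existsP[u vu]|/existsPn iso] := boolP [exists u, sedge v u]; last first.
    have : connect sedge v w by apply/(fingraph.rootP sym_sedge).
    by case/connectP => -[|z p] //= /andP[h]; have := iso z; rewrite h.
  have vin := walk_mem vu.
  move: vw; rewrite /outer_pos rvw => /addnI iE; rewrite rvw in vin.
  by rewrite -(nth_index v vin) iE nth_index // -index_mem -iE index_mem.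
have root_edge (x y : G) : sedge x y -> fingraph.root sedge x = fingraph.root sedge y.
  by move=> xy; apply/(fingraph.rootP sym_sedge)/connect1.
set r := fingraph.root sedge x1.
have r3 : fingraph.root sedge x3 = r by rewrite /r (root_edge _ _ e13).
(* [x2] stands between [x1] and [x3], hence in the interval of their component. *)
have r2 : fingraph.root sedge x2 = r.
  apply/enum_rank_inj/val_inj/eqP; rewrite /= eqn_leq -{1}r3 /r -!pos_div.
  by rewrite !leq_div2r // ltnW.
have r4 : fingraph.root sedge x4 = r by rewrite -(root_edge _ _ e24).
have m1 := walk_mem e13; have m2 := walk_mem e24.
have m3 : x3 \in walk (fingraph.root sedge x3).
  by apply: (@walk_mem _ x1); rewrite sedge_sym.
have m4 : x4 \in walk (fingraph.root sedge x4).
  by apply: (@walk_mem _ x2); rewrite sedge_sym.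
move: p12 p23 p34; rewrite /outer_pos r2 r3 r4 -/r !ltn_add2l.
move: m1 m2 m3 m4; rewrite r2 r3 r4 -/r /walk.
case: pickP => // o _; set L := #|_|; set w := map _ _ => m1 m2 m3 m4 i12 i23 i34.
have sw : size w = L by rewrite size_map size_traject.
pose E i := ((a * s) ^+ i)%g o.
have wE i : i < L -> nth x1 w i = tail (E i).
  move=> iL; rewrite (nth_map o) ?size_traject // nth_traject //.
  by rewrite /E permX.
have lt v : v \in w -> index v w < L by rewrite -sw index_mem.
have tE v : v \in w -> tail (E (index v w)) = v.
  by move=> vw; rewrite -wE ?lt // nth_index.
have fst v : v \in w -> forall i, i < L -> E i \in porbit s (E (index v w)) ->
    index v w <= i.
  move=> vw i iL; rewrite porbit_rot tE // eq_sym -wE // => /eqP <-.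
  by rewrite leqNgt; apply/negP => /(before_find x1); rewrite /= eqxx.
have neq u v : u \in w -> v \in w -> index u w < index v w ->
    E (index v w) \notin porbit s (E (index u w)).
  move=> uw vw uv; rewrite porbit_rot !tE //.
  by apply: contraTneq uv => ->; rewrite ltnn.
have neq' u v : u \in w -> v \in w -> index u w < index v w ->
    E (index u w) \notin porbit s (E (index v w)).
  by move=> uw vw uv; rewrite porbit_sym neq.
pose d13 : dart G := exist _ (x1, x3) e13.
pose d24 : dart G := exist _ (x2, x4) e24.
have i13 := ltn_trans i12 i23; have i24 := ltn_trans i23 i34.
have i14 := ltn_trans i13 i34.
apply: (@no_crossing _ s a o (index x1 w) (index x2 w) (index x3 w) (index x4 w)
  d13 d24 planar_bound i12 i23 i34 (lt _ m4) (fst _ m1) (fst _ m3)).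
- exact: neq.
- exact: neq'.
- exact: neq.
- exact: neq.
- exact: neq.
- by rewrite porbit_rot tE.
- by rewrite porbit_rot tE // permE.
- by rewrite porbit_rot tE.
- by rewrite porbit_rot tE // permE.
Qed.

End Outer.

Lemma outerplanar_noncrossing (G : sgraph) :
  outerplanar G -> exists pos : G -> nat, noncrossing pos.
Proof.
by case=> rot [rs sph out]; eexists; exact: (outer_pos_noncrossing rs sph out).
Qed.

(** * The blocks, and an outerplane map of two disjoint copies of [G1] *)

Lemma card_fan k : #|fan k| = k.+1.
Proof. by rewrite card_sum card_unit card_ord. Qed.

Lemma card_G1 : #|G1| = 6%N.
Proof. by rewrite card_ord. Qed.

Lemma connected_fan k : connected_graph (fan k).
Proof.
have sym : connect_sym (@sedge (fan k)) := sym_connect_sym (@sedge_sym (fan k)).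
have hub (u : fan k) : connect sedge (inl tt : fan k) u.
  by case: u => [[]|i]; [exact: connect0 | exact: connect1].
by move=> u v; apply: connect_trans (hub v); rewrite sym hub.
Qed.

Lemma connected_G1 : connected_graph G1.
Proof.
have sym : connect_sym (@sedge G1) := sym_connect_sym (@sedge_sym G1).
have hub (u : G1) : connect sedge (inord 4 : G1) u.
  have st (i j : nat) : (i < 6)%N -> (j < 6)%N ->
      ((i, j) \in G1_edges) || ((j, i) \in G1_edges) ->
      connect (@sedge G1) (inord i) (inord j).
    by move=> i6 j6 ij; apply: connect1; rewrite /sedge /= /G1_rel !inordK.
  rewrite -[u]inord_val; case: u => -[|[|[|[|[|[|//]]]]]] i6 /=; try exact: st.
    exact: connect0.
  exact: (connect_trans (st 4%N 1%N isT isT isT) (st 1 5 isT isT isT)).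
by move=> u v; apply: connect_trans (hub v); rewrite sym hub.
Qed.

Lemma n_comp_invariant (T : finType) (T' : eqType) (e : rel T) (a : {pred T}) (h : T -> T') :
  connect_sym e -> closed e a -> (forall x y, connect e x y = (h x == h y)) ->
  n_comp e a = size (undup [seq h x | x <- enum a]).
Proof.
move=> esym ecl hE; pose s := [seq h x | x <- enum [pred x | (x \in fingraph.roots e) && (x \in a)]].
have -> : n_comp e a = size s by rewrite size_map -cardE; apply: eq_card.
apply: perm_size; apply: uniq_perm; [|exact: undup_uniq|].
  rewrite map_inj_in_uniq ?enum_uniq // => x y.
  rewrite !mem_enum !inE => /andP[/eqP xr _] /andP[/eqP yr _] /eqP.
  by rewrite -hE => /(fingraph.rootP esym); rewrite xr yr.
move=> z; rewrite mem_undup; apply/mapP/mapP => -[x xa ->]; last first.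
  exists (fingraph.root e x); last by apply/eqP; rewrite -hE connect_root.
  rewrite mem_enum !inE roots_root //=.
  by rewrite -(closed_connect ecl (connect_root e x)) -[_ \in _](mem_enum a).
exists x => //; move: xa; rewrite !mem_enum inE => /andP[_].
by [].
Qed.

(** The competitor of order 13: with an isolated additional vertex, outerplanarity is easy to
    certify, while [rho2] is that of every bullet graph over [G1]. The map is checked by computation
    on pairs of vertex numbers. *)
Definition two_G1 : sgraph := add_vertex (set0 : {set disjoint_union G1 G1}).

Definition two_G1_code (u : two_G1) : nat := match u with
  | Some (inl i) => val i | Some (inr i) => val i + 6 | None => 12 end.

Definition G1_darts := G1_edges ++ [seq (p.2, p.1) | p <- G1_edges].
Definition two_G1_darts := G1_darts ++ [seq (p.1 + 6, p.2 + 6) | p <- G1_darts].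

(* The neighbours of each vertex in their cyclic order around the vertex, for *)
(* the drawing with outer cycle [0, 1, 5, 2, 3, 4].                           *)
Definition G1_rotation := [:: [:: 1; 4]; [:: 5; 2; 4; 0]; [:: 3; 4; 1; 5];
  [:: 4; 2]; [:: 0; 1; 2; 3]; [:: 2; 1]].

Definition next_dart (p : nat * nat) : nat * nat :=
  if p.1 < 6 then (p.1, next (nth [::] G1_rotation p.1) p.2)
  else (p.1, next (nth [::] G1_rotation (p.1 - 6)) (p.2 - 6) + 6).

Definition next_face (p : nat * nat) := next_dart (p.2, p.1).

(** The dart of the face of [p] that comes first in [two_G1_darts]; 36, the number of darts, exceeds
    every index. *)
Definition face_rep p :=
  let s := [seq iter i next_face p | i <- iota 0 6] in
  nth (0, 0) two_G1_darts (foldr minn 36 [seq index q two_G1_darts | q <- s]).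

Lemma next_dart_mem :
  all (fun p => next_dart p \in two_G1_darts) two_G1_darts.
Proof. by vm_compute. Qed.

(** The vertex degrees are 2 and 4. *)
Lemma next_dart_order :
  all (fun p => iter 4 next_dart p == p) two_G1_darts.
Proof. by vm_compute. Qed.

(** The faces are triangles and two outer hexagons. *)
Lemma next_face_order :
  all (fun p => iter 6 next_face p == p) two_G1_darts.
Proof. by vm_compute. Qed.

Lemma next_dart_orbit :
  all (fun p => all (fun q => (p.1 == q.1) ==>
    has (fun i => iter i next_dart p == q) (iota 0 4)) two_G1_darts) two_G1_darts.
Proof. by vm_compute. Qed.

Lemma face_rep_orbit :
  all (fun p => has (fun i => iter i next_face p == face_rep p) (iota 0 6))
    two_G1_darts.
Proof. by vm_compute. Qed.

Lemma face_rep_next :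
  all (fun p => face_rep p == face_rep (next_face p)) two_G1_darts.
Proof. by vm_compute. Qed.

Lemma two_G1_darts_lt :
  all (fun p : nat * nat => (p.1 < 12) && (p.2 < 12)) two_G1_darts.
Proof. by vm_compute. Qed.

Lemma two_G1_darts_side :
  all (fun p : nat * nat => p.1 %/ 6 == p.2 %/ 6) two_G1_darts.
Proof. by vm_compute. Qed.

Lemma two_G1_darts_tail :
  all (fun k => has (fun p : nat * nat => p.1 == k) two_G1_darts) (iota 0 12).
Proof. by vm_compute. Qed.

Lemma outer_dart :
  all (fun k => (6 * (k %/ 6), 6 * (k %/ 6) + 1) \in two_G1_darts) (iota 0 12).
Proof. by vm_compute. Qed.

Lemma outer_face :
  all (fun k => has (fun i =>
    (iter i next_face (6 * (k %/ 6), 6 * (k %/ 6) + 1)).1 == k) (iota 0 6)) (iota 0 12).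
Proof. by vm_compute. Qed.

Lemma card_face_rep :
  size (undup [seq face_rep p | p <- two_G1_darts]) = 10.
Proof. by vm_compute. Qed.

Lemma two_G1_code_inj : injective two_G1_code.
Proof.
move=> [[i|i]|] [[j|j]|] //= h.
- by do 2!congr (_ _); apply: val_inj.
- by have := ltn_ord i; lia.
- by have := ltn_ord i; lia.
- by have := ltn_ord j; lia.
- by do 2!congr (_ _); apply: val_inj => /=; lia.
- by have := ltn_ord i; lia.
- by have := ltn_ord j; lia.
- by have := ltn_ord j; lia.
Qed.

Lemma two_G1_edge (u v : two_G1) :
  sedge u v = ((two_G1_code u, two_G1_code v) \in two_G1_darts).
Proof.
case: u v => [[[i i6]|[i i6]]|] [[[j j6]|[j j6]]|] //=; rewrite ?inE.
- by case: i i6 => [|[|[|[|[|[|]]]]]] //; case: j j6 => [|[|[|[|[|[|]]]]]].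
- by case: i i6 => [|[|[|[|[|[|]]]]]] //; case: j j6 => [|[|[|[|[|[|]]]]]].
- by case: i i6 => [|[|[|[|[|[|]]]]]].
- by case: i i6 => [|[|[|[|[|[|]]]]]] //; case: j j6 => [|[|[|[|[|[|]]]]]].
- by case: i i6 => [|[|[|[|[|[|]]]]]] //; case: j j6 => [|[|[|[|[|[|]]]]]].
- by case: i i6 => [|[|[|[|[|[|]]]]]].
- by case: j j6 => [|[|[|[|[|[|]]]]]].
- by case: j j6 => [|[|[|[|[|[|]]]]]].
Qed.

Lemma two_G1_vertex k : k < 12 -> exists u, two_G1_code u = k.
Proof.
move=> k12; have [k6|k6] := ltnP k 6; first by exists (Some (inl (Ordinal k6))).
have k6' : k - 6 < 6 by lia.
by exists (Some (inr (Ordinal k6'))) => /=; lia.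
Qed.

Definition dart_code (d : dart two_G1) := (two_G1_code (val d).1, two_G1_code (val d).2).

Lemma dart_code_inj : injective dart_code.
Proof.
by move=> [[u v] uv] [[u' v'] uv'] [/two_G1_code_inj uu /two_G1_code_inj vv]; apply: val_inj; congr pair.
Qed.

Lemma dart_code_mem d : dart_code d \in two_G1_darts.
Proof. by case: d => [[u v] uv]; rewrite /dart_code -two_G1_edge. Qed.

Lemma dart_code_surj p : p \in two_G1_darts -> exists d, dart_code d = p.
Proof.
move=> pE; have /andP[p1 p2] := allP two_G1_darts_lt p pE.
have [u uE] := two_G1_vertex p1; have [v vE] := two_G1_vertex p2.
have uv : sedge u v by rewrite two_G1_edge uE vE -surjective_pairing.
by exists (exist _ (u, v) uv); rewrite /dart_code /= uE vE -surjective_pairing.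
Qed.

Definition rot_two_G1 (d : dart two_G1) : dart two_G1 :=
  odflt d [pick d' | dart_code d' == next_dart (dart_code d)].

Lemma rot_code d : dart_code (rot_two_G1 d) = next_dart (dart_code d).
Proof.
rewrite /rot_two_G1; case: pickP => [d' /eqP //|no].
have := allP next_dart_mem _ (dart_code_mem d).
by case/dart_code_surj => d' dE; have := no d'; rewrite dE eqxx.
Qed.

Lemma face_code d : dart_code (face_step rot_two_G1 d) = next_face (dart_code d).
Proof. by rewrite rot_code; case: d. Qed.

Lemma iter_rot_code i d : dart_code (iter i rot_two_G1 d) = iter i next_dart (dart_code d).
Proof. by elim: i => //= i IH; rewrite rot_code IH. Qed.

Lemma iter_face_code i d :
  dart_code (iter i (face_step rot_two_G1) d) = iter i next_face (dart_code d).
Proof. by elim: i => //= i IH; rewrite face_code IH. Qed.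

Lemma rot_two_G1_inj : injective rot_two_G1.
Proof.
apply: (can_inj (g := iter 3 rot_two_G1)) => d; apply: dart_code_inj.
rewrite -iterSr iter_rot_code.
exact/eqP/(allP next_dart_order _ (dart_code_mem d)).
Qed.

Lemma face_two_G1_inj : injective (face_step rot_two_G1).
Proof.
apply: (can_inj (g := iter 5 (face_step rot_two_G1))) => d; apply: dart_code_inj.
rewrite -iterSr iter_face_code.
exact/eqP/(allP next_face_order _ (dart_code_mem d)).
Qed.

Lemma rot_two_G1_system : rotation_system rot_two_G1.
Proof.
split; first exact: rot_two_G1_inj.
move=> d d'; apply/idP/eqP => [/iter_findex <-|tE].
  elim: findex => // i IH; rewrite IH; apply: two_G1_code_inj.
  have := congr1 fst (rot_code (iter i rot_two_G1 d)).
  by rewrite /next_dart /dart_code /=; case: ifP.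
have same : (dart_code d).1 = (dart_code d').1 by rewrite /dart_code -/(tail d) tE.
have := allP (allP next_dart_orbit _ (dart_code_mem d)) _ (dart_code_mem d').
move=> /implyP/(_ (introT eqP same))/hasP[i _ /eqP iE].
have -> : d' = iter i rot_two_G1 d by apply: dart_code_inj; rewrite iter_rot_code.
exact: fconnect_iter.
Qed.

Lemma face_connect d d' : fconnect (face_step rot_two_G1) d d' =
  (face_rep (dart_code d) == face_rep (dart_code d')).
Proof.
have fsym := fconnect_sym face_two_G1_inj.
have rep0 b : exists2 i, i \in iota 0 6 & iter i next_face (dart_code b) = face_rep (dart_code b).
  have /hasP[i i6 /eqP iE] := allP face_rep_orbit _ (dart_code_mem b).
  by exists i.
apply/idP/eqP => [/iter_findex <-|rE].
  elim: findex => [|i ->]; first exact: erefl.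
  rewrite [in RHS]iterS face_code.
  exact/eqP/(allP face_rep_next _ (dart_code_mem (iter i (face_step rot_two_G1) d))).
have [i _ iE] := rep0 d; have [j _ jE] := rep0 d'.
have ij : iter i (face_step rot_two_G1) d = iter j (face_step rot_two_G1) d'.
  apply: dart_code_inj; rewrite 2!iter_face_code.
  exact: (etrans iE (etrans rE (esym jE))).
have h1 := fconnect_iter (face_step rot_two_G1) i d.
have h2 := fconnect_iter (face_step rot_two_G1) j d'.
by rewrite ij in h1; rewrite fsym in h2; exact: connect_trans h1 h2.
Qed.

Definition side (u : two_G1) := two_G1_code u %/ 6.

Lemma connect_two_G1 (u v : two_G1) : connect sedge u v = (side u == side v).
Proof.
apply/idP/eqP => [/connectP[p + ->]|].
  elim: p u => //= w p IH u /andP[uw /IH <-].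
  have {}uw : sedge (u : two_G1) (w : two_G1) := uw; rewrite two_G1_edge in uw.
  exact/eqP/(allP two_G1_darts_side _ uw).
have lift (f : G1 -> two_G1) : (forall x y, sedge x y -> sedge (f x) (f y)) ->
    forall x y, connect sedge (f x) (f y).
  move=> fE x y; case/connectP: (connected_G1 x y) => p + ->.
  elim: p x => [|z p IH] x /=; first by move=> _; exact: connect0.
  by case/andP => xz /IH; apply: connect_trans; apply: connect1; exact: fE.
have sl (i : 'I_6) : side (Some (inl i)) = 0 by rewrite /side /= divn_small.
have sr (i : 'I_6) : side (Some (inr i)) = 1.
  by have := ltn_ord i; rewrite /side /=; lia.
case: u v => [[i|i]|] [[j|j]|]; rewrite ?sl ?sr // => _.
- exact: (lift (fun x => Some (inl x))).
- exact: (lift (fun x => Some (inr x))).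
Qed.

Lemma mem_non_isolated u : (u \in non_isolated two_G1) = (two_G1_code u < 12).
Proof.
rewrite inE; apply/existsP/idP => [[v]|u12].
  rewrite two_G1_edge => uv.
  by case/andP: (allP two_G1_darts_lt _ uv).
have : two_G1_code u \in iota 0 12 by rewrite mem_iota.
move=> /(allP two_G1_darts_tail) /hasP[p pE /eqP pu]; have [d dE] := dart_code_surj pE.
exists (val d).2; have -> : u = (val d).1; last by case: d {dE}.
by apply: two_G1_code_inj; rewrite -pu -dE.
Qed.

Lemma two_G1_outerplanar : outerplanar two_G1.
Proof.
exists rot_two_G1; split; first exact: rot_two_G1_system.
  have codes : [seq dart_code d | d <- enum (dart two_G1)] =i two_G1_darts.
    move=> p; apply/mapP/idP => [[d _ ->]|/dart_code_surj[d <-]]; first exact: dart_code_mem.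
    by exists d; rewrite ?mem_enum.
  rewrite /spherical; have -> : #|dart two_G1| = 36.
    rewrite cardE -(size_map dart_code); apply: (@perm_size _ _ two_G1_darts).
    apply: (uniq_perm _ _ codes) => //.
    by rewrite (map_inj_uniq dart_code_inj) enum_uniq.
  have vcodes : [seq two_G1_code u | u <- enum (non_isolated two_G1)] =i iota 0 12.
    move=> k; rewrite mem_iota; apply/mapP/idP => [[u]|k12].
      by rewrite mem_enum mem_non_isolated => u12 ->.
    have [u uE] := two_G1_vertex k12.
    by exists u; rewrite ?mem_enum ?mem_non_isolated ?uE.
  have -> : #|non_isolated two_G1| = 12.
    rewrite cardE -(size_map two_G1_code) -(size_iota 0 12); apply: perm_size.
    apply: (uniq_perm _ _ vcodes); last exact: iota_uniq.
    by rewrite (map_inj_uniq two_G1_code_inj) enum_uniq.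
  have -> : fcard (face_step rot_two_G1) predT = 10.
    rewrite (n_comp_invariant (fconnect_sym face_two_G1_inj) _ face_connect) //.
    rewrite (map_comp face_rep dart_code).
    rewrite -card_face_rep; apply: perm_size; apply: uniq_perm; rewrite ?undup_uniq // => p.
    rewrite !mem_undup; apply: eq_mem_map => q; rewrite -codes.
    by apply: eq_mem_map => d; rewrite !mem_enum.
  have -> : n_comp sedge (non_isolated two_G1) = 2.
    rewrite (n_comp_invariant (h := side) _ _ connect_two_G1) //.
    - rewrite (map_comp (divn^~ 6) two_G1_code).
      have -> : 2 = size (undup [seq k %/ 6 | k <- iota 0 12]) by [].
      apply: perm_size; apply: uniq_perm; rewrite ?undup_uniq // => p.
      by rewrite !mem_undup; apply: eq_mem_map => q; rewrite -vcodes.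
    - exact: sym_connect_sym (@sedge_sym two_G1).
    move=> u v uv; rewrite !mem_non_isolated.
    move: uv; rewrite two_G1_edge => uv.
    by case/andP: (allP two_G1_darts_lt _ uv) => -> ->.
  by [].
move=> x; rewrite mem_non_isolated => x12.
have [o oE] : exists o, dart_code o = (6 * side x, 6 * side x + 1).
  apply: dart_code_surj; rewrite /side.
  have : two_G1_code x \in iota 0 12 by rewrite mem_iota.
  exact: (allP outer_dart).
exists o => y; rewrite connect_two_G1 => /eqP xy.
have y12 : two_G1_code y \in iota 0 12.
  by rewrite mem_iota /=; move: xy x12; rewrite /side; lia.
have /hasP[i _ /eqP iE] := allP outer_face _ y12.
exists (iter i (face_step rot_two_G1) o); first exact: fconnect_iter.
apply: two_G1_code_inj; rewrite -iE -/(side y) -xy -oE -iter_face_code.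
by [].
Qed.

(** * Triangulated polygons *)

(* A triangulation of the polygon with vertices [i, ..., i + (inner t).+1];   *)
(* [Node l r] is the triangle on the side joining the first and last vertices *)
(* together with triangulations beyond its two other sides.                   *)
Inductive tri := Leaf | Node of tri & tri.

Fixpoint inner t := if t is Node l r then (inner l + inner r).+1 else 0.

Fixpoint edges i t : seq (nat * nat) :=
  (i, i + (inner t).+1) ::
  if t is Node l r then edges i l ++ edges (i + (inner l).+1) r else [::].

Definition noncrossing_on (e : rel nat) i j := forall a b c d,
  i <= a -> a < b -> b < c -> c < d -> d <= j -> e a c -> e b d -> False.

(** The apex over the base is the farthest neighbour of [i] before the last vertex, or [i.+1] if
    there is none. An edge other than the base that straddles the apex would start at [i], against
    this choice, or cross the edge from [i] to the apex. *)
Lemma tri_cover e i k : noncrossing_on e i (i + k.+1) -> exists2 t,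
  inner t = k & forall a b, i <= a -> a < b -> b <= i + k.+1 -> e a b ->
  (a, b) \in edges i t.
Proof.
have [n] := ubnP k; elim: n => // n IH in i k *; rewrite ltnS => kn nc.
case: k => [|k] in kn nc *.
  exists Leaf => // a b ia ab bi _; rewrite /= inE xpair_eqE; lia.
have [l [il lj lP]] : exists l, [/\ i < l, l < i + k.+2 &
    forall a b, i <= a -> a < b -> b <= i + k.+2 -> e a b ->
    [|| (a == i) && (b == i + k.+2), b <= l | l <= a]].
  have [ex|nex] := boolP (has (fun l => e i l) (iota i.+1 k.+1)); last first.
    exists i.+1; split; try lia; move=> a b ia ab bi eab.
    have [ai|ai] := eqVneq a i; last by lia.
    have [bj|bj] := eqVneq b (i + k.+2); first by [].
    move/hasPn/(_ b): nex; rewrite mem_iota -ai eab => h.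
    by have : false by apply: h; lia.
  have [l le lmax] : exists2 l, e i l && (i < l < i + k.+2) &
      forall l', e i l' -> l' < i + k.+2 -> l' <= l.
    have exl : exists l, e i l && (i < l < i + k.+2).
      by case/hasP: ex => l; rewrite mem_iota => h el; exists l; rewrite el; lia.
    have bnd l : e i l && (i < l < i + k.+2) -> l <= i + k.+2 by lia.
    case: (ex_maxnP exl bnd) => l lP lmax; exists l => // l' el' l'j.
    by have [il'|] := ltnP i l'; [apply: lmax; rewrite el' il' | lia].
  case/and3P: le => eil il lj; exists l; split=> // a b ia ab bj eab.
  have [ai|ai] := eqVneq a i.
    have [bj'|bj'] := eqVneq b (i + k.+2); first by [].
    by rewrite lmax ?orbT // -?ai //; lia.
  have [bl|lb] := leqP b l; first by rewrite orbT.
  have [la|al] := leqP l a; first by rewrite orbT.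
  case: (nc i a l b) => //; lia.
have [||tl tlk tlP] := IH i (l - i).-1; first by lia.
  by move=> a b c d ia ab bc cd dj; apply: nc ab bc cd _; lia.
have [||tr trk trP] := IH l (i + k.+2 - l).-1; first by lia.
  by move=> a b c d ia ab bc cd dj; apply: nc ab bc cd _; lia.
exists (Node tl tr) => [|a b ia ab bj eab]; first by rewrite /= tlk trk; lia.
rewrite inE /= tlk trk mem_cat.
have -> : i + (l - i).-1.+1 = l by lia.
case/or3P: (lP a b ia ab bj eab) => [/andP[/eqP -> /eqP ->]|bl|la].
- by rewrite xpair_eqE eqxx /=; apply/orP; left; lia.
- by rewrite tlP ?orbT //; lia.
- by rewrite trP ?orbT //; lia.
Qed.


Lemma edges_bound i t a b : (a, b) \in edges i t ->
  [&& i <= a, a < b & b <= i + (inner t).+1].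
Proof.
elim: t i => [|l IHl r IHr] i; first by rewrite /= inE xpair_eqE; lia.
rewrite inE xpair_eqE => /orP[/=|]; first by lia.
by rewrite mem_cat => /orP[/IHl|/IHr] /=; lia.
Qed.

(** * Enumeration of all triangulations through the values of a fold *)

Section Folds.
Variables (X : Type) (leaf : X) (node : X -> X -> X).

Fixpoint tri_fold t := if t is Node l r then node (tri_fold l) (tri_fold r) else leaf.

(** Row [k] lists the fold values of all triangulations with [k] inner vertices. Rows are reused and
    no tree is built, which keeps the enumeration feasible. *)
Fixpoint fold_table n : seq (seq X) :=
  if n is k.+1 then
    let s := fold_table k in
    rcons s (List.flat_map (fun j => List.flat_map (fun l =>
      List.map (node l) (nth [::] s (k - j))) (nth [::] s j)) (iota 0 k.+1))
  else [:: [:: leaf]].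

Lemma fold_tableS k : fold_table k.+1 =
  rcons (fold_table k) (List.flat_map (fun j => List.flat_map (fun l =>
    List.map (node l) (nth [::] (fold_table k) (k - j)))
      (nth [::] (fold_table k) j)) (iota 0 k.+1)).
Proof. by []. Qed.

Lemma size_fold_table n : size (fold_table n) = n.+1.
Proof. by elim: n => //= n IH; rewrite size_rcons IH. Qed.

Lemma nth_fold_table n k : k <= n ->
  nth [::] (fold_table n) k = nth [::] (fold_table k) k.
Proof.
elim: n => [|n IH]; first by case: k.
rewrite leq_eqVlt => /orP[/eqP -> //|kn].
by rewrite fold_tableS nth_rcons size_fold_table kn IH.
Qed.

Lemma In_mem (T : eqType) (x : T) s : x \in s -> List.In x s.
Proof.
by elim: s => //= y s IH; rewrite inE => /orP[/eqP ->|/IH]; [left | right].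
Qed.

Lemma In_fold_table t :
  List.In (tri_fold t) (nth [::] (fold_table (inner t)) (inner t)).
Proof.
elim: t => [|l IHl r IHr]; first by left.
rewrite [inner _]/= fold_tableS nth_rcons size_fold_table ltnn eqxx.
apply/List.in_flat_map; exists (inner l); split.
  by apply: In_mem; rewrite (mem_iota 0); lia.
apply/List.in_flat_map; exists (tri_fold l).
rewrite !nth_fold_table ?addKn; try lia; split=> //.
exact: List.in_map.
Qed.

Lemma fold_table_all (P : X -> bool) k :
  List.forallb P (nth [::] (fold_table k) k) ->
  forall t, inner t = k -> P (tri_fold t).
Proof.
by move=> h t tk; apply: (proj1 (List.forallb_forall P _) h); rewrite -tk; apply: In_fold_table.
Qed.

End Folds.

Definition fan_edges m c (es : seq (nat * nat)) := forall a b, (a, b) \in es ->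
  [\/ a = c, b = c, b = a.+1 | a = 0 /\ b = m.-1].

Section Elimination.
(* Fixed-point arithmetic with denominator [D]: eliminating the inner vertices *)
(* of a region from the quadratic form [(T / D) |x|^2 - form x] leaves         *)
(* [- (p x_i^2 + 2 q x_i x_j + s x_j^2) / D] on its two end vertices.          *)
Variables T D : N.

(** Eliminates the apex by completing the square with pivot [d]; each base edge of the two
    subregions adds [D] to its mixed coefficient. [N.succ] rounds the quotients up, and [None]
    records a pivot that is not positive. *)
Definition schur_node (x y : option (N * N * N)) :=
  match x, y with
  | Some (pl, ql, sl), Some (pr, qr, sr) =>
    let d := (T - (sl + pr))%num in
    let a := (D + ql)%num in let b := (D + qr)%num in
    if (sl + pr <? T)%num then
      Some (pl + N.succ (a * a / d), N.succ (a * b / d),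
            sr + N.succ (b * b / d))%num
    else None
  | _, _ => None
  end.

Definition schur := tri_fold (Some (0, 0, 0)%num) schur_node.

(** With the last base edge added, the binary form in the two end variables is positive
    semidefinite. *)
Definition schur_ok x :=
  if x is Some (p, q, s) then
    [&& (p <? T), (s <? T) & ((D + q) * (D + q) <=? (T - p) * (T - s))]%num
  else false.

Variables (R : realFieldType) (x : nat -> R).
Hypothesis x0 : forall i, (0 <= x i)%R.
Hypothesis D0 : (0 < D)%num.

Local Open Scope ring_scope.
Let r (n : N) : R := (N.to_nat n)%:R.

Let rD a b : r (a + b)%num = r a + r b.
Proof. by rewrite /r N2Nat.inj_add -natrD. Qed.
Let rM a b : r (a * b)%num = r a * r b.
Proof. by rewrite /r N2Nat.inj_mul -natrM. Qed.
Let r_ge0 a : 0 <= r a. Proof. exact: ler0n. Qed.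
Let r_lt a b : (a < b)%num -> r a < r b.
Proof. by rewrite /r ltr_nat; lia. Qed.
Let r_le a b : (a <= b)%num -> r a <= r b.
Proof. by rewrite /r ler_nat; lia. Qed.
Let rB a b : (b <= a)%num -> r (a - b)%num = r a - r b.
Proof. by move=> ba; rewrite -[in r a](N.sub_add b a) // rD addrK. Qed.

Definition edge_sum (es : seq (nat * nat)) := \sum_(p <- es) x p.1 * x p.2.

(** The base edge is left out because the region on its other side shares it; the caller accounts
    for it. *)
Lemma schurP t i p q s : schur t = Some (p, q, s) ->
  let j := (i + (inner t).+1)%N in
  2 * r D * edge_sum (behead (edges i t)) <=
  r T * \sum_(i.+1 <= a < j) x a ^+ 2
  + r p * x i ^+ 2 + 2 * r q * (x i * x j) + r s * x j ^+ 2.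
Proof.
elim: t i p q s => [|tl IHl tr IHr] i p q s.
  by case=> <- <- <- /=; rewrite /edge_sum big_nil addn1 big_geq // !mulr0 !mul0r !addr0.
have -> : schur (Node tl tr) = schur_node (schur tl) (schur tr) by [].
case El: (schur tl) => [[[pl ql] sl]|] //.
case Er: (schur tr) => [[[pr qr] sr]|] //=.
case: N.ltb_spec => // lt [<- <- <-].
set z := (i + (inner tl).+1)%N; set j := (i + _)%N.
have jE : j = (z + (inner tr).+1)%N by rewrite /j /z; lia.
have := IHr z _ _ _ Er; have := IHl i _ _ _ El; rewrite -/z /= -jE.
set dd := (T - (sl + pr))%num.
have dE : r dd = r T - r sl - r pr.
  by rewrite /dd rB ?rD; [ring | exact: N.lt_le_incl].
have d0 : 0 < r dd by rewrite dE -addrA -opprD subr_gt0 -rD r_lt.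
have succ_div a b : r a * r b <= r (N.succ (a * b / dd)%num) * r dd.
  rewrite -!rM; apply/r_le/N.lt_le_incl; rewrite [(N.succ _ * _)%num]N.mul_comm.
  by apply: N.mul_succ_div_gt => d00; rewrite d00 /r ltxx in d0.
move: (succ_div (D + ql) (D + ql))%num (succ_div (D + ql) (D + qr))%num
  (succ_div (D + qr) (D + qr))%num; rewrite !rD.
set c1 := r (N.succ _); set c2 := r (N.succ _); set c3 := r (N.succ _).
have hcat es es' : edge_sum (es ++ es') = edge_sum es + edge_sum es'.
  by rewrite /edge_sum big_cat.
have hcons k t : edge_sum (edges k t) =
    x k * x (k + (inner t).+1)%N + edge_sum (behead (edges k t)).
  by case: t => *; rewrite /edge_sum /= big_cons.
rewrite hcat !hcons -/z -jE.
rewrite [\sum_(i.+1 <= a < j) _](@big_cat_nat _ _ _ z) /=; [|lia|lia].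
rewrite [\sum_(z <= a < j) _]big_ltn; last by lia.
move: (edge_sum _) (edge_sum _) (\sum_(_ <= _ < _) _) (\sum_(_ <= _ < _) _).
move=> El' Er' Sl Sr h1 h2 h3 hl hr.
(* The square completed at [x z]. As the entries of [x] are nonnegative, rounding up the mixed
   coefficient is harmless too. *)
have key : 2 * (r D + r ql) * (x i * x z) + 2 * (r D + r qr) * (x z * x j)
   <= r dd * x z ^+ 2 + c1 * x i ^+ 2 + 2 * c2 * (x i * x j) + c3 * x j ^+ 2.
  rewrite -(ler_pM2l d0).
  have xij : 0 <= x i * x j by rewrite mulr_ge0.
  have xii : 0 <= x i ^+ 2 by rewrite sqr_ge0.
  have xjj : 0 <= x j ^+ 2 by rewrite sqr_ge0.
  have h1' := ler_wpM2r xii h1; have h2' := ler_wpM2r xij h2.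
  have h3' := ler_wpM2r xjj h3.
  have sq := sqr_ge0 (r dd * x z - (r D + r ql) * x i - (r D + r qr) * x j).
  lra.
rewrite dE in key; lra.
Qed.

Lemma schur_okP t : schur_ok (schur t) ->
  2 * edge_sum (edges 0 t) <=
  (r T / r D) * \sum_(0 <= a < (inner t).+2) x a ^+ 2.
Proof.
case Et: (schur t) => [[[p q] s]|] //= /and3P[/N.ltb_spec0 pT /N.ltb_spec0 sT].
move=> /N.leb_spec0 det.
have rD0 : 0 < r D by have := r_lt D0; rewrite /r.
have := schurP 0 Et; rewrite add0n /=; set j := (inner t).+1.
have -> : edge_sum (edges 0 t) = x 0%N * x j + edge_sum (behead (edges 0 t)).
  by case: (t) @j => *; rewrite /edge_sum /= big_cons.
have -> : \sum_(0 <= a < j.+1) x a ^+ 2 =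
    x 0%N ^+ 2 + \sum_(1 <= a < j) x a ^+ 2 + x j ^+ 2.
  by rewrite big_nat_recr //=; congr (_ + _); rewrite big_ltn.
have {det} := r_le det; rewrite !rM rD !rB; try exact: N.lt_le_incl.
have {pT} := r_lt pT; have {sT} := r_lt sT; have := r_ge0 q.
have := x0 0; have := x0 j.
move: (edge_sum _) (\sum_(_ <= _ < _) _) (x 0%N) (x j) => E S a b.
move=> b0 a0 q0 sT pT det h.
rewrite -(ler_pM2l rD0); have -> : r D * (r T / r D * (a ^+ 2 + S + b ^+ 2)) =
  r T * (a ^+ 2 + S + b ^+ 2) by field; rewrite gt_eqF.
suff : 2 * (r D + r q) * (a * b) <= (r T - r p) * a ^+ 2 + (r T - r s) * b ^+ 2 by lra.
have P0 : 0 < r T - r p by rewrite subr_gt0.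
rewrite -(ler_pM2l P0).
have bb : 0 <= b ^+ 2 by rewrite sqr_ge0.
have := ler_wpM2r bb det.
have := sqr_ge0 ((r T - r p) * a - (r D + r q) * b); lra.
Qed.

End Elimination.

(** * Recognition of fans, and the computed certificates *)

Definition is_leaf t := if t is Leaf then true else false.
(** Relative to the base, the hub of a fan is the first vertex, the last vertex, or the apex of the
    base triangle. *)
Fixpoint left_fan t := if t is Node l r then left_fan l && is_leaf r else true.
Fixpoint right_fan t := if t is Node l r then right_fan r && is_leaf l else true.
Definition middle_fan t := if t is Node l r then right_fan l && left_fan r else true.

Lemma left_fanP t i a b : left_fan t -> (a, b) \in edges i t -> a = i \/ b = a.+1.
Proof.
elim: t i => [|l IHl r _] i /=; first by rewrite inE xpair_eqE; lia.
case/andP => fl lr; rewrite inE xpair_eqE => /orP[|]; first by lia.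
rewrite mem_cat => /orP[/(IHl _ fl) //|].
by case: r lr => //= _; rewrite inE xpair_eqE; lia.
Qed.

Lemma right_fanP t i a b : right_fan t -> (a, b) \in edges i t ->
  b = i + (inner t).+1 \/ b = a.+1.
Proof.
elim: t i => [|l _ r IHr] i /=; first by rewrite inE xpair_eqE; lia.
case/andP => fr; case: l => //= _; rewrite inE xpair_eqE => /orP[|]; first by lia.
rewrite inE xpair_eqE => /orP[|/(IHr _ fr)]; lia.
Qed.

Lemma fan_treeP t : [|| left_fan t, right_fan t | middle_fan t] ->
  exists2 c, c < (inner t).+2 & fan_edges (inner t).+2 c (edges 0 t).
Proof.
case/or3P => ft.
- by exists 0 => // a b /(left_fanP ft)[->|->]; [constructor 1 | constructor 3].
- exists (inner t).+1 => // a b /(right_fanP ft)[->|->]; first by rewrite add0n; constructor 2.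
  by constructor 3.
case: t ft => [|l r] /=.
  by exists 0 => // a b; rewrite inE => /eqP[-> ->]; constructor.
case/andP => fl fr; exists (inner l).+1; first by lia.
move=> a b; rewrite inE mem_cat => /or3P[/eqP[-> ->]|/(right_fanP fl)|/(left_fanP fr)].
- by constructor 4.
- by rewrite add0n => -[->|->]; [constructor 2 | constructor 3].
- by case=> [->|->]; [constructor 1 | constructor 3].
Qed.

Definition fan_info := (option (N * N * N) * (bool * bool * bool * bool))%type.

Definition info_leaf : fan_info := (Some (0, 0, 0)%num, (true, true, true, true)).

(** The flags (leaf, left, right and middle fan) travel with the elimination data, so that fans are
    recognized without their trees. *)
Definition info_node T D (x y : fan_info) : fan_info :=
  let: (s1, (i1, l1, r1, _)) := x in
  let: (s2, (i2, l2, r2, _)) := y in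
  (schur_node T D s1 s2, (false, l1 && i2, r2 && i1, r1 && l2)).

Lemma info_fold T D t : tri_fold info_leaf (info_node T D) t =
  (schur T D t, (is_leaf t, left_fan t, right_fan t, middle_fan t)).
Proof. by elim: t => //= l -> r ->. Qed.

Definition info_ok T D (x : fan_info) :=
  let: (s, (_, l, r, c)) := x in schur_ok T D s || [|| l, r | c].

(* Every triangulation of the [m]-gon is a fan or has largest eigenvalue at    *)
(* most [T / D].                                                               *)
Definition fan_check m T D := List.forallb (info_ok T D)
  (nth [::] (fold_table info_leaf (info_node T D) (m - 2)) (m - 2)).

Lemma fan_checkP m T D : fan_check m T D -> forall t, inner t = m - 2 ->
  schur_ok T D (schur T D t) \/
  exists2 c, c < (inner t).+2 & fan_edges (inner t).+2 c (edges 0 t).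
Proof.
move=> chk t tk; have := fold_table_all chk tk.
by rewrite info_fold => /orP[ok|/fan_treeP ok]; [left | right].
Qed.

(** [G1] is the hexagon triangulated around an inner triangle; [sun_left] uses the inner triangle 0,
    2, 4 and [sun_right] the triangle 1, 3, 5. *)
Definition sun_left := edges 0 (Node (Node (Node Leaf Leaf) (Node Leaf Leaf)) Leaf).
Definition sun_right := edges 0 (Node Leaf (Node (Node Leaf Leaf) (Node Leaf Leaf))).

Definition sun_check T D := List.forallb (fun t =>
    [|| schur_ok T D (schur T D t), edges 0 t == sun_left | edges 0 t == sun_right])
  (nth [::] (fold_table Leaf Node 4) 4).

Lemma tri_fold_id t : tri_fold Leaf Node t = t.
Proof. by elim: t => //= l -> r ->. Qed.

Lemma sun_checkP T D : sun_check T D -> forall t, inner t = 4 ->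
  [\/ schur_ok T D (schur T D t), edges 0 t = sun_left | edges 0 t = sun_right].
Proof.
move=> chk t tk; have := fold_table_all chk tk; rewrite tri_fold_id.
by case/or3P => [|/eqP|/eqP]; [constructor 1 | constructor 2 | constructor 3].
Qed.

(** With [T = 0] the eigenvalue alternative always fails, so this says that every triangulation is a
    fan. *)
Lemma fan_check_small m : 1 < m -> m < 6 -> fan_check m 0 1.
Proof. by case: m => [|[|[|[|[|[|]]]]]] // _ _; vm_compute. Qed.
(* The bounds [T / D] lie below the largest eigenvalue of the fan of order [m]. *)
Lemma fan_check7 : fan_check 7 34500 10000. Proof. by vm_compute. Qed.
Lemma fan_check8 : fan_check 8 36600 10000. Proof. by vm_compute. Qed.
Lemma fan_check9 : fan_check 9 38400 10000. Proof. by vm_compute. Qed.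
Lemma fan_check10 : fan_check 10 40100 10000. Proof. by vm_compute. Qed.
Lemma fan_check11 : fan_check 11 41700 10000. Proof. by vm_compute. Qed.
Lemma fan_check12 : fan_check 12 43300 10000. Proof. by vm_compute. Qed.
Lemma sun_check6 : sun_check 32300 10000. Proof. by vm_compute. Qed.

(** * From triangulations to quadratic forms of non-crossing graphs *)

Section CoverSum.
Variable R : numDomainType.
Local Open Scope ring_scope.

Lemma cover_sum m (e : rel nat) (es : seq (nat * nat)) (f : nat -> nat -> R) :
  symmetric e -> irreflexive e ->
  (forall a b, (a < b < m)%N -> e a b -> (a, b) \in es) ->
  (forall a b, 0 <= f a b) -> (forall a b, f a b = f b a) ->
  \sum_(a < m) \sum_(b < m) (e a b)%:R * f a b <= 2 * \sum_(p <- es) f p.1 p.2.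
Proof.
move=> esym eirr ecov f0 fsym.
pose g (a b : nat) := \sum_(p <- es) ((p == (a, b)) + (p == (b, a)))%:R * f p.1 p.2.
apply: (@le_trans _ _ (\sum_(a < m) \sum_(b < m) g a b)).
  apply: ler_sum => a _; apply: ler_sum => b _; rewrite /g.
  have [eab|_] := boolP (e a b); last first.
    by rewrite mul0r sumr_ge0 // => p _; rewrite mulr_ge0.
  rewrite mul1r.
  have [p pes pE] : exists2 p, p \in es & p = (a : nat, b : nat) \/ p = (b : nat, a : nat).
    have [ab|ba|ab] := ltngtP a b.
    - by exists (a : nat, b : nat); [apply: ecov; rewrite // ab /= | left].
    - exists (b : nat, a : nat); last by right.
      by apply: ecov; rewrite ?ba //= esym.
    - by rewrite ab eirr in eab.
  rewrite (big_rem p) //= -[X in X <= _]addr0 lerD //; last first.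
    by apply: sumr_ge0 => q _; rewrite mulr_ge0.
  rewrite -[X in X <= _]mul1r; apply: (@le_trans _ _ (1 * f p.1 p.2)).
    by case: pE => -> /=; rewrite // fsym.
  by apply: ler_wpM2r => //; rewrite ler1n; case: pE => ->; rewrite eqxx ?addnS.
have -> : \sum_(a < m) \sum_(b < m) g a b = \sum_(p <- es)
    (\sum_(a < m) \sum_(b < m) ((p == (a : nat, b : nat)) + (p == (b : nat, a : nat)))%:R) * f p.1 p.2.
  rewrite /g; under eq_bigr do rewrite exchange_big /=.
  rewrite exchange_big /=; apply: eq_bigr => p _; rewrite big_distrl /=.
  by apply: eq_bigr => a _; rewrite big_distrl.
rewrite mulr_sumr; apply: ler_sum => -[u v] _ /=; apply: ler_wpM2r => //.
under eq_bigr do under eq_bigr do rewrite natrD.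
under eq_bigr do rewrite big_split /=.
rewrite big_split /=.
have one (u' v' : nat) : \sum_(a < m) \sum_(b < m)
    ((u', v') == (a : nat, b : nat))%:R <= 1 :> R.
  under eq_bigr do under eq_bigr do rewrite xpair_eqE -mulnb natrM.
  under eq_bigr do rewrite -mulr_sumr.
  rewrite -mulr_suml; have le1 (w : nat) : \sum_(a < m) (w == a)%:R <= 1 :> R.
    have [wm|mw] := ltnP w m; last first.
      by rewrite big1 // => a _; rewrite gtn_eqF // (leq_trans _ mw).
    rewrite (bigD1 (Ordinal wm)) //= eqxx big1 ?addr0 // => a.
    by rewrite -val_eqE /= eq_sym => /negPf ->.
  by apply: mulr_ile1 => //; rewrite ?sumr_ge0.
rewrite (natrD _ 1 1) lerD ?one //; rewrite exchange_big /=; apply: le_trans (one u v).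
by apply: ler_sum => a _; apply: ler_sum => b _.
Qed.

End CoverSum.

(** Cancels a factor 100 of the certificates, so that eigenvalues are compared with fractions of
    denominator 100. *)
Lemma to_nat_ratio (F : numFieldType) a b :
  ((N.to_nat (a * 100))%:R / (N.to_nat (b * 100))%:R
    = (N.to_nat a)%:R / (N.to_nat b)%:R :> F)%R.
Proof.
rewrite !N2Nat.inj_mul !multE !natrM -mulf_div divff ?mulr1 //.
by rewrite pnatr_eq0.
Qed.

Section Small.
Variables (R : realFieldType) (m : nat) (e : rel nat) (x : nat -> R).
Hypotheses (m2 : 1 < m) (esym : symmetric e) (eirr : irreflexive e).
Hypothesis nc : noncrossing_on e 0 m.-1.
Hypothesis x0 : forall i, (0 <= x i)%R.

Definition fan_at c := forall a b, a < b < m -> e a b ->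
  [\/ a = c, b = c, b = a.+1 | a = 0 /\ b = m.-1].

Let cover : exists2 t, inner t = m - 2 &
  forall a b, a < b < m -> e a b -> (a, b) \in edges 0 t.
Proof.
have mE : m.-1 = 0 + (m - 2).+1 by lia.
have := nc; rewrite mE => /tri_cover[t tk tP]; exists t => // a b /andP[ab bm].
by apply: tP => //; lia.
Qed.

Let schur_bound T D t : (0 < D)%num -> inner t = m - 2 ->
  (forall a b, a < b < m -> e a b -> (a, b) \in edges 0 t) ->
  schur_ok T D (schur T D t) ->
  (\sum_(a < m) \sum_(b < m) (e a b)%:R * (x a * x b) <=
  ((N.to_nat T)%:R / (N.to_nat D)%:R) * \sum_(a < m) x a ^+ 2)%R.
Proof.
move=> D0 tm cov ok; have := schur_okP x0 D0 ok.
have -> : (inner t).+2 = m by lia.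
rewrite big_mkord; apply: le_trans.
rewrite /edge_sum; apply: (@cover_sum _ m e _ (fun a b => x a * x b)%R) => //.
  by move=> a b; rewrite mulr_ge0.
by move=> a b; rewrite mulrC.
Qed.

Lemma fan_check_bound T D : (0 < D)%num -> fan_check m T D ->
  (exists2 c, c < m & fan_at c) \/
  (\sum_(a < m) \sum_(b < m) (e a b)%:R * (x a * x b) <=
  ((N.to_nat T)%:R / (N.to_nat D)%:R) * \sum_(a < m) x a ^+ 2)%R.
Proof.
move=> D0 chk; have [t tm cov] := cover.
have [ok|[c]] := fan_checkP chk tm; first by right; apply: schur_bound ok.
have -> : (inner t).+2 = m by lia.
by move=> cm fe; left; exists c => // a b ab eab; apply/fe/cov.
Qed.

Lemma sun_check_bound : m = 6 ->
  [\/ forall a b, a < b < m -> e a b -> (a, b) \in sun_left,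
      forall a b, a < b < m -> e a b -> (a, b) \in sun_right |
  (\sum_(a < m) \sum_(b < m) (e a b)%:R * (x a * x b) <=
  ((N.to_nat 323)%:R / (N.to_nat 100)%:R) * \sum_(a < m) x a ^+ 2)%R].
Proof.
move=> m6; have [t tm cov] := cover.
have t4 : inner t = 4 by rewrite tm m6.
have [ok|E|E] := sun_checkP sun_check6 t4; first last.
- by constructor 2 => a b ab eab; rewrite -E cov.
- by constructor 1 => a b ab eab; rewrite -E cov.
constructor 3; rewrite -to_nat_ratio; exact: schur_bound tm cov ok.
Qed.

End Small.

(** * Walks from a hub *)

Section GapSum.
Variable c : nat -> nat.

(** Equals the sum over the vertices [a] of [c a] times the degree of [a] in [es]. *)
Definition end_sum (es : seq (nat * nat)) := \sum_(p <- es) (c p.1 + c p.2).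

Lemma end_sum_cat es es' : end_sum (es ++ es') = end_sum es + end_sum es'.
Proof. by rewrite /end_sum big_cat. Qed.

Lemma end_sum_edges i t : end_sum (edges i t) =
  c i + c (i + (inner t).+1) + end_sum (behead (edges i t)).
Proof. by case: t => *; rewrite /end_sum /= big_cons. Qed.

Lemma end_sum_Node i l r : let z := i + (inner l).+1 in
  end_sum (behead (edges i (Node l r))) =
  c i + c z + end_sum (behead (edges i l)) +
  (c z + c (i + (inner (Node l r)).+1) + end_sum (behead (edges z r))).
Proof.
rewrite /= end_sum_cat !end_sum_edges.
by have -> : i + (inner l).+1 + (inner r).+1 = i + (inner l + inner r).+2 by lia.
Qed.

Lemma end_sum_zero i t : let j := i + (inner t).+1 in
  (forall a, i < a < j -> c a = 0) ->
  end_sum (behead (edges i t)) <= (c i + c j) * inner t.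
Proof.
elim: t i => [|l IHl r IHr] i j c0; first by rewrite /end_sum big_nil.
rewrite end_sum_Node; set z := i + (inner l).+1.
have zj : z + (inner r).+1 = j by rewrite /j /z /=; lia.
have := IHl i; have := IHr z; rewrite /= -/z zj => hr hl.
have c_z : c z = 0 by apply: c0; rewrite /j /z /=; lia.
have {}hr : end_sum (behead (edges z r)) <= (c z + c j) * inner r.
  by apply: hr => a ha; apply: c0; rewrite /z in ha; lia.
have {}hl : end_sum (behead (edges i l)) <= (c i + c z) * inner l.
  by apply: hl => a ha; apply: c0; rewrite /j /z /= in ha *; lia.
rewrite c_z in hl hr *; move: hl hr; rewrite -/j /=; nia.
Qed.

(** All interior weights come from edges at [i]. The apex has weight at most 1 and hides [i] from
    the vertices beyond it, so [end_sum_zero] bounds that part by 3 per vertex. The two new sides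
    cost at most [1 + (1 + 2) = 4], one unit of the bound. *)
Lemma end_sum_left i t : let j := i + (inner t).+1 in
  c i = 0 -> c j <= 2 ->
  (forall a, i < a < j -> c a <= ((i, a) \in edges i t)) ->
  end_sum (behead (edges i t)) <= 4 * inner t.
Proof.
elim: t i => [|l IHl r IHr] i j ci cj ca; first by rewrite /end_sum big_nil.
rewrite end_sum_Node; set z := i + (inner l).+1.
have zj : z + (inner r).+1 = j by rewrite /j /z /=; lia.
have notr a : z < a -> a < j -> (i, a) \in edges i (Node l r) = false.
  move=> za aj; apply/negP; rewrite inE xpair_eqE mem_cat.
  case/or3P => [|/edges_bound|/edges_bound]; rewrite /j /z /= in za aj *; lia.
have c_z : c z <= 1.
  by apply: leq_trans (ca z _) (leq_b1 _); rewrite /j /z /=; lia.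
have hr : end_sum (behead (edges z r)) <= (c z + c j) * inner r.
  rewrite -zj; apply: end_sum_zero => a ha; apply/eqP; rewrite -leqn0.
  apply: leq_trans (ca a _) _; first by rewrite /z in ha zj *; lia.
  by rewrite notr //; lia.
have hl : end_sum (behead (edges i l)) <= 4 * inner l.
  apply: IHl => //; first by rewrite -/z; lia.
  move=> a ha; apply: leq_trans (ca a _) _; first by rewrite /j /=; lia.
  rewrite inE mem_cat xpair_eqE eqxx /=.
  have -> : (a == i + (inner l + inner r).+2) = false by lia.
  case: ((i, a) \in edges i l) => //=; case E: (_ \in _) => //.
  by have := edges_bound E; lia.
move: hl hr; rewrite -/j ci /=; nia.
Qed.

Lemma end_sum_right i t : let j := i + (inner t).+1 in
  c j = 0 -> c i <= 2 ->
  (forall a, i < a < j -> c a <= ((a, j) \in edges i t)) ->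
  end_sum (behead (edges i t)) <= 4 * inner t.
Proof.
elim: t i => [|l IHl r IHr] i j cj ci ca; first by rewrite /end_sum big_nil.
rewrite end_sum_Node; set z := i + (inner l).+1.
have zj : z + (inner r).+1 = j by rewrite /j /z /=; lia.
have notl a : i < a -> a < z -> (a, j) \in edges i (Node l r) = false.
  move=> za aj; apply/negP; rewrite inE xpair_eqE mem_cat.
  case/or3P => [|/edges_bound|/edges_bound]; rewrite /j /z /= in za aj *; lia.
have c_z : c z <= 1.
  by apply: leq_trans (ca z _) (leq_b1 _); rewrite /j /z /=; lia.
have hl : end_sum (behead (edges i l)) <= (c i + c z) * inner l.
  apply: end_sum_zero => a ha; apply/eqP; rewrite -leqn0.
  apply: leq_trans (ca a _) _; first by rewrite /z in ha zj *; lia.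
  by rewrite notl //; rewrite /z; lia.
have hr : end_sum (behead (edges z r)) <= 4 * inner r.
  apply: IHr; rewrite ?zj //; first by lia.
  move=> a ha; apply: leq_trans (ca a _) _; first by rewrite /z in ha *; lia.
  rewrite inE mem_cat xpair_eqE eqxx /=.
  have -> : (a == i) = false by rewrite /z in ha; lia.
  rewrite /= -/z; case: ((a, j) \in edges z r); rewrite ?orbT //= orbF.
  by case E: (_ \in _) => //; have := edges_bound E; rewrite /z in ha *; lia.
move: hl hr; rewrite -/j cj /=; nia.
Qed.

(** The apex over the base sees both ends and has weight at most 2; a vertex on either side of it
    sees only one end, which leaves [end_sum_left] and [end_sum_right]. *)
Lemma end_sum_gap i t : let j := i + (inner t).+1 in
  c i = 0 -> c j = 0 -> (forall a, i < a < j ->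
    c a <= ((i, a) \in edges i t) + ((a, j) \in edges i t)) ->
  end_sum (edges i t) <= 4 * inner t.
Proof.
case: t => [|l r] j ci cj ca.
  by rewrite /end_sum big_seq1 /= ci -/j cj.
rewrite end_sum_edges end_sum_Node -/j ci cj; set z := i + (inner l).+1.
have zj : z + (inner r).+1 = j by rewrite /j /z /=; lia.
have iE a : i < a -> a < j -> ((i, a) \in edges i (Node l r)) = ((i, a) \in edges i l).
  move=> ia aj; rewrite inE mem_cat xpair_eqE eqxx /=.
  have -> : (a == i + (inner l + inner r).+2) = false by rewrite /j /= in aj; lia.
  case: ((i, a) \in edges i l) => //=; case E: (_ \in _) => //.
  by have := edges_bound E; lia.
have jE a : i < a -> a < j -> ((a, j) \in edges i (Node l r)) = ((a, j) \in edges z r).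
  move=> ia aj; rewrite inE mem_cat xpair_eqE.
  have -> : (a == i) = false by lia.
  rewrite /= -/z; case: ((a, j) \in edges z r); rewrite ?orbT //= orbF.
  by case E: (_ \in _) => //; have := edges_bound E; rewrite /z in zj; lia.
have c_z : c z <= 2.
  by apply: leq_trans (ca z _) (leq_add (leq_b1 _) (leq_b1 _)); rewrite /z in zj *; lia.
have hl : end_sum (behead (edges i l)) <= 4 * inner l.
  apply: end_sum_left => // a ha; apply: leq_trans (ca a _) _; first by lia.
  rewrite iE ?jE; try lia; rewrite -[X in _ <= X]addn0 leq_add2l.
  by case E: (_ \in _) => //; have := edges_bound E; rewrite /z in ha *; lia.
have hr : end_sum (behead (edges z r)) <= 4 * inner r.
  apply: end_sum_right; rewrite ?zj // => a ha.
  apply: leq_trans (ca a _) _; first by rewrite /z in ha *; lia.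
  rewrite iE ?jE; try (rewrite /z in ha; lia).
  rewrite -[X in _ <= X]add0n leq_add2r.
  by case E: (_ \in _) => //; have := edges_bound E; rewrite /z in ha *; lia.
move: hl hr; rewrite /=; lia.
Qed.

End GapSum.

Section Walks.
Variables (m : nat) (e : rel nat).
Hypotheses (esym : symmetric e) (eirr : irreflexive e).
Hypothesis (elt : forall a b, e a b -> b < m) (nc : noncrossing_on e 0 m).

(** The number of walks of length two from the hub to [a]. *)
Definition hub_deg a := \sum_(v < m) e 0 v * e v a.
Definition deg a := \sum_(b < m) e a b.
Definition outer_deg a := if (0 < a) && ~~ e 0 a then hub_deg a else 0.

Let elt' a b : e a b -> a < m. Proof. by rewrite esym => /elt. Qed.

Let confined k j a b : k < a -> a < j -> (k = 0 \/ e 0 k) -> (j = m \/ e 0 j) ->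
  ~~ e 0 a -> e a b -> k <= b <= j.
Proof.
move=> ka aj k0 jm n0a eab; have bm := elt eab.
have b0 : b <> 0 by move=> b0; move: eab n0a; rewrite b0 esym => ->.
apply/andP; split.
  case: k0 => [->//|e0k]; rewrite leqNgt; apply/negP => bk.
  by apply: (@nc 0 b k a) => //; rewrite 1?esym //; [lia | have := elt' eab; lia].
case: jm => [->|e0j]; first exact: ltnW.
rewrite leqNgt; apply/negP => jb.
by apply: (@nc 0 a j b) => //; lia.
Qed.


(** A gap lies between consecutive neighbours of the hub, [0] and [m] standing for the missing
    neighbours at the two ends. By non-crossing the edges of an inner vertex stay in the gap, and
    its only possible common neighbours with the hub are [k] and [j], so [end_sum_gap] applies. *)
Lemma gap_bound k j : k < j -> j <= m -> (k = 0 \/ e 0 k) -> (j = m \/ e 0 j) ->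
  (forall v, k < v -> v < j -> ~~ e 0 v) ->
  \sum_(k.+1 <= a < j) outer_deg a * deg a <= 4 * (j - k.+1).
Proof.
move=> kj jm k0 j0 nN.
have jE : j = k + (j - k.+1).+1 by lia.
have ncg : noncrossing_on e k (k + (j - k.+1).+1).
  by rewrite -jE => a b c d ka ab bc cd dj; apply: nc => //; lia.
have [t tk tP] := tri_cover ncg; rewrite -jE in tP.
pose c a := if k < a < j then outer_deg a else 0.
have c_in a : k < a < j -> c a = outer_deg a by rewrite /c => ->.
have gap := @end_sum_gap c k t; rewrite /= tk -jE in gap.
have {}gap : end_sum c (edges k t) <= 4 * (j - k.+1).
  apply: gap; rewrite /c ?ltnn ?andbF // => a /andP[ka aj]; rewrite ka aj /=.
  rewrite /outer_deg nN ?(leq_ltn_trans _ ka) //=.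
  have hub_le : hub_deg a <= e k a + e a j.
    apply: (@leq_trans (\sum_(v < m) ((v == k :> nat) * e k a + (v == j :> nat) * e a j))).
      apply: leq_sum => v _; case e0v: (e 0 v) => //; rewrite mul1n.
      case eva: (e v a) => //.
      have eav : e a v by rewrite esym.
      have /andP[kv vj] := confined ka aj k0 j0 (nN _ ka aj) eav.
      have [vk|vk] := eqVneq (v : nat) k; first by rewrite -vk eva.
      have [vj'|vj'] := eqVneq (v : nat) j; first by rewrite -vj' eav addnC.
      by have := nN v; rewrite e0v => /(_ _ _)/negP; case; lia.
    rewrite big_split /= -!big_distrl /= leq_add //.
      rewrite -[X in _ <= X]mul1n leq_mul2r; apply/orP; right.
      apply: leq_trans (_ : \sum_(v < m | v == k :> nat) 1 <= _).
        by rewrite [X in _ <= X]big_mkcond /=; apply: leq_sum => v _; case: eqP.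
      rewrite sum1_card; apply/card_le1P => u + v; rewrite !inE => /eqP uk.
      by rewrite -uk.
    rewrite -[X in _ <= X]mul1n leq_mul2r; apply/orP; right.
    apply: leq_trans (_ : \sum_(v < m | v == j :> nat) 1 <= _).
      by rewrite [X in _ <= X]big_mkcond /=; apply: leq_sum => v _; case: eqP.
    rewrite sum1_card; apply/card_le1P => u + v; rewrite !inE => /eqP uk.
    by rewrite -uk.
  apply: leq_trans hub_le (leq_add _ _).
    by case eka: (e k a) => //; rewrite tP //; lia.
  by case eaj: (e a j) => //; rewrite tP //; lia.
apply: leq_trans gap.
pose e' a b := [&& e a b, k <= a <= j & k <= b <= j].
have e'sym : symmetric e' by move=> a b; rewrite /e' esym; congr andb; rewrite andbC.
have e'irr : irreflexive e' by move=> a; rewrite /e' eirr.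
have := @cover_sum rat m.+1 e' (edges k t) (fun a b => (c a + c b)%:R%R) e'sym e'irr.
have -> : (\sum_(p <- edges k t) (c p.1 + c p.2)%:R)%R = (end_sum c (edges k t))%:R%R :> rat.
  by rewrite natr_sum.
have -> : (\sum_(a < m.+1) \sum_(b < m.+1) (e' a b)%:R * (c a + c b)%:R)%R =
   (2 * (\sum_(a < m.+1) \sum_(b < m.+1) e' a b * c a))%:R%R :> rat.
  under eq_bigr do under eq_bigr do rewrite -natrM mulnDr natrD.
  under eq_bigr do rewrite big_split /=.
  rewrite big_split /= [X in (_ + X)%R]exchange_big /= mul2n -addnn natrD.
  rewrite !natr_sum; congr (_ + _)%R; apply: eq_bigr => a _; rewrite natr_sum //.
  by apply: eq_bigr => b _; rewrite e'sym.
rewrite -(natrM _ 2) ler_nat leq_mul2l /= => cov.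
apply: leq_trans (cov _ _ _) => {cov}; first last.
- by move=> a b; rewrite addnC.
- by move=> a b.
- move=> a b /andP[ab bm] /and3P[eab /andP[ka aj] /andP[kb bj]].
  exact: tP.
have -> : \sum_(k.+1 <= a < j) outer_deg a * deg a =
    \sum_(a < m.+1 | k < a < j) outer_deg a * deg a.
  rewrite -(big_mkord (fun a => k < a < j) (fun a => outer_deg a * deg a)).
  rewrite (big_nat_widen _ _ m.+1) 1?ltnW // (big_nat_widenl _ 0) //.
  by apply: eq_bigl => a; rewrite andbC.
rewrite big_mkcond /=; apply: leq_sum => a _; case: ifP => // /andP[ka aj].
rewrite /deg big_distrr /= big_ord_recr /= -[X in X <= _]addn0 leq_add //.
apply: leq_sum => b _; rewrite c_in ?ka // mulnC.
case eab: (e a b) => //; rewrite /e' eab /=.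
have := confined ka aj k0 j0 (nN _ ka aj) eab => ->; rewrite andbT.
by rewrite (ltnW ka) (ltnW aj).
Qed.

Lemma outer_walks j : j <= m -> 0 < j -> (j = m \/ e 0 j) ->
  \sum_(1 <= a < j) outer_deg a * deg a <= 4 * \sum_(1 <= a < j) ~~ e 0 a.
Proof.
have [n] := ubnP j; elim: n j => // n IH j; rewrite ltnS => jn jm j0 jE.
have [k [kj kE kmax]] : exists k, [/\ k < j, k = 0 \/ e 0 k &
    forall v, k < v -> v < j -> ~~ e 0 v].
  pose P k := (k < j) && ((k == 0) || e 0 k).
  have ex : exists k, P k by exists 0; rewrite /P j0.
  have bnd k : P k -> k <= j by case/andP => /ltnW.
  case: (ex_maxnP ex bnd) => k /andP[kj kE] kmax; exists k; split=> // [|v kv vj].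
    by case/orP: kE => [/eqP|]; [left | right].
  by apply/negP => e0v; have := kmax v; rewrite /P vj e0v orbT => /(_ isT); lia.
have gap := gap_bound kj jm kE jE kmax.
have cnt : \sum_(k.+1 <= a < j) ~~ e 0 a = j - k.+1.
  rewrite -[RHS]muln1 -sum_nat_const_nat; apply: eq_big_nat => a /andP[ka aj].
  by rewrite kmax.
case: (posnP k) => [k0|kpos]; first by rewrite k0 in gap cnt; rewrite cnt.
have ek : e 0 k by case: kE => // k0; lia.
have IHk := IH k (leq_trans kj jn) (leq_trans (ltnW kj) jm) kpos (or_intror ek).
rewrite !(@big_cat_nat _ _ _ k 1 j) ?(ltnW kj) //=.
rewrite mulnDr leq_add //.
rewrite big_ltn // [X in _ <= 4 * X]big_ltn // ek cnt /outer_deg ek andbF.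
by rewrite mul0n !add0n.
Qed.

Lemma outer_walks_all : 0 < m ->
  \sum_(1 <= a < m) outer_deg a * deg a <= 4 * \sum_(1 <= a < m) ~~ e 0 a.
Proof. by move=> m0; apply: outer_walks => //; left. Qed.

End Walks.

Lemma sum_unique_le1 (I : finType) (P : pred I) :
  (forall u v, P u -> P v -> u = v) -> \sum_i P i <= 1.
Proof.
move=> uP; rewrite -big_mkcond sum1_card /=; apply/card_le1P => u Pu v.
by rewrite !inE; apply/idP/eqP => [Pv|->//]; exact: uP.
Qed.

(** * A vertex with the largest Perron entry dominates the graph *)

Section Hub.
Variables (m : nat) (e : rel nat).
Hypotheses (esym : symmetric e) (eirr : irreflexive e).
Hypothesis (elt : forall a b, e a b -> b < m) (nc : noncrossing_on e 0 m).

Let hub_nbr z (v : 'I_m) := e 0 v && e v z.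

(** For [0 < u < v < z] the chords [0 v] and [u z] cross. *)
Let hub_left z : e 0 z -> \sum_(v < m) (hub_nbr z v && (v < z)) <= 1.
Proof.
move=> e0z; apply: sum_unique_le1.
suff lt (u v : 'I_m) : hub_nbr z u && (u < z) -> hub_nbr z v && (v < z) -> u < v -> False.
  move=> u v Pu Pv; apply: val_inj; case: (ltngtP u v) => //= uv.
    by case: (lt u v).
  by case: (lt v u).
move=> /andP[/andP[e0u euz] uz] /andP[/andP[e0v evz] vz] uv.
apply: (@nc 0 u v z) => //; last exact: ltnW (elt e0z).
by rewrite lt0n; apply: contraTneq e0u => ->; rewrite eirr.
Qed.

Let hub_right z : e 0 z -> \sum_(v < m) (hub_nbr z v && (z < v)) <= 1.
Proof.
move=> e0z; apply: sum_unique_le1.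
suff lt (u v : 'I_m) : hub_nbr z u && (z < u) -> hub_nbr z v && (z < v) -> u < v -> False.
  move=> u v Pu Pv; apply: val_inj; case: (ltngtP u v) => //= uv.
    by case: (lt u v).
  by case: (lt v u).
move=> /andP[/andP[e0u euz] uz] /andP[/andP[e0v evz] vz] uv.
apply: (@nc 0 z u v) => //; rewrite 1?esym //; last exact: ltnW.
by rewrite lt0n; apply: contraTneq e0z => ->; rewrite eirr.
Qed.

Let hub_degE z : hub_deg m e z =
  \sum_(v < m) (hub_nbr z v && (v < z)) + \sum_(v < m) (hub_nbr z v && (z < v)).
Proof.
rewrite -big_split /=; apply: eq_bigr => v _; rewrite /hub_nbr mulnb.
by case: ltngtP => [|| ->]; rewrite ?andbT ?andbF ?addn0 // eirr andbF.
Qed.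

Lemma hub_deg_le2 z : e 0 z -> hub_deg m e z <= 2.
Proof. by move=> e0z; rewrite hub_degE (leq_add (hub_left e0z) (hub_right e0z)). Qed.

Lemma hub_deg_first z : e 0 z -> (forall v, e 0 v -> z <= v) -> hub_deg m e z <= 1.
Proof.
move=> e0z zmin; rewrite hub_degE big1 ?hub_right // => v _.
case: (boolP (hub_nbr z v)) => //= /andP[e0v _].
by rewrite ltnNge zmin.
Qed.

Lemma hub_deg_last z : e 0 z -> (forall v, e 0 v -> v <= z) -> hub_deg m e z <= 1.
Proof.
move=> e0z zmax; rewrite hub_degE addnC big1 ?hub_left // => v _.
case: (boolP (hub_nbr z v)) => //= /andP[e0v _].
by rewrite ltnNge zmax.
Qed.

Variables (R : realFieldType) (x : nat -> R) (rho : R).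
Local Open Scope ring_scope.
Hypotheses (x_ge0 : forall a, 0 <= x a) (x_le1 : forall a, x a <= 1) (x_hub : x 0%N = 1).
Hypothesis x_eig : forall a, (a < m)%N -> \sum_(b < m) (e a b)%:R * x b = rho * x a.
Hypothesis rho_ge : 22%:R / 5%:R <= rho.

Let rho0 : 0 < rho. Proof. by apply: lt_le_trans rho_ge; lra. Qed.

Lemma nbr_entry v w : e v w -> x w <= rho * x v.
Proof.
move=> evw; have wm := elt evw; have vm : (v < m)%N by apply: (@elt w); rewrite esym.
rewrite -x_eig // (bigD1 (Ordinal wm)) //= evw mul1r lerDl sumr_ge0 // => b _.
by rewrite mulr_ge0.
Qed.

Lemma nbr_entry2 v w w' : w != w' -> e v w -> e v w' -> x w + x w' <= rho * x v.
Proof.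
move=> ww' evw evw'; have wm := elt evw; have wm' := elt evw'.
have vm : (v < m)%N by apply: (@elt w); rewrite esym.
rewrite -x_eig // (bigD1 (Ordinal wm)) //= (bigD1 (Ordinal wm')) /=; last first.
  by rewrite -val_eqE /= eq_sym.
rewrite evw evw' !mul1r addrA lerDl sumr_ge0 // => b _.
by rewrite mulr_ge0.
Qed.

(** A neighbour of the hub has entry at least [1 / rho], and at least [1 / rho + 1 / rho ^ 2] if it
    has a common neighbour with the hub. *)
Lemma end_deficit z : e 0 z -> (hub_deg m e z <= 1)%N ->
  rho^-1 + rho^-1 ^+ 2 <= (2 - (hub_deg m e z)%:R) * x z.
Proof.
move=> e0z h1; have ez0 : e z 0 by rewrite esym.
have xz : rho^-1 <= x z.
  by rewrite -(ler_pM2l rho0) mulfV ?gt_eqF // -x_hub nbr_entry.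
have r1 : rho^-1 ^+ 2 <= rho^-1.
  rewrite expr2 -[X in _ <= X]mulr1 ler_pM2l ?invr_gt0 // invf_le1 //.
  by apply: le_trans rho_ge; lra.
case hz: (hub_deg m e z) h1 => [|[|//]] _; first by rewrite subr0; lra.
have [v e0v evz] : exists2 v : 'I_m, e 0 v & e v z.
  have : (0 < hub_deg m e z)%N by rewrite hz.
  rewrite lt0n sum_nat_eq0 negb_forall => /existsP[v].
  by rewrite /= muln_eq0 negb_or !eqb0 !negbK => /andP[]; exists v.
have xv : rho^-1 <= x v.
  by rewrite -(ler_pM2l rho0) mulfV ?gt_eqF // -x_hub nbr_entry // esym.
have : x 0%N + x v <= rho * x z.
  by apply: nbr_entry2; rewrite 1?esym //; apply: contraTneq e0v => <-; rewrite eirr.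
rewrite x_hub => h; have -> : 2 - 1%:R = 1 :> R by lra.
rewrite mul1r -(ler_pM2l rho0) mulrDr expr2 mulrA mulfV ?gt_eqF // mul1r.
lra.
Qed.

Let card_hub := (\sum_(v < m) e 0 v)%N.
Let card_outer := (\sum_(1 <= a < m) ~~ e 0 a)%N.

Hypothesis m0 : (0 < m)%N.

Lemma hub_outer_card : (card_hub + card_outer = m.-1)%N.
Proof.
rewrite /card_hub -(big_mkord predT (fun v => e 0 v : nat)) big_ltn // eirr add0n.
rewrite -big_split /= (eq_bigr (fun=> 1%N)) => [|a _]; last by case: (e 0 a).
by rewrite sum_nat_const_nat muln1 subn1.
Qed.

Lemma rho_le_hub : rho <= card_hub%:R.
Proof.
have := x_eig m0; rewrite x_hub mulr1 => <-; rewrite natr_sum; apply: ler_sum => v _.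
by rewrite -[X in _ <= X]mulr1 ler_wpM2l.
Qed.

(** Applying the eigenvalue equation twice at the hub turns [rho (rho - 2)] into the sum of [(h z -
    2 [z adjacent to 0]) x z]. The hub contributes its degree. A non-neighbour has
    [x z <= deg z / rho], so [outer_walks_all] bounds their total. *)
Lemma hub_bound : rho * (rho - 2) + 2 * (rho^-1 + rho^-1 ^+ 2)
  <= card_hub%:R + 4 / rho * card_outer%:R.
Proof.
pose o0 := Ordinal m0.
pose h (z : nat) : R := (hub_deg m e z)%:R.
have tot : rho * (rho - 2) = \sum_(z < m) (h z - 2 * (e 0 z)%:R) * x z.
  have r1 : rho = \sum_(v < m) (e 0 v)%:R * x v by rewrite x_eig // x_hub mulr1.
  have r2 : rho * rho = \sum_(z < m) h z * x z.
    rewrite {2}r1 mulr_sumr.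
    transitivity (\sum_(v < m) \sum_(z < m) (e 0 v)%:R * (e v z)%:R * x z).
      apply: eq_bigr => v _; rewrite mulrCA -x_eig // mulr_sumr.
      by apply: eq_bigr => z _; rewrite mulrA.
    rewrite exchange_big /=; apply: eq_bigr => z _; rewrite -big_distrl /=; congr (_ * _).
    by rewrite /h natr_sum; apply: eq_bigr => v _; rewrite natrM.
  rewrite mulrBr r2 mulrC {1}r1 mulr_sumr -sumrB; apply: eq_bigr => z _; ring.
have h0 : h 0%N = card_hub%:R.
  rewrite /h /card_hub; congr (_%:R); apply: eq_bigr => v _.
  by rewrite [e v 0%N]esym; case: (e 0 v).
pose G (z : nat) := if e 0 z then (2 - h z) * x z else 0.
have split : rho * (rho - 2) = card_hub%:R - \sum_(z < m) G z
    + \sum_(z < m) (outer_deg m e z)%:R * x z.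
  rewrite tot (bigD1 o0) //= [\sum_(z < m) G z](bigD1 o0) //=.
  rewrite [X in _ = _ + X](bigD1 o0) //= /G /outer_deg eirr /= h0 x_hub mulr0 subr0.
  rewrite mulr1 mul0r !add0r -addrA; congr (_ + _); rewrite addrC -sumrB.
  apply: eq_bigr => z z0; have zpos : (0 < z)%N by rewrite lt0n.
  by rewrite zpos /= /h; case: (e 0 z) => /=; ring.
have outer : \sum_(z < m) (outer_deg m e z)%:R * x z <= 4 / rho * card_outer%:R.
  rewrite -(ler_pM2l rho0) mulr_sumr.
  have -> : rho * (4 / rho * card_outer%:R) = (4 * card_outer)%:R.
    by rewrite natrM mulrA [rho * _]mulrC divfK ?gt_eqF.
  apply: (@le_trans _ _ (\sum_(z < m) (outer_deg m e z * deg m e z)%:R)).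
    apply: ler_sum => z _; rewrite mulrCA -x_eig // natrM ler_wpM2l //.
    rewrite /deg natr_sum; apply: ler_sum => b _.
    by rewrite -[X in _ <= X]mulr1 ler_wpM2l.
  rewrite -natr_sum ler_nat -(big_mkord predT (fun z => outer_deg m e z * deg m e z)%N).
  by rewrite big_ltn // {1}/outer_deg mul0n add0n outer_walks_all.
have Gge0 z : 0 <= G z.
  rewrite /G; case: ifP => // e0z; rewrite mulr_ge0 // subr_ge0 /h.
  by rewrite (ler_nat R _ 2) hub_deg_le2.
have [v1 e1 v1min] : exists2 v, e 0 v & forall w, e 0 w -> (v <= w)%N.
  have ex : exists v, e 0 v.
    have : (0 < card_hub)%N by rewrite -(ltr_nat R) (lt_le_trans rho0 rho_le_hub).
    rewrite lt0n sum_nat_eq0 negb_forall => /existsP[v].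
    by rewrite /= eqb0 negbK; exists v.
  by case: (ex_minnP ex) => v ev vmin; exists v.
have [v2 e2 v2max] : exists2 v, e 0 v & forall w, e 0 w -> (w <= v)%N.
  have ex : exists v, e 0 v by exists v1.
  have bnd v : e 0 v -> (v <= m)%N by move/elt/ltnW.
  by case: (ex_maxnP ex bnd) => v ev vmax; exists v.
have v12 : v1 != v2.
  apply/eqP => v12; have : (card_hub <= 1)%N.
    apply: sum_unique_le1 => u v e0u e0v; apply: val_inj => /=.
    have := v1min _ e0u; have := v2max _ e0u; have := v1min _ e0v; have := v2max _ e0v.
    by rewrite -v12; lia.
  rewrite -(ler_nat R) => /(le_trans rho_le_hub) /(le_trans rho_ge); lra.
have Gsum : 2 * (rho^-1 + rho^-1 ^+ 2) <= \sum_(z < m) G z.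
  rewrite (bigD1 (Ordinal (elt e1))) //= (bigD1 (Ordinal (elt e2))) /=; last first.
    by rewrite -val_eqE /= eq_sym.
  have g1 : rho^-1 + rho^-1 ^+ 2 <= G v1.
    by rewrite /G e1 end_deficit // hub_deg_first.
  have g2 : rho^-1 + rho^-1 ^+ 2 <= G v2.
    by rewrite /G e2 end_deficit // hub_deg_last.
  have := @sumr_ge0 R 'I_m (index_enum _) (fun z => (z != Ordinal (elt e1)) && (z != Ordinal (elt e2))) G (fun z _ => Gge0 z).
  lra.
lra.
Qed.

(** In [hub_bound] each non-neighbour costs [1 - 4 / rho] compared with [m - 1], more than the gap
    between that bound and the one for the fan. *)
Lemma hub_dominating :
  m.-1%:R <= rho * (rho - 2) + 2 * (rho - 1) / (rho * (rho - 2)) ->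
  forall a, (0 < a < m)%N -> e 0 a.
Proof.
move=> Km a am; apply/negPn/negP => e0a.
have W1 : (1 <= card_outer)%N.
  rewrite /card_outer (big_rem a) /= ?mem_index_iota // e0a.
  by [].
have := hub_bound; move: Km; rewrite -hub_outer_card natrD.
move: W1; rewrite -(ler_nat R).
move: (card_hub%:R) (card_outer%:R) => d W W1 h1 h2.
have r2 : 0 < rho - 2 by move: rho_ge; lra.
have r0 := rho0.
have i1 : 4 / rho < 1 by rewrite ltr_pdivrMr // mul1r; apply: lt_le_trans rho_ge; lra.
have h3 : 1 - 4 / rho <= W * (1 - 4 / rho).
  by rewrite -[X in X <= _]mul1r ler_wpM2r // subr_ge0 ltW.
have h4 : 1 - 4 / rho <= 2 * (rho - 1) / (rho * (rho - 2)) - 2 * (rho^-1 + rho^-1 ^+ 2).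
  lra.
have rr : 0 < rho ^+ 2 * (rho - 2) by rewrite mulr_gt0 // exprn_gt0.
have := ler_wpM2l (ltW rr) h4.
have -> : rho ^+ 2 * (rho - 2) * (1 - 4 / rho) = rho * (rho - 2) * (rho - 4).
  by field; rewrite gt_eqF.
have -> : rho ^+ 2 * (rho - 2) * (2 * (rho - 1) / (rho * (rho - 2)) -
    2 * (rho^-1 + rho^-1 ^+ 2)) = 4.
  by field; rewrite !gt_eqF.
(* The gap is [4 / (rho ^ 2 (rho - 2))], so a contradiction needs [rho (rho - 2) (rho - 4) > 4]; at
   [22 / 5] the left side is 4.224. *)
have a1 : 22%:R / 5%:R * (12%:R / 5%:R) <= rho * (rho - 2).
  by apply: ler_pM; move: rho_ge; lra.
have a2 : 22%:R / 5%:R * (12%:R / 5%:R) * (2%:R / 5%:R) <= rho * (rho - 2) * (rho - 4).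
  by apply: ler_pM; move: rho_ge; lra.
lra.
Qed.

End Hub.

(** * Numbering along the circle, and embeddings into the blocks *)

Section Numbering.
Variable G : sgraph.

Lemma noncrossing_rotate (pos : G -> nat) u : noncrossing pos ->
  exists2 pos' : G -> nat, noncrossing pos' & forall v, pos' u <= pos' v.
Proof.
move=> [pinj nc]; have [N pN] : exists N, forall v, pos v < N.
  by exists (\max_v pos v).+1 => v; rewrite ltnS leq_bigmax.
exists (fun v => if pos v < pos u then pos v + N else pos v); last first.
  by move=> v; rewrite ltnn; case: ltnP => // _; rewrite ltnW // ltn_addl.
split=> [v w|a b c d].
  move=> vw; apply: pinj; move: vw; have := pN v; have := pN w.
  by case: (ltnP (pos v) (pos u)); case: (ltnP (pos w) (pos u)); lia.
move: (pN a) (pN b) (pN c) (pN d) => aN bN cN dN.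
case: (ltnP (pos a) (pos u)) => ha; case: (ltnP (pos b) (pos u)) => hb; try lia;
  case: (ltnP (pos c) (pos u)) => hc; try lia;
  case: (ltnP (pos d) (pos u)) => hd; try lia; move=> ab bc cd eac ebd;
  rewrite ?ltn_add2r in ab bc cd.
- exact: (nc a b c d).
- by apply: (nc b c d a) => //; [lia | rewrite sedge_sym].
- by apply: (nc c d a b) => //; [lia | rewrite sedge_sym | rewrite sedge_sym].
- by apply: (nc d a b c) => //; [lia | rewrite sedge_sym].
- exact: (nc a b c d).
Qed.

Definition index_edge (u : G) (s : seq G) i j :=
  [&& i < size s, j < size s & sedge (nth u s i) (nth u s j)].

Lemma noncrossing_numbering (pos : G -> nat) u : noncrossing pos ->
  exists s : seq G, [/\ perm_eq s (enum G), nth u s 0 = u &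
    noncrossing_on (index_edge u s) 0 (size s)].
Proof.
case/(noncrossing_rotate u) => {}pos [pinj nc] umin.
pose le := relpre pos leq; pose s := sort le (enum G).
have ps : perm_eq s (enum G) by rewrite perm_sort.
have us : uniq s by rewrite sort_uniq enum_uniq.
have sle : sorted le s by apply: sort_sorted => v w; apply: leq_total.
have letr : transitive le by move=> b a c; apply: leq_trans.
have lt i j : i < j -> j < size s -> pos (nth u s i) < pos (nth u s j).
  move=> ij js; have is_ := ltn_trans ij js.
  rewrite ltn_neqAle (inj_eq pinj) nth_uniq // (ltn_eqF ij) /=.
  by apply: (sorted_leq_nth letr (fun _ => leqnn _) u sle) => //; exact: ltnW.
exists s; split=> //.
  have us' : u \in s by rewrite (perm_mem ps) mem_enum.
  have s0 : 0 < size s by case: (s) us'.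
  apply: pinj; apply/eqP; rewrite eqn_leq umin andbT.
  have [i0|i0] := posnP (index u s); first by rewrite -[in X in X <= _]i0 nth_index.
  by rewrite -[X in _ <= pos X](nth_index u us') ltnW // lt // index_mem.
move=> a b c d _ ab bc cd ds /and3P[aS cS eac] /and3P[bS dS ebd].
by apply: (nc _ _ _ _ _ _ _ eac ebd); apply: lt.
Qed.

Lemma sum_numbering (V : nmodType) u (s : seq G) (F : G -> V) : perm_eq s (enum G) ->
  (\sum_v F v = \sum_(i < size s) F (nth u s i))%R.
Proof.
move=> ps; rewrite -(big_mkord xpredT (fun i => F (nth u s i))) -(big_nth u xpredT F).
by rewrite (perm_big _ ps) big_enum.
Qed.

Variables (u : G) (s : seq G).
Hypothesis ps : perm_eq s (enum G).

Let mem_s v : v \in s. Proof. by rewrite (perm_mem ps) mem_enum. Qed.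

Lemma size_numbering : size s = #|G|.
Proof. by rewrite (perm_size ps) cardE. Qed.

Lemma index_edge_sym : symmetric (index_edge u s).
Proof. by move=> i j; rewrite /index_edge sedge_sym andbCA. Qed.

Lemma index_edge_irr : irreflexive (index_edge u s).
Proof. by move=> i; rewrite /index_edge sedge_irrefl !andbF. Qed.

Lemma index_edge_index v w : sedge v w -> index_edge u s (index v s) (index w s).
Proof. by move=> vw; rewrite /index_edge !index_mem !mem_s !nth_index. Qed.

Let index_inj v w : index v s = index w s -> v = w.
Proof. by move=> vw; rewrite -(nth_index u (mem_s v)) vw nth_index. Qed.

Lemma fan_embedding c : c < size s -> fan_at (size s) (index_edge u s) c ->
  exists2 f : G -> fan #|G|.-1, injective f & forall v w, sedge v w -> sedge (f v) (f w).
Proof.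
rewrite size_numbering; set m := #|G| => cm fanc.
(* The hub is [c]; the rim is read cyclically from the vertex after it. *)
pose r i := if c < i then i - c.+1 else i + m - c.+1.
pose f v : fan m.-1 := if index v s == c then inl tt else
  if insub (r (index v s)) is Some o then inr o else inl tt.
have im v : index v s < m by rewrite /m -size_numbering index_mem.
have rm v : index v s != c -> r (index v s) < m.-1.
  by rewrite /r; have := im v; case: (ltngtP c (index v s)); lia.
have fE v (vc : index v s != c) : f v = inr (Ordinal (rm v vc)).
  by rewrite /f (negPf vc) (insubT (fun i => i < m.-1) (rm v vc)).
have fc v : index v s = c -> f v = inl tt by move=> vc; rewrite /f vc eqxx.
exists f.
  move=> v w; have [vc|vc] := eqVneq (index v s) c; have [wc|wc] := eqVneq (index w s) c.
  - by move=> _; apply: index_inj; rewrite vc.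
  - by rewrite (fc v) // (fE w wc).
  - by rewrite (fc w) // (fE v vc).
  rewrite (fE v vc) (fE w wc) => -[rvw]; apply: index_inj.
  move: rvw (im v) (im w) vc wc; rewrite /r.
  by case: (ltngtP c (index v s)); case: (ltngtP c (index w s)); lia.
suff main v w : index v s < index w s -> sedge v w -> sedge (f v) (f w).
  move=> v w vw; case: (ltngtP (index v s) (index w s)) => [vw'|wv|/index_inj vw'].
  - exact: main.
  - by rewrite sedge_sym main // sedge_sym.
  - by rewrite vw' sedge_irrefl in vw.
move=> vw evw; have := fanc _ _ _ (index_edge_index evw); rewrite vw im => /(_ isT).
have [vc|vc] := eqVneq (index v s) c.
  have wc : index w s != c by rewrite -vc gtn_eqF.
  by rewrite (fc v vc) (fE w wc).
have [wc|wc] := eqVneq (index w s) c.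
  by rewrite (fc w wc) (fE v vc).
rewrite (fE v vc) (fE w wc) /= /path_rel /= /r => h.
move: (im v) (im w) vc wc; case: h => h;
  move: vw h; case: (ltngtP c (index v s)); case: (ltngtP c (index w s)); lia.
Qed.

(** [tbl] renames the hexagon vertices to those of [G1]; the check on [es] is a computation. *)
Lemma sun_embedding (tbl : seq nat) (es : seq (nat * nat)) : size s = 6 ->
  perm_eq tbl (iota 0 6) ->
  all (fun p : nat * nat => let: (a, b) := (nth 0 tbl p.1, nth 0 tbl p.2) in
    ((a, b) \in G1_edges) || ((b, a) \in G1_edges)) es ->
  (forall a b, a < b < size s -> index_edge u s a b -> (a, b) \in es) ->
  exists2 f : G -> G1, injective f & forall v w, sedge v w -> sedge (f v) (f w).
Proof.
move=> s6 tp /allP esP cov; have im v : index v s < 6 by rewrite -s6 index_mem.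
have tsz : size tbl = 6 by rewrite (perm_size tp).
have tu : uniq tbl by rewrite (perm_uniq tp).
have tlt i : i < 6 -> nth 0 tbl i < 6.
  move=> i6; have : nth 0 tbl i \in tbl by rewrite mem_nth ?tsz.
  by rewrite (perm_mem tp) mem_iota.
exists (fun v => inord (nth 0 tbl (index v s)) : G1).
  move=> v w /(congr1 val) /=; rewrite !inordK ?tlt // => /eqP.
  by rewrite nth_uniq ?tsz // => /eqP /index_inj.
suff main v w : index v s < index w s -> sedge v w ->
    sedge (inord (nth 0 tbl (index v s)) : G1) (inord (nth 0 tbl (index w s))).
  move=> v w vw; case: (ltngtP (index v s) (index w s)) => [vw'|wv|/index_inj vw'].
  - exact: main.
  - by rewrite sedge_sym main // sedge_sym.
  - by rewrite vw' sedge_irrefl in vw.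
move=> vw evw; have := esP _ (cov _ _ _ (index_edge_index evw)).
rewrite s6 vw im => /(_ isT) /=.
by rewrite /sedge /= /G1_rel !inordK ?tlt.
Qed.

End Numbering.

Definition extremal_block m := if m == 6 then G1 else fan m.-1.

Lemma card_extremal_block m : 0 < m -> #|extremal_block m| = m.
Proof.
move=> m0; rewrite /extremal_block; case: eqP => [->|_]; first exact: card_G1.
by rewrite card_fan prednK.
Qed.

Lemma connected_extremal_block m : connected_graph (extremal_block m).
Proof.
rewrite /extremal_block; case: eqP => _; [exact: connected_G1 | exact: connected_fan].
Qed.

Local Open Scope ring_scope.

(** * Real symmetric matrices and the second eigenvalue *)

Section Spectral.
Variable R : rcfType.

(** Over the complex extension the matrix is Hermitian, so its spectrum is real. *)
Lemma symmetric_eigenvalue n (A : 'M[R]_n.+1) :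
  A^T = A -> exists a, eigenvalue A a.
Proof.
move=> Asym; pose AC := map_mx (real_complex R) A.
have AH : AC \is hermsymmx.
  apply: realsym_hermsym.
    rewrite is_hermitianmxE expr0 scale1r; apply/eqP/matrixP => i j.
    by rewrite !mxE -[in LHS]Asym mxE.
  by apply/mxOverP => i j; rewrite mxE complex_real.
have /orthomx_spectralP ACE := hermitian_normalmx AH.
have spr := hermitian_spectral_diag_real AH.
set P := spectralmx AC in ACE; set sp := spectral_diag AC in ACE spr.
have PU : P \in unitmx by apply: spectral_unit.
have PA : P *m AC = diag_mx sp *m P by rewrite [in LHS]ACE mulmxA mulKVmx.
have /complex_realP[a spa] : sp 0 0 \is Num.real by exact: (mxOverP spr).
exists a; rewrite eigenvalue_root_char -(fmorph_root (real_complex R)).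
rewrite map_char_poly -eigenvalue_root_char; apply/eigenvalueP.
exists (row 0 P).
  by rewrite -row_mul PA mul_diag_mx; apply/rowP => j; rewrite !mxE spa.
apply: contraTneq PU => r0; rewrite unitmxE (expand_det_row _ 0) big1 ?unitr0 //.
by move=> j _; move/rowP/(_ j): r0; rewrite !mxE => ->; rewrite mul0r.
Qed.

(** The reflection that exchanges the first basis vector and [v]. *)
Lemma householder n (v : 'rV[R]_n.+1) : v *m v^T = 1%:M ->
  exists2 H : 'M[R]_n.+1, H^T = H /\ H *m H = 1%:M & row 0 H = v.
Proof.
move=> v1; pose e : 'rV[R]_n.+1 := delta_mx 0 0; pose w := v - e.
have [w0|wn0] := eqVneq w 0.
  exists 1%:M; first by rewrite trmx1 mulmx1.
  by rewrite rowE mulmx1; move/eqP: w0; rewrite subr_eq0 => /eqP.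
have ve : v *m e^T = (v 0 0)%:M.
  apply/matrixP => i j; rewrite !ord1 !mxE (bigD1 0) //= big1 ?addr0.
    by rewrite !mxE !eqxx mulr1.
  by move=> k /negPf k0; rewrite !mxE k0 andbF mulr0.
have ev : e *m v^T = (v 0 0)%:M.
  by rewrite -[LHS]trmxK trmx_mul !trmxK ve tr_scalar_mx.
have ee : e *m e^T = 1%:M.
  by rewrite trmx_delta mul_delta_mx; apply/matrixP => i j; rewrite !ord1 !mxE.
pose c := 2 - 2 * v 0 0.
have ww : w *m w^T = c%:M.
  rewrite /w linearB /= mulmxBl !mulmxBr v1 ve ev ee.
  by apply/matrixP => i j; rewrite !ord1 !mxE /= !mulr1n /c; ring.
have c0 : c != 0.
  apply: contraNneq wn0 => c0; move: ww; rewrite c0 => /matrixP /(_ 0 0).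
  rewrite !mxE mul0rn => /eqP; rewrite psumr_eq0 => [/allP w0|i _]; last first.
    by rewrite !mxE -expr2 sqr_ge0.
  apply/eqP/rowP => i; have := w0 i (mem_index_enum _).
  by rewrite !mxE -expr2 sqrf_eq0 => /eqP.
pose K := w^T *m w; pose H := 1%:M - (2 / c) *: K.
have KK : K *m K = c *: K.
  by rewrite /K mulmxA -[w^T *m w *m _]mulmxA ww mul_mx_scalar -scalemxAl.
have KT : K^T = K by rewrite trmx_mul trmxK.
exists H; first split.
- by rewrite /H linearB /= linearZ /= KT trmx1.
- rewrite /H mulmxBl mul1mx mulmxBr mulmx1 -scalemxAl -scalemxAr KK !scalerA.
  rewrite -addrA -[X in _ = X]addr0; congr (_ + _).
  rewrite opprB -!scaleNr -!scalerDl.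
  by apply/eqP; rewrite scaler_eq0; apply/orP; left; apply/eqP; field.
rewrite rowE mulmxBr mulmx1 -scalemxAr mulmxA.
have -> : e *m w^T = (- (c / 2))%:M.
  rewrite /w linearB /= mulmxBr ev ee.
  by apply/matrixP => i j; rewrite !ord1 !mxE /= !mulr1n /c; field.
rewrite mul_scalar_mx scalerA; have -> : 2 / c * - (c / 2) = -1 by field.
by rewrite scaleN1r opprK /w addrC subrK.
Qed.

(** Deflation: conjugating by the reflection that brings a unit eigenvector to the first position
    splits off a block of size one. *)
Theorem real_spectral n (A : 'M[R]_n) : A^T = A ->
  exists (P : 'M[R]_n) (d : 'rV[R]_n),
    P *m P^T = 1%:M /\ A = P^T *m diag_mx d *m P.
Proof.
elim: n A => [|n IH] A Asym.
  by exists 1%:M, 0; split; apply/matrixP => -[].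
have [a /eigenvalueP[v0 v0A v0n]] := symmetric_eigenvalue Asym.
have [v vA v1] : exists2 v : 'rV[R]_n.+1, v *m A = a *: v & v *m v^T = 1%:M.
  pose c := (v0 *m v0^T) 0 0.
  have c0 : 0 < c.
    rewrite /c !mxE lt_def sumr_ge0 ?andbT => [|i _]; last first.
      by rewrite !mxE -expr2 sqr_ge0.
    rewrite psumr_eq0 => [|i _]; last by rewrite !mxE -expr2 sqr_ge0.
    apply: contraNN v0n => /allP h; apply/eqP/rowP => i.
    have := h i (mem_index_enum _).
    by rewrite !mxE -expr2 sqrf_eq0 => /eqP.
  exists ((Num.sqrt c)^-1 *: v0).
    by rewrite -scalemxAl v0A !scalerA mulrC.
  rewrite linearZ /= -scalemxAl -scalemxAr scalerA -expr2 exprVn sqr_sqrtr ?ltW //.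
  have -> : v0 *m v0^T = c%:M by rewrite [LHS]mx11_scalar.
  by rewrite scale_scalar_mx mulVf ?gt_eqF.
have [H [HT HH] Hv] := householder v1.
pose B := H *m A *m H.
have BT : B^T = B by rewrite /B !trmx_mul HT Asym mulmxA.
have vH : v *m H = delta_mx 0 0 by rewrite -Hv rowE -mulmxA HH mulmx1.
have B0 : row 0 B = a *: delta_mx 0 0.
  by rewrite /B !row_mul Hv vA -scalemxAl vH.
have AE : A = H *m B *m H.
  by rewrite /B !mulmxA HH mul1mx -mulmxA HH mulmx1.
clearbody B; pose B' : 'M[R]_(1 + n) := B.
have Be j : B 0 j = a * (j == 0)%:R.
  by move/rowP/(_ j): B0; rewrite !mxE.
have BeT j : B j 0 = a * (j == 0)%:R by rewrite -BT mxE Be.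
have BE : B' = block_mx a%:M 0 0 (drsubmx B').
  rewrite -[LHS]submxK; congr block_mx; apply/matrixP => i j.
  - by rewrite !ord1 !mxE lshift0 Be eqxx mulr1.
  - by rewrite !ord1 !mxE lshift0 Be mulr0.
  - by rewrite !ord1 !mxE lshift0 BeT mulr0.
have [P' [d' [P'1 dE]]] := IH (drsubmx B') (etrans (trmx_drsub _) (congr1 _ BT)).
pose Q : 'M[R]_(1 + n) := block_mx 1%:M 0 0 P'.
have QT : Q^T = block_mx 1%:M 0 0 P'^T.
  by rewrite /Q tr_block_mx trmx1 !trmx0.
have QQ : Q *m Q^T = 1%:M.
  rewrite QT mulmx_block !mulmx0 !mul0mx !addr0 !add0r mulmx1 P'1.
  by rewrite -scalar_mx_block.
pose dd : 'rV[R]_(1 + n) := row_mx a%:M d'.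
have core : B' = Q^T *m diag_mx dd *m Q.
  rewrite {1}BE dE QT diag_mx_row !mulmx_block.
  rewrite !(mulmx0, mul0mx, addr0, add0r, mulmx1, mul1mx).
  congr block_mx; apply/matrixP => i j; rewrite !ord1 !mxE eqxx /=.
  by rewrite !mulr1n.
clearbody Q dd; exists (Q *m H), dd; split.
  by rewrite trmx_mul HT mulmxA -[Q *m H *m H]mulmxA HH mulmx1.
by rewrite AE (core : B = _) trmx_mul HT !mulmxA.
Qed.

End Spectral.

Section Eigenvalues.
Variable R : realType.

Lemma mup_prod_XsubC (s : seq R) x :
  mup x (\prod_(a <- s) ('X - a%:P)) = count_mem x s.
Proof.
elim: s => [|a s IH]; first by rewrite big_nil mupNroot // root1.
rewrite big_cons mupM ?polyXsubC_eq0 //; last first.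
  by rewrite monic_neq0 // monic_prod_XsubC.
by rewrite IH /= -['X - a%:P]expr1 mup_XsubCX; case: eqP.
Qed.

Lemma count_flatten_nseq (f : R -> nat) (s : seq R) x : uniq s ->
  count_mem x (flatten [seq nseq (f y) y | y <- s]) = if x \in s then f x else 0%N.
Proof.
elim: s => //= y s IH /andP[ys us]; rewrite count_cat IH // count_nseq inE /=.
rewrite in_cons; have [->|nxy] /= := eqVneq x y.
  by rewrite (negPf ys) addn0 mul1n.
by rewrite mul0n.
Qed.

Lemma char_poly_similar n (A P D : 'M[R]_n) : P *m P^T = 1%:M ->
  A = P^T *m D *m P -> char_poly A = char_poly D.
Proof.
move=> PP AE; have PP' : P^T *m P = 1%:M by apply: mulmx1C.
pose PX := map_mx polyC P.
have PX1 : PX^T *m PX = 1%:M.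
  by rewrite /PX map_trmx -map_mxM PP' map_mx1.
rewrite /char_poly; have -> : char_poly_mx A = PX^T *m char_poly_mx D *m PX.
  rewrite /char_poly_mx mulmxBr mulmxBl AE !map_mxM -map_trmx -/PX.
  by rewrite mul_mx_scalar -scalemxAl PX1 scalemx1.
by rewrite !det_mulmx mulrAC -det_mulmx PX1 det1 mul1r.
Qed.

Lemma eigenvalues_spectral n (A P : 'M[R]_n) (d : 'rV[R]_n) :
  P *m P^T = 1%:M -> A = P^T *m diag_mx d *m P ->
  eigenvalues A = sort >=%R [seq d 0 i | i <- enum 'I_n].
Proof.
move=> PP AE; have cE : char_poly A = \prod_(a <- [seq d 0 i | i <- enum 'I_n]) ('X - a%:P).
  rewrite (char_poly_similar PP AE) char_poly_trig ?diag_mx_is_trig //.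
  rewrite big_map big_enum /=; apply: eq_bigr => i _.
  by rewrite mxE eqxx.
have p0 : char_poly A != 0 by rewrite monic_neq0 // char_poly_monic.
rewrite /eigenvalues; apply/perm_sortP.
- by move=> x y; apply: ge_total.
- by move=> y x z xy /le_trans; apply.
- by move=> x y /le_anti.
rewrite /perm_eq; apply/allP => x _ /=.
rewrite count_flatten_nseq; last first.
  by rewrite /rootsR; apply: (sorted_uniq lt_trans ltxx); apply: sorted_roots.
have := roots_on_rootsR p0 x; rewrite inE /= => <-; rewrite cE mup_prod_XsubC.
by rewrite root_prod_XsubC; case: ifPn => // /count_memPn ->.
Qed.

End Eigenvalues.

(** * Quadratic forms of graphs and Perron vectors *)

Section Forms.
Variables (R : realType) (G : sgraph).
Implicit Types x z : G -> R.

Definition dot x z : R := \sum_u x u * z u.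
Definition adj x u : R := \sum_v (sedge u v)%:R * x v.
Definition qform x : R := dot x (adj x).

Lemma spectral_basis : exists (P : 'I_#|G| -> G -> R) (d : 'I_#|G| -> R),
  [/\ eigenvalues (adjacency R G) = sort >=%R [seq d i | i <- enum 'I_#|G|],
      forall i u, adj (P i) u = d i * P i u,
      forall i j, dot (P i) (P j) = (i == j)%:R,
      forall z, dot z z = \sum_i dot (P i) z ^+ 2 &
      forall z, qform z = \sum_i d i * dot (P i) z ^+ 2].
Proof.
have Asym : (adjacency R G)^T = adjacency R G.
  by apply/matrixP => i j; rewrite !mxE sedge_sym.
have [P [d [PP AE]]] := real_spectral Asym.
have PA : P *m adjacency R G = diag_mx d *m P.
  by rewrite AE !mulmxA PP mul1mx.
pose f i u := P i (enum_rank u).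
have sumG (F : G -> R) : \sum_u F u = \sum_(i < #|G|) F (enum_val i).
  by rewrite -(big_enum_val F).
have adjE z u : adj z u = \sum_j z (enum_val j) * adjacency R G j (enum_rank u).
  rewrite /adj sumG; apply: eq_bigr => j _.
  by rewrite mxE enum_rankK sedge_sym mulrC.
have fA i u : adj (f i) u = d 0 i * f i u.
  rewrite adjE; move/matrixP/(_ i (enum_rank u)): PA; rewrite mul_diag_mx !mxE => <-.
  by apply: eq_bigr => j _; rewrite /f enum_valK.
have fO i j : dot (f i) (f j) = (i == j)%:R.
  rewrite /dot sumG; move/matrixP/(_ i j): PP; rewrite !mxE => <-.
  by apply: eq_bigr => k _; rewrite /f enum_valK mxE.
pose c z i := dot (f i) z.
have zE z u : z u = \sum_i c z i * f i u.
  have PP' : P^T *m P = 1%:M by apply: mulmx1C.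
  rewrite /c /dot; under eq_bigr do rewrite big_distrl /=.
  rewrite exchange_big /= (bigD1 u) //= [X in _ + X]big1 ?addr0 => [|v vu].
    under eq_bigr do rewrite mulrAC.
    rewrite -big_distrl /=; move/matrixP/(_ (enum_rank u) (enum_rank u)): PP'.
    rewrite !mxE eqxx /=; under eq_bigr do rewrite mxE.
    by rewrite /f => ->; rewrite mul1r.
  under eq_bigr do rewrite mulrAC.
  rewrite -big_distrl /=; move/matrixP/(_ (enum_rank v) (enum_rank u)): PP'.
  rewrite !mxE (inj_eq enum_rank_inj) (negPf vu) /=.
  by under eq_bigr do rewrite mxE; rewrite /f => ->; rewrite mul0r.
have dotE z w : dot z w = \sum_i c z i * c w i.
  rewrite {1}/dot; under eq_bigr do rewrite zE big_distrl /=.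
  rewrite exchange_big /=; apply: eq_bigr => i _.
  by rewrite /c [X in _ * X]/dot big_distrr /=; apply: eq_bigr => u _; rewrite mulrA.
have cA z i : c (adj z) i = d 0 i * c z i.
  rewrite /c /dot mulr_sumr /adj.
  under eq_bigr do rewrite big_distrr /=.
  rewrite exchange_big /=; apply: eq_bigr => u _; rewrite mulrA -fA /adj big_distrl /=.
  by apply: eq_bigr => v _; rewrite sedge_sym mulrCA mulrA.
exists f, (fun i => d 0 i); split.
- exact: eigenvalues_spectral PP AE.
- exact: fA.
- exact: fO.
- by move=> z; rewrite dotE; apply: eq_bigr => i _; rewrite -expr2.
- move=> z; rewrite /qform dotE; apply: eq_bigr => i _.
  by rewrite cA mulrCA -expr2.
Qed.

Lemma top_eigenvector : (0 < #|G|)%N -> exists lam x,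
  [/\ dot x x = 1, forall u, adj x u = lam * x u &
      forall z, qform z <= lam * dot z z].
Proof.
move=> G0; have [P [d [_ Pd PO n2 q]]] := spectral_basis.
have [i _ imax] := @arg_maxP _ _ _ (Ordinal G0) xpredT d isT.
exists (d i), (P i); split=> [|//|z]; first by rewrite PO eqxx.
rewrite q n2 mulr_sumr; apply: ler_sum => j _.
by apply: ler_wpM2r; [exact: sqr_ge0 | exact: imax].
Qed.

Lemma rho2_eigenvectors : (1 < #|G|)%N -> exists lam x1 x2,
  [/\ rho2 R G <= lam, dot x1 x1 = 1, dot x2 x2 = 1 & dot x1 x2 = 0] /\
  [/\ forall u, adj x1 u = lam * x1 u, forall u, adj x2 u = rho2 R G * x2 u,
      forall z, qform z <= lam * dot z z &
      forall z, dot x1 z = 0 -> qform z <= rho2 R G * dot z z].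
Proof.
move=> G1; have [P [d [eE Pd PO n2 q]]] := spectral_basis.
pose t := sort (relpre d >=%R) (enum 'I_#|G|).
have tE : eigenvalues (adjacency R G) = map d t by rewrite eE sort_map.
have ut : uniq t by rewrite sort_uniq enum_uniq.
have mt i : i \in t by rewrite mem_sort mem_enum.
have st : sorted (relpre d >=%R) t by apply: sort_sorted => i j; apply: ge_total.
have szt : size t = #|G| by rewrite size_sort size_enum_ord.
case: t => [|i1 [|i2 t]] in tE ut mt st szt; rewrite -szt // in G1.
have rE : rho2 R G = d i2 by rewrite /rho2 tE.
move: ut => /= /andP[]; rewrite inE negb_or => /andP[i12 _] _.
move: st => /= /andP[d12 st].
have dle j : j != i1 -> d j <= d i2.
  have := mt j; rewrite !inE => /or3P[->//|/eqP -> //|jt] _.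
  have tr : transitive (relpre d >=%R) by move=> y x z /= xy /le_trans; apply.
  by have /allP /(_ j jt) := order_path_min tr st.
exists (d i1), (P i1), (P i2); rewrite rE.
split; split=> //; rewrite ?PO ?eqxx ?(negPf i12) //.
- move=> z; rewrite q n2 mulr_sumr; apply: ler_sum => j _.
  apply: ler_wpM2r; first exact: sqr_ge0.
  by have [->//|/dle /le_trans] := eqVneq j i1; apply.
- move=> z z1; rewrite q n2 mulr_sumr; apply: ler_sum => j _.
  have [->|/dle] := eqVneq j i1; first by rewrite z1 expr0n /= !mulr0.
  by move=> ?; apply: ler_wpM2r => //; exact: sqr_ge0.
Qed.

End Forms.

Section Perron.
Variables (R : realType) (G : sgraph).
Implicit Types x z w : G -> R.

Lemma dotC x z : dot x z = dot z x.
Proof. by apply: eq_bigr => u _; rewrite mulrC. Qed.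

Lemma dotDl x z w : dot (fun u => x u + z u) w = dot x w + dot z w.
Proof. by rewrite -big_split; apply: eq_bigr => u _; rewrite mulrDl. Qed.

Lemma dotZl c x z : dot (fun u => c * x u) z = c * dot x z.
Proof. by rewrite mulr_sumr; apply: eq_bigr => u _; rewrite mulrA. Qed.

Lemma dotDr x z w : dot w (fun u => x u + z u) = dot w x + dot w z.
Proof. by rewrite dotC dotDl !(dotC w). Qed.

Lemma dotZr c x z : dot x (fun u => c * z u) = c * dot x z.
Proof. by rewrite dotC dotZl dotC. Qed.

Lemma eq_dot x x' z z' : x =1 x' -> z =1 z' -> dot x z = dot x' z'.
Proof. by move=> xE zE; apply: eq_bigr => u _; rewrite xE zE. Qed.

Lemma adjD x z u : adj (fun u => x u + z u) u = adj x u + adj z u.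
Proof. by rewrite -big_split; apply: eq_bigr => v _; rewrite mulrDr. Qed.

Lemma adjZ c x u : adj (fun u => c * x u) u = c * adj x u.
Proof. by rewrite mulr_sumr; apply: eq_bigr => v _; rewrite mulrCA. Qed.

Lemma dot_adj x z : dot x (adj z) = dot (adj x) z.
Proof.
rewrite /dot /adj; under eq_bigr do rewrite mulr_sumr.
rewrite exchange_big /=; apply: eq_bigr => u _; rewrite mulr_suml.
by apply: eq_bigr => v _; rewrite sedge_sym mulrCA mulrA.
Qed.

Lemma dot_ge0 x : 0 <= dot x x.
Proof. by apply: sumr_ge0 => u _; rewrite -expr2 sqr_ge0. Qed.

Lemma dot_eq0 x : dot x x = 0 -> forall u, x u = 0.
Proof.
move/eqP; rewrite psumr_eq0 => [/allP x0 u|u _]; last by rewrite -expr2 sqr_ge0.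
by have := x0 u (mem_index_enum _); rewrite -expr2 sqrf_eq0 => /eqP.
Qed.

Lemma dot_gt0 x u : x u != 0 -> 0 < dot x x.
Proof.
move=> xu; rewrite lt_def dot_ge0 andbT; apply: contraNneq xu => /dot_eq0 x0.
by rewrite x0.
Qed.

Lemma formD x z t : qform (fun u => x u + t * z u) =
  qform x + 2 * t * dot z (adj x) + t ^+ 2 * qform z.
Proof.
have aE : adj (fun u => x u + t * z u) =1 (fun u => adj x u + t * adj z u).
  by move=> u; rewrite adjD adjZ.
rewrite /qform (eq_dot (fun _ => erefl) aE) dotDl !dotDr !dotZl !dotZr.
by rewrite (dot_adj x z) (dotC (adj x) z); ring.
Qed.

Lemma dot_lincomb x z t : dot (fun u => x u + t * z u) (fun u => x u + t * z u) =
  dot x x + 2 * t * dot x z + t ^+ 2 * dot z z.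
Proof. by rewrite dotDl !dotDr !dotZl !dotZr (dotC z x); ring. Qed.

(** First-order optimality: moving [z] by [t] times the residual [g] gives [2 t |g|^2 <= t^2 c] for
    all [t], and a small positive [t] forces [g = 0]. *)
Lemma maximizer_eigen lam z : (forall w, qform w <= lam * dot w w) ->
  qform z = lam * dot z z -> forall u, adj z u = lam * z u.
Proof.
move=> top fz; pose g u := adj z u + (- lam) * z u.
suff g0 : dot g g = 0.
  by move=> u; apply/eqP; rewrite -subr_eq0 -mulNr; apply/eqP; apply: (dot_eq0 g0).
have gg : dot g g = dot g (adj z) - lam * dot z g.
  by rewrite {2}/g dotDr dotZr (dotC g z) mulNr.
pose c := lam * dot g g - qform g.
have ineq t : 2 * t * dot g g <= t ^+ 2 * c.
  have := top (fun u => z u + t * g u); rewrite formD dot_lincomb fz.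
  by rewrite {2}gg /c; lra.
have := dot_ge0 g; rewrite le_eqVlt => /orP[/eqP //|g0].
have c0 : 0 < `|c| + 1 by rewrite ltr_wpDl.
have h2 := ler_norm c.
have h4 := ineq (dot g g / (`|c| + 1)).
have := h4; rewrite -(ler_pM2l c0) -(ler_pM2l c0).
have -> : (`|c| + 1) * ((`|c| + 1) * ((dot g g / (`|c| + 1)) ^+ 2 * c)) = dot g g ^+ 2 * c.
  by field; rewrite gt_eqF.
have -> : (`|c| + 1) * ((`|c| + 1) * (2 * (dot g g / (`|c| + 1)) * dot g g)) =
    dot g g ^+ 2 * (2 * (`|c| + 1)) by field; rewrite gt_eqF.
rewrite ler_pM2l ?exprn_gt0 //; have := normr_ge0 c; lra.
Qed.

Lemma eigen_form lam z : (forall u, adj z u = lam * z u) -> qform z = lam * dot z z.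
Proof. by move=> zE; rewrite /qform (eq_dot (fun _ => erefl) zE) dotZr. Qed.

Lemma adj_ge0 z u : (forall v, 0 <= z v) -> 0 <= adj z u.
Proof. by move=> z0; apply: sumr_ge0 => v _; rewrite mulr_ge0. Qed.

Lemma adj_ge_nbr z u v : (forall v, 0 <= z v) -> sedge u v -> z v <= adj z u.
Proof.
move=> z0 uv; rewrite /adj (bigD1 v) //= uv mul1r lerDl sumr_ge0 // => w _.
by rewrite mulr_ge0.
Qed.

(** Positivity spreads along edges, as the eigenvalue equation at a zero entry forces zero at its
    neighbours. *)
Lemma perron_gt0 lam z : connected_graph G -> (forall u, 0 <= z u) -> 0 < dot z z ->
  (forall u, adj z u = lam * z u) -> forall u, 0 < z u.
Proof.
move=> conn z0 zz zE u; have [v zv] : exists v, 0 < z v.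
  apply/existsP; apply: contraTT zz; rewrite negb_exists => /forallP zle.
  rewrite -leNgt; apply: sumr_le0 => v _; have := zle v; rewrite -leNgt => h.
  by rewrite (@le_anti _ _ (z v) 0) ?mulr0 // h z0.
have /connectP[p pth lst] := conn v u; elim: p v zv pth lst => [|w p IH] v zv /=.
  by move=> _ ->.
case/andP => vw pth lst; apply: IH pth lst.
rewrite lt_def z0 andbT; apply/eqP => zw.
have wv : sedge w v by rewrite sedge_sym.
by have := adj_ge_nbr z0 wv; rewrite zE zw mulr0 leNgt zv.
Qed.

Lemma qform_norm z : qform z <= qform (fun u => `|z u|).
Proof.
rewrite /qform /dot; apply: ler_sum => u _; rewrite /adj !mulr_sumr.
apply: ler_sum => v _; rewrite -[X in _ <= _ * (X * _)]ger0_norm //.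
by rewrite -!normrM ler_norm.
Qed.

Lemma dot_norm z : dot (fun u => `|z u|) (fun u => `|z u|) = dot z z.
Proof. by apply: eq_bigr => u _; rewrite -normrM ger0_norm // -expr2 sqr_ge0. Qed.

Definition top_eigenvalue lam := (forall z, qform z <= lam * dot z z) /\
  exists z, [/\ forall u, 0 <= z u, 0 < dot z z & forall u, adj z u = lam * z u].

Lemma top_eigenvalueP : (0 < #|G|)%N -> exists lam, top_eigenvalue lam.
Proof.
move=> G0; have [lam [x [x1 xE top]]] := top_eigenvector R G0.
exists lam; split=> //; exists (fun u => `|x u|); split=> //.
  by rewrite dot_norm x1.
apply: maximizer_eigen => //; apply/le_anti; rewrite top /=.
by rewrite dot_norm -(eigen_form xE) qform_norm.
Qed.

End Perron.

(** * The extremal blocks *)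

Section FanEigenvalue.
Variable R : realType.

Lemma sum_fan k (F : fan k -> R) : \sum_u F u = F (inl tt) + \sum_(i < k) F (inr i).
Proof.
rewrite big_sumType /=; congr (_ + _).
by rewrite (bigD1 tt) //= big1 ?addr0 // => -[].
Qed.

Lemma adj_hub k (z : fan k -> R) : adj z (inl tt) = \sum_(i < k) z (inr i).
Proof.
by rewrite /adj sum_fan mul0r add0r; apply: eq_bigr => i _; rewrite mul1r.
Qed.

Lemma adj_rim k (z : fan k -> R) i : adj z (inr i) =
  z (inl tt) + \sum_(j < k) (path_rel i j)%:R * z (inr j).
Proof. by rewrite /adj sum_fan mul1r. Qed.

Lemma path_deg k (j : 'I_k) :
  \sum_(i < k) (path_rel i j)%:R = ((0 < j)%N + (j.+1 < k)%N)%:R :> R.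
Proof.
transitivity (\sum_(i < k) (((i : nat).+1 == j) + ((j : nat).+1 == i))%:R : R).
  apply: eq_bigr => i _; rewrite /path_rel; congr (_%:R).
  by case: eqP => [<-|] //=; rewrite gtn_eqF.
have one (P : pred 'I_k) (b : bool) : (b -> exists2 i, P i & forall i', P i' -> i' = i) ->
    (~~ b -> forall i, ~~ P i) -> \sum_(i < k) (P i)%:R = b%:R :> R.
  case: b => [/(_ isT)[i Pi uni] _|_ /(_ isT) nP]; last first.
    by rewrite big1 // => i _; rewrite (negPf (nP i)).
  rewrite (bigD1 i) //= Pi big1 ?addr0 // => i' ii'.
  by case Pi': (P i') => //; rewrite (uni _ Pi') eqxx in ii'.
under eq_bigr do rewrite natrD.
rewrite big_split /= natrD; congr (_ + _); apply: one.
- move=> j0; have jk : (j.-1 < k)%N by apply: leq_ltn_trans (leq_pred _) _.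
  exists (Ordinal jk) => /= [|i' /eqP ij]; first by rewrite prednK.
  by apply: val_inj; rewrite /= -ij.
- by rewrite -eqn0Ngt => /eqP j0 i; rewrite j0.
- move=> jk; exists (Ordinal jk) => // i' /eqP ij.
  by apply: val_inj; rewrite /= -ij.
- by move=> jk i; apply: contraNneq jk => ->.
Qed.

(** The test vector with 2 at the hub and 1 on the rim has quotient [(6 k - 2) / (k + 4)], which
    increases with [k] and is [17 / 5] at [k = 6]. *)
Lemma fan_top_test k lam : (5 < k)%N -> @top_eigenvalue R (fan k) lam ->
  17%:R / 5%:R <= lam.
Proof.
move=> k6 [top _].
pose z (u : fan k) : R := if u is inl _ then 2 else 1.
have hub : adj z (inl tt) = k%:R.
  by rewrite adj_hub sumr_const card_ord.
have dz : dot z z = 4 + k%:R.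
  rewrite /dot sum_fan /=; under eq_bigr do rewrite mulr1.
  by rewrite sumr_const card_ord -natrM.
have fz : 6 * k%:R - 2 <= qform z.
  rewrite /qform /dot sum_fan hub /=.
  under eq_bigr do rewrite mul1r adj_rim.
  rewrite big_split /= exchange_big /=.
  have -> : \sum_(j < k) \sum_(i < k) (path_rel i j)%:R * 1
      = \sum_(j < k) (2 - (j == 0 :> nat)%:R - (j == k.-1 :> nat)%:R) :> R.
    apply: eq_bigr => j _; under eq_bigr do rewrite mulr1.
    rewrite path_deg natrD lt0n.
    have -> : (j.+1 < k)%N = (j != k.-1 :> nat) by have := ltn_ord j; lia.
    by case: eqP => _; case: eqP => _ /=; ring.
  rewrite !sumrB !sumr_const card_ord -![2 *+ k]mulr_natr.
  have k0 : (0 < k)%N by lia.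
  have kk : (k.-1 < k)%N by lia.
  rewrite (bigD1 (Ordinal k0)) //= big1 => [|i]; last first.
    by rewrite -val_eqE /= => /negPf ->.
  rewrite (bigD1 (Ordinal kk)) //= eqxx big1 => [|i]; last first.
    by rewrite -val_eqE /= => /negPf ->.
  rewrite mulr1n; lra.
have := le_trans fz (top z); rewrite dz => h.
have k6' : 6%:R <= k%:R :> R by rewrite ler_nat.
rewrite leNgt; apply/negP => l5.
have : lam * (4 + k%:R) < 17%:R / 5%:R * (4 + k%:R) by rewrite ltr_pM2r //; lra.
lra.
Qed.

(** The hub equation taken twice gives [lam (lam - 2) c = k c] minus the entries at the two ends of
    the rim. Every rim entry is at most [c / (lam - 2)], hence an end entry at most
    [c (lam - 1) / (lam (lam - 2))]. *)
Lemma fan_top_lower k lam : (5 < k)%N -> @top_eigenvalue R (fan k) lam ->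
  k%:R <= lam * (lam - 2) + 2 * (lam - 1) / (lam * (lam - 2)).
Proof.
move=> k6 topl; have l5 := fan_top_test k6 topl.
case: topl => _ [z [z0 zz zE]].
have zpos := perron_gt0 (@connected_fan k) z0 zz zE.
set c := z (inl tt); have c0 : 0 < c by apply: zpos.
have hub : \sum_(i < k) z (inr i) = lam * c by rewrite -zE adj_hub.
have rim i : lam * z (inr i) = c + \sum_(j < k) (path_rel i j)%:R * z (inr j).
  by rewrite -zE adj_rim.
have k0 : (0 < k)%N by lia.
have kk : (k.-1 < k)%N by lia.
have [im _ imax] := @arg_maxP _ _ _ (Ordinal k0) xpredT (fun i => z (inr i)) isT.
have zmax i : z (inr i) <= z (inr im) by apply: imax.
have row_le (i : 'I_k) (b : nat) : (((0 < i)%N + (i.+1 < k)%N)%N <= b)%N ->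
    lam * z (inr i) <= c + b%:R * z (inr im).
  move=> ib; rewrite rim lerD2l.
  apply: (@le_trans _ _ (\sum_(j < k) (path_rel i j)%:R * z (inr im))).
    by apply: ler_sum => j _; rewrite ler_wpM2l.
  rewrite -mulr_suml; under eq_bigr do rewrite path_rel_sym.
  by rewrite path_deg ler_wpM2r // ler_nat.
have Mle : (lam - 2) * z (inr im) <= c.
  have := row_le im 2 (leq_add (leq_b1 _) (leq_b1 _)); lra.
have e1 := row_le (Ordinal k0) 1 _; have e2 := row_le (Ordinal kk) 1 _.
have {}e1 := e1 (leq_b1 _).
have {}e2 : lam * z (inr (Ordinal kk)) <= c + 1%:R * z (inr im).
  by apply: e2; rewrite /= prednK // ltnn addn0 leq_b1.
have tot : lam * (lam * c) = k%:R * c + 2 * (lam * c)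
    - z (inr (Ordinal k0)) - z (inr (Ordinal kk)).
  rewrite -{1}hub mulr_sumr; under eq_bigr do rewrite rim.
  rewrite big_split /= sumr_const card_ord -[c *+ k]mulr_natl exchange_big /=.
  rewrite -!addrA; congr (_ + _).
  transitivity (\sum_(j < k) (2 - (j == 0 :> nat)%:R - (j == k.-1 :> nat)%:R) * z (inr j)).
    apply: eq_bigr => j _; rewrite -mulr_suml path_deg natrD lt0n.
    have -> : (j.+1 < k)%N = (j != k.-1 :> nat) by have := ltn_ord j; lia.
    by case: eqP => _; case: eqP => _ /=; ring.
  under eq_bigr do rewrite !mulrBl.
  rewrite !sumrB -mulr_sumr hub addrA; congr (_ - _ - _).
    rewrite (bigD1 (Ordinal k0)) //= mul1r big1 ?addr0 // => i.
    by rewrite -val_eqE /= => /negPf ->; rewrite mul0r.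
  rewrite (bigD1 (Ordinal kk)) //= eqxx mul1r big1 ?addr0 // => i.
  by rewrite -val_eqE /= => /negPf ->; rewrite mul0r.
have l2 : 0 < lam - 2 by lra.
have ll : 0 < lam * (lam - 2) by rewrite mulr_gt0 //; lra.
have bound y : lam * y <= c + 1%:R * z (inr im) -> y <= (lam - 1) / (lam * (lam - 2)) * c.
  move=> h; rewrite -(ler_pM2l ll).
  have -> : lam * (lam - 2) * ((lam - 1) / (lam * (lam - 2)) * c) = (lam - 1) * c.
    by field; rewrite !gt_eqF //; lra.
  have := ler_wpM2l (ltW l2) h; lra.
have b1 := bound _ e1; have b2 := bound _ e2.
rewrite -(ler_pM2r c0) mulrDl; lra.
Qed.

(** Turns [fan_top_lower] into numerical lower bounds for [lam], and lets a larger eigenvalue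
    replace [lam] in it. *)
Lemma fan_bound_mono (a b : R) : 17%:R / 5%:R <= a -> a <= b ->
  a * (a - 2) + 2 * (a - 1) / (a * (a - 2)) <= b * (b - 2) + 2 * (b - 1) / (b * (b - 2)).
Proof.
move=> a5 ab.
have A0 : 0 < a * (a - 2) by rewrite mulr_gt0 //; lra.
have B0 : 0 < b * (b - 2) by rewrite mulr_gt0 //; lra.
rewrite -subr_ge0.
have -> : b * (b - 2) + 2 * (b - 1) / (b * (b - 2)) - (a * (a - 2) + 2 * (a - 1) / (a * (a - 2)))
  = (b - a) * ((a + b - 2) - 2 * ((a - 1) * (b - 1) + 1) / ((a * (a - 2)) * (b * (b - 2)))).
  by field; rewrite !gt_eqF //; lra.
apply: mulr_ge0; first by rewrite subr_ge0.
rewrite subr_ge0 ler_pdivrMr; last exact: mulr_gt0.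
have A2 : 4 <= a * (a - 2).
  have -> : 4 = 4 * 1 :> R by ring.
  have := @ler_pM R (17%:R/5%:R) a (7%:R/5%:R) (a-2); lra.
have B2 : b * b <= 4 * (b * (b - 2)).
  have : 0 <= b * (3 * b - 8) by rewrite mulr_ge0 //; lra.
  lra.
have AB : 4 * (b * (b - 2)) <= a * (a - 2) * (b * (b - 2)) by rewrite ler_wpM2r // ltW.
have S0 : 0 <= a + b - 2 by lra.
have := ler_wpM2l S0 (le_trans B2 AB).
have b2 : 0 <= b * b by rewrite mulr_ge0 //; lra.
have h : 4 * (b * b) <= (a + b - 2) * (b * b) by rewrite ler_wpM2r //; lra.
have h2 : a * b <= b * b by rewrite ler_wpM2r //; lra.
lra.
Qed.

Lemma fan_top_gt k lam (tau : R) : (5 < k)%N -> @top_eigenvalue R (fan k) lam ->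
  17%:R / 5%:R <= tau ->
  tau * (tau - 2) * (tau * (tau - 2)) + 2 * (tau - 1) < k%:R * (tau * (tau - 2)) ->
  tau < lam.
Proof.
move=> k6 topl t5 tk; rewrite ltNge; apply/negP => lt.
have t0 : 0 < tau * (tau - 2) by rewrite mulr_gt0 //; lra.
have := le_trans (fan_top_lower k6 topl)
  (fan_bound_mono (fan_top_test k6 topl) lt).
by rewrite -(ler_pM2r t0) mulrDl divfK ?gt_eqF // leNgt tk.
Qed.

Lemma G1_top_gt lam : @top_eigenvalue R G1 lam -> 323%:R / 100%:R < lam.
Proof.
move=> [top _].
(* The largest eigenvalue is [1 + sqrt 5], and its eigenvector has the golden ratio, close to
   [8 / 5], between the inner triangle and the other vertices. *)
pose z (u : G1) : R := if [|| u == 1%N :> nat, u == 2%N :> nat | u == 4%N :> nat] then 8 else 5.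
have := top z; rewrite /qform /dot /adj.
rewrite !(big_ord_recl, big_ord0) /z /= /G1_rel /=.
rewrite ?mulr1n ?mulr0n; lra.
Qed.

End FanEigenvalue.

(** * Graphs with a large Rayleigh quotient embed in the block *)

Section Extremal.
Variable R : realType.
Local Open Scope ring_scope.

Lemma fan_top_gt0 k lam : (0 < k)%N -> @top_eigenvalue R (fan k) lam -> 0 < lam.
Proof.
move=> k0 [_ [z [z0 zz zE]]]; have zpos := perron_gt0 (@connected_fan k) z0 zz zE.
have : z (inr (Ordinal k0)) <= adj z (inl tt) by apply: adj_ge_nbr.
rewrite zE => h; rewrite -(pmulr_lgt0 _ (zpos (inl tt))).
exact: lt_le_trans (zpos _) h.
Qed.

Lemma extremal_embedding (H : sgraph) (pos : H -> nat) (lam : R) (z : H -> R) :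
  noncrossing pos -> top_eigenvalue (extremal_block #|H|) lam ->
  (forall v, 0 <= z v) -> 0 < dot z z -> lam * dot z z <= qform z ->
  exists2 f : H -> extremal_block #|H|, injective f &
    forall v w, sedge v w -> sedge (f v) (f w).
Proof.
move=> nc topl z0 zz lamz.
have [u _] : exists u : H, true.
  case: (pickP (fun _ : H => true)) => [u _|no]; first by exists u.
  by rewrite /dot big_pred0 ?ltxx in zz.
have [s [ps su ncs]] := noncrossing_numbering u nc.
have sz := size_numbering ps.
have qE : qform z = \sum_(a < size s) \sum_(b < size s)
    (index_edge u s a b)%:R * (z (nth u s a) * z (nth u s b)).
  rewrite /qform /dot (sum_numbering u _ ps); apply: eq_bigr => a _.
  rewrite /adj (sum_numbering u _ ps) mulr_sumr; apply: eq_bigr => b _.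
  by rewrite /index_edge !ltn_ord /= mulrCA.
have dE : dot z z = \sum_(a < size s) z (nth u s a) ^+ 2.
  by rewrite /dot (sum_numbering u _ ps); apply: eq_bigr => a _; rewrite expr2.
have ncs' : noncrossing_on (index_edge u s) 0 (size s).-1.
  by move=> a b c d a0 ab bc cd ds; apply: ncs => //; apply: leq_trans ds (leq_pred _).
have eirr := @index_edge_irr H u s; have esym := @index_edge_sym H u s.
have xz0 i : 0 <= z (nth u s i) by [].
have m0 : (0 < size s)%N by rewrite sz; apply/card_gt0P; exists u.
have small_case T D : (0 < D)%num -> (1 < size s)%N -> fan_check (size s) T D ->
    size s <> 6%N -> (N.to_nat T)%:R / (N.to_nat D)%:R < lam ->
    exists2 f : H -> fan #|H|.-1, injective f & forall v w, sedge v w -> sedge (f v) (f w).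
  move=> D0 s2 chk s6 tl.
  have [[c cs fanc]|] := fan_check_bound s2 esym eirr ncs' xz0 D0 chk.
    exact: fan_embedding cs fanc.
  rewrite -qE -dE => h; have := le_trans lamz h.
  by rewrite ler_pM2r // leNgt tl.
have [m1|m1] := eqVneq #|H| 1%N.
  have all_eq (v w : H) : v = w.
    by move: (m1) => /eqP/fintype1P[x xP]; rewrite (xP v) (xP w).
  rewrite m1; exists (fun _ => inl tt : fan 0) => [v w _|v w]; first exact: all_eq.
  by rewrite (all_eq v w) sedge_irrefl.
have s2 : (1 < size s)%N by rewrite sz in m0 *; case: #|H| m1 m0 => [|[]].
have [m6|m6] := eqVneq #|H| 6%N.
  rewrite m6 /extremal_block /= in topl *.
  have s6 : size s = 6%N by rewrite sz.
  have [||] := sun_check_bound s2 esym eirr ncs' xz0 s6.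
  - exact: (@sun_embedding _ _ _ ps [:: 1; 5; 2; 3; 4; 0]%N).
  - exact: (@sun_embedding _ _ _ ps [:: 0; 1; 5; 2; 3; 4]%N).
  rewrite -qE -dE => h; have := le_trans lamz h.
  by rewrite ler_pM2r // leNgt (G1_top_gt topl).
move: topl; rewrite /extremal_block (negPf m6) -sz => topl.
have s6 : size s <> 6%N by rewrite sz; apply/eqP.
have [sle5|sgt5] := ltnP (size s) 6.
  rewrite sz; apply: (@small_case 0 1 erefl)%num => //; first exact: fan_check_small.
  by rewrite mul0r; apply: fan_top_gt0 topl; case: (size s) s2 => [|[]].
have s7 : (6 < size s)%N by rewrite ltn_neqAle sgt5 andbT eq_sym; apply/eqP.
have [sle12|sgt12] := ltnP (size s) 13.
  have gt (a : N) (p : R) : (N.to_nat a)%:R = p -> 17%:R / 5%:R <= p / 100%:R ->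
      p / 100%:R * (p / 100%:R - 2) * (p / 100%:R * (p / 100%:R - 2))
        + 2 * (p / 100%:R - 1) < (size s).-1%:R * (p / 100%:R * (p / 100%:R - 2)) ->
      (N.to_nat (a * 100))%:R / (N.to_nat (100 * 100))%:R < lam.
    move=> ap h1 h2; rewrite to_nat_ratio ap; apply: fan_top_gt topl h1 h2.
    by clear -s7; lia.
  have : size s \in iota 7 6 by rewrite mem_iota s7.
  rewrite !inE sz.
  case/or4P => [/eqP m7|/eqP m8|/eqP m9|/or3P[]/eqP m10].
  - apply: (@small_case (345 * 100) (100 * 100) erefl)%num => //.
      by rewrite sz m7; exact: fan_check7.
    by apply: (gt _ 345%:R) => //; rewrite ?sz ?m7 /=; lra.
  - apply: (@small_case (366 * 100) (100 * 100) erefl)%num => //.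
      by rewrite sz m8; exact: fan_check8.
    by apply: (gt _ 366%:R) => //; rewrite ?sz ?m8 /=; lra.
  - apply: (@small_case (384 * 100) (100 * 100) erefl)%num => //.
      by rewrite sz m9; exact: fan_check9.
    by apply: (gt _ 384%:R) => //; rewrite ?sz ?m9 /=; lra.
  - apply: (@small_case (401 * 100) (100 * 100) erefl)%num => //.
      by rewrite sz m10; exact: fan_check10.
    by apply: (gt _ 401%:R) => //; rewrite ?sz ?m10 /=; lra.
  - apply: (@small_case (417 * 100) (100 * 100) erefl)%num => //.
      by rewrite sz m10; exact: fan_check11.
    by apply: (gt _ 417%:R) => //; rewrite ?sz ?m10 /=; lra.
  - apply: (@small_case (433 * 100) (100 * 100) erefl)%num => //.
      by rewrite sz m10; exact: fan_check12.
    by apply: (gt _ 433%:R) => //; rewrite ?sz ?m10 /=; lra.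
have k6 : (5 < (size s).-1)%N by clear -sgt12; lia.
have H0 : (0 < #|H|)%N by rewrite -sz.
(* The vector [z] need not be an eigenvector; the hub argument uses one for the largest eigenvalue
   of [H]. *)
have [mu [topm [y [y0 yy yE]]]] := top_eigenvalueP R H0.
have lm : lam <= mu by rewrite -(ler_pM2r zz); apply: le_trans lamz (topm z).
have [w _ wmax'] := @arg_maxP _ _ _ u xpredT y isT.
have {wmax'} wmax v : y v <= y w by apply: wmax'.
have w0 : 0 < y w.
  rewrite lt_def y0 andbT; apply: contraTneq yy => yw0; rewrite -leNgt.
  apply: sumr_le0 => v _; suff -> : y v = 0 by rewrite mulr0.
  by apply/le_anti; rewrite y0 andbT -yw0 wmax.
have [t [pt tw nct]] := noncrossing_numbering w nc.
have tz : size t = size s by rewrite sz (size_numbering pt).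
(* The threshold of [hub_dominating], which the fan exceeds once its rim has 12 vertices. *)
have tau_lam : 22%:R / 5%:R < lam.
  apply: fan_top_gt topl _ _ => //; first by lra.
  have k12 : 12%:R <= (size s).-1%:R :> R by rewrite ler_nat; clear -sgt12; lia.
  lra.
have dom : forall a, (0 < a < size t)%N -> index_edge w t 0 a.
  apply: (@hub_dominating (size t) (index_edge w t) (index_edge_sym w t)
    (index_edge_irr w t) _ nct R (fun i => y (nth w t i) / y w) mu).
  - by move=> a b /and3P[].
  - by move=> a; rewrite divr_ge0.
  - by move=> a; rewrite ler_pdivrMr // mul1r wmax.
  - by rewrite tw divff // gt_eqF.
  - move=> a at_; rewrite mulrA -yE /adj (sum_numbering w _ pt) mulr_suml.
    by apply: eq_bigr => b _; rewrite /index_edge at_ ltn_ord /= mulrA.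
  - exact: ltW (lt_le_trans tau_lam lm).
  - by rewrite tz; clear -m0; lia.
  rewrite tz; apply: le_trans (fan_top_lower k6 topl) (fan_bound_mono _ lm).
  exact: fan_top_test topl.
rewrite sz; apply: (@fan_embedding _ w t pt 0); first by rewrite tz.
move=> a b /andP[ab bt] eab.
have [a0|a0] := posnP a; first by constructor 1.
have [b1|b1] := eqVneq b a.+1; first by constructor 3.
(* An edge from [a] beyond [a.+1] would cross the chord from the hub to [a.+1]. *)
case: (nct 0 a a.+1 b)%N => //; [|exact: ltnW|].
  by rewrite ltn_neqAle eq_sym b1.
by apply: dom; apply: leq_ltn_trans ab bt.
Qed.

End Extremal.

Lemma isograph_sym (G H : sgraph) : isograph G H -> isograph H G.
Proof.
case=> f [g fK gK] fE; exists g; first by exists f.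
by move=> x y; rewrite -fE !gK.
Qed.

Lemma isograph_refl (G : sgraph) : isograph G G.
Proof. by exists id; [exists id | ]. Qed.

(** * The second eigenvalue under isomorphism and of bullet graphs *)

Section Transport.
Variable R : realType.

Lemma qformE (G : sgraph) (z : G -> R) :
  qform z = \sum_u \sum_v (sedge u v)%:R * (z u * z v).
Proof.
rewrite /qform /dot; apply: eq_bigr => u _; rewrite mulr_sumr.
by apply: eq_bigr => v _; rewrite mulrCA.
Qed.

Section Iso.
Variables (G H : sgraph) (f : G -> H).
Hypotheses (fb : bijective f) (fE : forall x y, sedge (f x) (f y) = sedge x y).

Lemma dot_iso (x z : H -> R) : dot (fun u => x (f u)) (fun u => z (f u)) = dot x z.
Proof. by rewrite /dot [RHS](reindex f) //; exact: onW_bij. Qed.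

Lemma adj_iso (x : H -> R) u : adj (fun u => x (f u)) u = adj x (f u).
Proof.
rewrite /adj [RHS](reindex f); last exact: onW_bij.
by apply: eq_bigr => v _; rewrite fE.
Qed.
End Iso.

(** The plane spanned by [y] and [z] contains a nonzero vector orthogonal to the top eigenvector. *)
Lemma rho2_ge (G : sgraph) (mu : R) (y z : G -> R) : (1 < #|G|)%N ->
  0 < dot y y -> 0 < dot z z -> dot y z = 0 -> dot z (adj y) = 0 ->
  mu * dot y y <= qform y -> mu * dot z z <= qform z -> mu <= rho2 R G.
Proof.
move=> G1 yy zz yz zAy qy qz.
have [lam [x1 [x2 [[_ _ _ _] [_ _ _ top2]]]]] := rho2_eigenvectors R G1.
have comb a b : dot x1 (fun u => a * y u + b * z u) = 0 ->
    0 < a ^+ 2 + b ^+ 2 -> mu <= rho2 R G.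
  move=> orth ab; pose w u := a * y u + b * z u.
  have dw : dot w w = a ^+ 2 * dot y y + b ^+ 2 * dot z z.
    rewrite /w dot_lincomb !dotZl !dotZr yz; ring.
  have qw : qform w = a ^+ 2 * qform y + b ^+ 2 * qform z.
    rewrite /w formD /qform.
    have aE : adj (fun u => a * y u) =1 (fun u => a * adj y u) by move=> u; rewrite adjZ.
    rewrite (eq_dot (fun _ => erefl) aE) (eq_dot (fun _ => erefl) aE) dotZl !dotZr zAy; ring.
  have w0 : 0 < dot w w.
    rewrite dw; case: (ltrgt0P (a ^+ 2)) => [a0|a0|a0].
    - by have := mulr_ge0 (sqr_ge0 b) (ltW zz); have := mulr_gt0 a0 yy; lra.
    - by have := sqr_ge0 a; rewrite leNgt a0.
    - by rewrite a0 mul0r add0r mulr_gt0 //; move: ab; rewrite a0 add0r.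
  rewrite -(ler_pM2r w0); apply: le_trans (top2 _ orth); rewrite qw dw.
  have := ler_wpM2l (sqr_ge0 a) qy; have := ler_wpM2l (sqr_ge0 b) qz; lra.
have [h|h] := eqVneq (dot x1 z ^+ 2 + dot x1 y ^+ 2) 0.
  have [z0 y0] : dot x1 z = 0 /\ dot x1 y = 0.
    move/eqP: h; rewrite paddr_eq0 ?sqr_ge0 // !sqrf_eq0.
    by case/andP => /eqP -> /eqP ->.
  apply: (@comb 1 0); first by rewrite dotDr !dotZr y0 z0; ring.
  by rewrite expr0n expr1n addr0.
apply: (@comb (dot x1 z) (- dot x1 y)); first by rewrite dotDr !dotZr; ring.
by rewrite sqrrN lt_def h addr_ge0 ?sqr_ge0.
Qed.

Lemma rho2_iso (G H : sgraph) : (1 < #|G|)%N -> isograph G H -> rho2 R G = rho2 R H.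
Proof.
suff le (G' H' : sgraph) : (1 < #|G'|)%N -> isograph G' H' -> rho2 R H' <= rho2 R G'.
  move=> G1 iso; apply/le_anti/andP; split; last exact: le.
  have [f fb _] := iso; apply: le; last exact: isograph_sym.
  by rewrite -(bij_eq_card fb).
move=> G1 [f fb fE]; have H1 : (1 < #|H'|)%N by rewrite -(bij_eq_card fb).
have [lam [x1 [x2 [[lamge d1 d2 d12] [e1 e2 _ _]]]]] := rho2_eigenvectors R H1.
apply: (@rho2_ge G' _ (fun u => x1 (f u)) (fun u => x2 (f u))) => //.
- by rewrite dot_iso // d1.
- by rewrite dot_iso // d2.
- by rewrite dot_iso.
- have aE : adj (fun u => x1 (f u)) =1 (fun u => lam * x1 (f u)).
    by move=> u; rewrite adj_iso // e1.
  by rewrite (eq_dot (fun _ => erefl) aE) dotZr dot_iso // dotC d12 mulr0.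
- have aE u : adj (fun u => x1 (f u)) u = lam * x1 (f u) by rewrite adj_iso // e1.
  by rewrite (eigen_form aE) ler_wpM2r // dot_ge0.
have aE u : adj (fun u => x2 (f u)) u = rho2 R H' * x2 (f u) by rewrite adj_iso // e2.
by rewrite (eigen_form aE).
Qed.

End Transport.

Section Bullet.
Variables (R : realType) (H : sgraph) (S : {set disjoint_union H H}).
Let M := add_vertex S.
Implicit Types z : M -> R.

Lemma sum_bullet (F : M -> R) : \sum_u F u =
  F None + (\sum_(u : H) F (Some (inl u)) + \sum_(u : H) F (Some (inr u))).
Proof.
rewrite (bigD1 (None : M)) //=; congr (_ + _).
transitivity (\sum_(w : disjoint_union H H) F (Some w)); last by rewrite big_sumType.
rewrite (reindex_omap Some id) /=; last by case.
by apply: eq_bigl => u; rewrite eqxx.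
Qed.

Lemma card_bullet : #|M| = (#|H| + #|H|).+1.
Proof. by rewrite card_option card_sum. Qed.

Lemma dot_bullet z z' : z None = 0 -> dot z z' =
  dot (fun u => z (Some (inl u))) (fun u => z' (Some (inl u))) +
  dot (fun u => z (Some (inr u))) (fun u => z' (Some (inr u))).
Proof. by move=> z0; rewrite /dot sum_bullet z0 mul0r add0r. Qed.

Lemma adj_bullet_l z u : z None = 0 ->
  adj z (Some (inl u)) = adj (fun v => z (Some (inl v))) u.
Proof.
move=> z0; rewrite /adj sum_bullet z0 mulr0 add0r [X in _ + X]big1 ?addr0 // => v _.
by rewrite mul0r.
Qed.

Lemma adj_bullet_r z u : z None = 0 ->
  adj z (Some (inr u)) = adj (fun v => z (Some (inr v))) u.
Proof.
move=> z0; rewrite /adj sum_bullet z0 mulr0 add0r [X in X + _]big1 ?add0r // => v _.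
by rewrite mul0r.
Qed.

Lemma qform_bullet z : z None = 0 -> qform z =
  qform (fun u => z (Some (inl u))) + qform (fun u => z (Some (inr u))).
Proof.
move=> z0; rewrite /qform dot_bullet //; congr (_ + _).
  by apply: eq_bigr => u _; rewrite adj_bullet_l.
by apply: eq_bigr => u _; rewrite adj_bullet_r.
Qed.

(** Interlacing. Upper bound: some combination of the two top eigenvectors vanishes at the
    additional vertex, hence lives on the two copies. Lower bound: the Perron vector of [H] on
    either copy. *)
Lemma rho2_bullet lam : (0 < #|H|)%N -> @top_eigenvalue R H lam -> rho2 R M = lam.
Proof.
move=> H0 [top [p [p0 pp pE]]].
have M1 : (1 < #|M|)%N by rewrite card_bullet ltnS addn_gt0 H0.
have qp := eigen_form pE.
apply/le_anti/andP; split.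
  have [l1 [x1 [x2 [[lamge d1 d2 d12] [e1 e2 _ _]]]]] := rho2_eigenvectors R M1.
  have d0 : dot (fun _ : H => 0 : R) (fun _ => 0) = 0.
    by rewrite /dot big1 // => u _; rewrite mulr0.
  have comb a b : a * x1 None + b * x2 None = 0 -> 0 < a ^+ 2 + b ^+ 2 -> rho2 R M <= lam.
    move=> w0 ab; pose w u := a * x1 u + b * x2 u.
    have aE : adj w =1 (fun u => a * l1 * x1 u + b * rho2 R M * x2 u).
      by move=> u; rewrite /w adjD !adjZ e1 e2 !mulrA.
    have dw : dot w w = a ^+ 2 + b ^+ 2.
      by rewrite /w dot_lincomb !dotZl !dotZr d1 d2 d12; ring.
    have qw : qform w = a ^+ 2 * l1 + b ^+ 2 * rho2 R M.
      rewrite /qform (eq_dot (fun _ => erefl) aE) /w dotDl !dotDr !dotZl !dotZr.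
      by rewrite (dotC x2 x1) d1 d2 d12; ring.
    have qle : qform w <= lam * dot w w.
      by rewrite qform_bullet // dot_bullet // mulrDr lerD.
    have wpos : 0 < dot w w by rewrite dw.
    rewrite -(ler_pM2r wpos); apply: le_trans qle; rewrite qw dw.
    have := ler_wpM2l (sqr_ge0 a) lamge; lra.
  have [h|h] := eqVneq (x2 None ^+ 2 + x1 None ^+ 2) 0.
    have [z0 y0] : x2 None = 0 /\ x1 None = 0.
      move/eqP: h; rewrite paddr_eq0 ?sqr_ge0 // !sqrf_eq0.
      by case/andP => /eqP -> /eqP ->.
    apply: (@comb 1 0); first by rewrite y0 z0; ring.
    by rewrite expr0n expr1n addr0.
  apply: (@comb (x2 None) (- x1 None)); first by ring.
  by rewrite sqrrN lt_def h addr_ge0 ?sqr_ge0.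
pose y (u : M) : R := if u is Some (inl v) then p v else 0.
pose z (u : M) : R := if u is Some (inr v) then p v else 0.
have z0 : dot (fun _ : H => 0 : R) (fun _ => 0) = 0.
  by rewrite /dot big1 // => u _; rewrite mulr0.
have q0 : qform (fun _ : H => 0 : R) = 0.
  by rewrite /qform /dot big1 // => u _; rewrite mul0r.
apply: (@rho2_ge R M lam y z) => //.
- by rewrite dot_bullet //= z0 addr0.
- by rewrite dot_bullet //= z0 add0r.
- rewrite dot_bullet //= /dot !big1 ?addr0 // => u _; by rewrite ?mulr0 ?mul0r.
- rewrite dot_bullet //= /dot [X in X + _]big1 ?add0r => [|u _]; last by rewrite mul0r.
  rewrite big1 // => u _; rewrite adj_bullet_r // /adj big1 ?mulr0 // => v _.
  by rewrite mulr0.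
- by rewrite dot_bullet //= z0 addr0 qform_bullet //= q0 addr0 qp.
- by rewrite dot_bullet //= z0 add0r qform_bullet //= q0 add0r qp.
Qed.

End Bullet.

(** * Uniqueness of the block, and vectors of small support *)

Section Blocks.
Variable R : realType.

(** Carried to the block by the embedding, [z] keeps its norm and its form can only grow, so it
    attains [lam] and is a positive eigenvector. An edge missing in [H] would then cost a positive
    amount. *)
Lemma block_unique (H : sgraph) (pos : H -> nat) (lam : R) (z : H -> R) :
  noncrossing pos -> top_eigenvalue (extremal_block #|H|) lam ->
  (forall v, 0 <= z v) -> 0 < dot z z -> lam * dot z z <= qform z ->
  [/\ isograph H (extremal_block #|H|), forall v, 0 < z v & qform z = lam * dot z z].
Proof.
move=> nc topl z0 zz lamz; have [f finj fE] := extremal_embedding nc topl z0 zz lamz.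
have H0 : (0 < #|H|)%N.
  rewrite lt0n; apply: contraTneq zz => /card0_eq H0.
  by rewrite /dot big_pred0 ?ltxx // => u; have := H0 u.
have fb : bijective f by apply: inj_card_bij; rewrite // card_extremal_block.
have [g fK gK] := fb; set F := extremal_block _ in topl f finj fE fb g fK gK *.
pose w (a : F) := z (g a).
have wz u : w (f u) = z u by rewrite /w fK.
have dw : dot w w = dot z z.
  by rewrite /dot (reindex f) /=; [apply: eq_bigr => u _; rewrite wz | exact: onW_bij].
have qw : qform w = \sum_u \sum_v (sedge (f u) (f v))%:R * (z u * z v).
  rewrite qformE (reindex f) /=; last exact: onW_bij.
  apply: eq_bigr => u _; rewrite (reindex f) /=; last exact: onW_bij.
  by apply: eq_bigr => v _; rewrite !wz.
have le_e u v : (sedge u v <= sedge (f u) (f v))%N.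
  by case E: (sedge u v) => //; rewrite (fE _ _ E).
have sub : 0 <= qform w - qform z.
  rewrite qw qformE subr_ge0; apply: ler_sum => u _; apply: ler_sum => v _.
  by rewrite ler_wpM2r ?mulr_ge0 // ler_nat le_e.
have wtop := topl.1 w; rewrite dw in wtop.
have qwE : qform w = lam * dot w w by rewrite dw; lra.
have qzE : qform z = lam * dot z z by lra.
have wE := maximizer_eigen topl.1 qwE.
have w0 a : 0 <= w a := z0 (g a).
have wpos : forall a, 0 < w a.
  by apply: (perron_gt0 (@connected_extremal_block _) w0 _ wE); rewrite dw.
have zpos v : 0 < z v by rewrite -wz.
split=> //; exists f => // u v.
have : qform w - qform z = 0 by lra.
rewrite qw qformE -sumrB => /eqP; rewrite psumr_eq0 => [/allP h|a _]; last first.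
  rewrite -sumrB sumr_ge0 // => b _; rewrite -mulrBl mulr_ge0 ?mulr_ge0 //.
  by rewrite subr_ge0 ler_nat le_e.
have := h u (mem_index_enum _); rewrite /= -sumrB psumr_eq0 => [/allP h'|b _]; last first.
  rewrite -mulrBl mulr_ge0 ?mulr_ge0 //.
  by rewrite subr_ge0 ler_nat le_e.
have := h' v (mem_index_enum _); rewrite /= -mulrBl mulf_eq0 mulf_eq0.
rewrite !(gt_eqF (zpos _)) !orbF subr_eq0 eqr_nat.
by case: (sedge (f u) (f v)); case: (sedge u v).
Qed.

End Blocks.

Lemma superset_card (T : finType) (A : {set T}) m : (#|A| <= m)%N -> (m <= #|T|)%N ->
  exists2 B : {set T}, A \subset B & #|B| = m.
Proof.
have [k] := ubnP (m - #|A|); elim: k A => // k IH A; rewrite ltnS => mk Am mT.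
have [Am'|Am'] := eqVneq #|A| m; first by exists A.
have /set0Pn[v vA] : ~: A != set0.
  by apply: contraNneq Am' => Ac; rewrite -(setCK A) Ac setC0 cardsT eqn_leq in Am *;
    rewrite Am mT.
have vA' : #|v |: A| = #|A|.+1 by rewrite cardsU1; rewrite inE in vA; rewrite vA.
have ltm : (#|A| < m)%N by rewrite ltn_neqAle Am' Am.
have [||B AB Bm] := IH (v |: A) _ _ mT; rewrite ?vA' //.
  by move: mk ltm; clear; lia.
by exists B => //; apply: subset_trans AB; rewrite subsetUr.
Qed.

Section Induced.
Variables (G : sgraph) (A : {set G}).

Definition induced_rel (u v : {v : G | v \in A}) := sedge (val u) (val v).
Fact induced_sym : symmetric induced_rel.
Proof. by move=> u v; rewrite /induced_rel sedge_sym. Qed.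
Fact induced_irrefl : irreflexive induced_rel.
Proof. by move=> u; rewrite /induced_rel sedge_irrefl. Qed.
Definition induced := SGraph induced_sym induced_irrefl.

Lemma card_induced : #|induced| = #|A|.
Proof. by rewrite card_sig. Qed.

Lemma noncrossing_induced (pos : G -> nat) : noncrossing pos ->
  noncrossing (fun u : induced => pos (val u)).
Proof.
case=> pinj nc; split=> [u v /pinj|a b c d ab bc cd]; first exact: val_inj.
exact: nc.
Qed.

Variables (R : realType) (y : G -> R).
Hypothesis y0 : forall u, u \notin A -> y u = 0.

Lemma sum_induced (F : G -> R) : (forall u, u \notin A -> F u = 0) ->
  \sum_u F u = \sum_(u : induced) F (val u).
Proof.
move=> F0; rewrite -(big_sub (mem A)) /= [RHS]big_mkcond /=.
by apply: eq_bigr => u _; case: ifPn => // /F0.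
Qed.

Lemma dot_induced : dot y y = dot (fun u : induced => y (val u)) (fun u => y (val u)).
Proof. by apply: sum_induced => u /y0 ->; rewrite mul0r. Qed.

Lemma qform_induced : qform y = qform (fun u : induced => y (val u)).
Proof.
rewrite !qformE sum_induced => [|u /y0 ->]; last first.
  by rewrite big1 // => v _; rewrite mul0r mulr0.
apply: eq_bigr => u _; rewrite sum_induced // => v /y0 ->.
by rewrite !mulr0.
Qed.

End Induced.

Local Notation psupp y := [set u | (0 < y u)%R].

Section Support.
Variables (R : realType) (G : sgraph) (pos : G -> nat).
Hypothesis nc : noncrossing pos.

(** Enlarge the support to exactly [m] vertices; the positivity in [block_unique] shows that nothing
    was added. *)
Lemma support_block (y : G -> R) m lam :
  (0 < m <= #|G|)%N -> @top_eigenvalue R (extremal_block m) lam ->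
  (forall v, 0 <= y v) -> 0 < dot y y -> lam * dot y y <= qform y ->
  (#|psupp y| <= m)%N ->
  [/\ #|psupp y| = m, isograph (induced (psupp y)) (extremal_block m) &
    qform y = lam * dot y y].
Proof.
move=> /andP[m0 mG] topl y0 yy qy Am.
have [B AB Bm] := superset_card Am mG.
have yB u : u \notin B -> y u = 0.
  move=> uB; apply/le_anti; rewrite y0 andbT leNgt; apply: contra uB => yu.
  by apply: (subsetP AB); rewrite inE.
have cB := card_induced B; rewrite Bm in cB.
have [||||iso zpos qE] := @block_unique R (induced B) _ lam (fun u => y (val u))
    (noncrossing_induced B nc).
- by rewrite cB.
- by move=> v; apply: y0.
- by rewrite -dot_induced.
- by rewrite -dot_induced // -qform_induced.
have AE : psupp y = B.
  apply/eqP; rewrite eqEsubset AB /=; apply/subsetP => u uB; rewrite inE.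
  exact: (zpos (exist _ u uB)).
rewrite AE cB in iso *; split=> //.
by rewrite (qform_induced yB) qE -(dot_induced yB).
Qed.

Definition pos_part (x : G -> R) u := Num.max (x u) 0.

Lemma pos_part_ge0 x u : 0 <= pos_part x u.
Proof. by rewrite /pos_part le_max lexx orbT. Qed.

Lemma pos_part_gt0 x u : (0 < pos_part x u) = (0 < x u).
Proof. by rewrite /pos_part lt_max ltxx orbF. Qed.

Lemma pos_partB x u : x u = pos_part x u - pos_part (fun v => - x v) u.
Proof. by rewrite /pos_part; case: leP => h; case: leP; lra. Qed.

Lemma pos_part_mul x u : pos_part x u * x u = pos_part x u * pos_part x u.
Proof. by rewrite /pos_part; case: leP => h; rewrite ?mul0r ?mulr0. Qed.

(** The surplus is carried by the edges between the positive and the negative support; if it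
    vanishes, there are none. *)
Lemma pos_part_form lam (x : G -> R) : (forall u, adj x u = lam * x u) ->
  qform (pos_part x) = lam * dot (pos_part x) (pos_part x) +
    dot (pos_part x) (adj (pos_part (fun v => - x v))).
Proof.
move=> xE; set p := pos_part x; set q := pos_part _.
have pE : adj p =1 (fun u => lam * x u + adj q u).
  move=> u; rewrite -xE -adjD; apply: eq_bigr => v _; congr (_ * _).
  by rewrite [x v]pos_partB -/p -/q subrK.
rewrite /qform (eq_dot (fun _ => erefl) pE) dotDr dotZr; congr (_ * _ + _).
by apply: eq_bigr => u _; rewrite /p pos_part_mul.
Qed.

Lemma pos_part_form_ge lam (x : G -> R) : (forall u, adj x u = lam * x u) ->
  lam * dot (pos_part x) (pos_part x) <= qform (pos_part x).
Proof.
move=> xE; rewrite (pos_part_form xE) lerDl sumr_ge0 // => u _.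
by rewrite mulr_ge0 ?adj_ge0 ?pos_part_ge0 // => v; rewrite pos_part_ge0.
Qed.

Definition mixed (x : G -> R) := [exists u, 0 < x u] && [exists u, x u < 0].

Lemma not_mixed x : ~~ mixed x -> (forall u, x u = `|x u|) \/ (forall u, x u = - `|x u|).
Proof.
rewrite negb_and !negb_exists => /orP[] /forallP h; [right | left] => u.
  by have := h u; rewrite -leNgt => h'; rewrite ler0_norm // opprK.
by have := h u; rewrite -leNgt => h'; rewrite ger0_norm.
Qed.

Lemma not_mixed_dot x z : ~~ mixed x -> ~~ mixed z -> dot x z = 0 ->
  dot (fun u => `|x u|) (fun u => `|z u|) = 0.
Proof.
move=> /not_mixed[] xE /not_mixed[] zE; rewrite (eq_dot xE zE) /dot //.
- by under eq_bigr do rewrite mulrN; rewrite sumrN => /eqP; rewrite oppr_eq0 => /eqP.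
- by under eq_bigr do rewrite mulNr; rewrite sumrN => /eqP; rewrite oppr_eq0 => /eqP.
- by under eq_bigr do rewrite mulrNN.
Qed.

Lemma dot_pos_part x u : 0 < x u -> 0 < dot (pos_part x) (pos_part x).
Proof. by move=> xu; apply: (@dot_gt0 _ _ _ u); rewrite gt_eqF // pos_part_gt0. Qed.

Lemma opp_eigen lam (x : G -> R) : (forall u, adj x u = lam * x u) ->
  forall u, adj (fun v => - x v) u = lam * - x u.
Proof.
move=> xE u; rewrite mulrN -xE -sumrN; apply: eq_bigr => v _.
by rewrite mulrN.
Qed.

Lemma pos_part_disjoint x u : 0 < pos_part x u -> 0 < pos_part (fun v => - x v) u -> False.
Proof. by rewrite !pos_part_gt0; lra. Qed.

(** If neither of the two top eigenvectors changes sign, their orthogonality makes the supports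
    disjoint, and their absolute values serve. *)
Lemma two_signs : (1 < #|G|)%N -> exists y z : G -> R,
  [/\ forall u, 0 <= y u, forall u, 0 <= z u, 0 < dot y y & 0 < dot z z] /\
  [/\ forall u, 0 < y u -> 0 < z u -> False, rho2 R G * dot y y <= qform y &
      rho2 R G * dot z z <= qform z].
Proof.
move=> G1; have [lam [x1 [x2 [[lamge d1 d2 d12] [e1 e2 _ _]]]]] := rho2_eigenvectors R G1.
have ge0 (x : G -> R) : 0 <= dot x x by exact: dot_ge0.
have mix mu x : rho2 R G <= mu -> (forall u, adj x u = mu * x u) -> mixed x ->
    exists y z : G -> R,
    [/\ forall u, 0 <= y u, forall u, 0 <= z u, 0 < dot y y & 0 < dot z z] /\
    [/\ forall u, 0 < y u -> 0 < z u -> False, rho2 R G * dot y y <= qform y &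
        rho2 R G * dot z z <= qform z].
  move=> mge xE /andP[/existsP[u xu] /existsP[v xv]].
  exists (pos_part x), (pos_part (fun v => - x v)).
  have nE := opp_eigen xE; split; split.
  - exact: pos_part_ge0.
  - exact: pos_part_ge0.
  - exact: dot_pos_part xu.
  - by apply: (@dot_pos_part _ v); rewrite oppr_gt0.
  - exact: pos_part_disjoint.
  - by apply: le_trans (pos_part_form_ge xE); rewrite ler_wpM2r.
  - by apply: le_trans (pos_part_form_ge nE); rewrite ler_wpM2r.
have [m1|m1] := boolP (mixed x1); first exact: mix lamge e1 m1.
have [m2|m2] := boolP (mixed x2); first exact: mix (lexx _) e2 m2.
have := not_mixed_dot m1 m2 d12 => /eqP.
rewrite psumr_eq0 => [/allP d0|u _]; last by rewrite mulr_ge0.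
exists (fun u => `|x1 u|), (fun u => `|x2 u|); split; split=> //.
- by rewrite dot_norm d1.
- by rewrite dot_norm d2.
- move=> u u1 u2; have := d0 u (mem_index_enum _).
  by rewrite /= mulf_eq0 !gt_eqF.
- rewrite dot_norm; apply: le_trans (qform_norm _); rewrite (eigen_form e1).
  by rewrite ler_wpM2r.
- by rewrite dot_norm; apply: le_trans (qform_norm _); rewrite (eigen_form e2).
Qed.

(** By connectedness the top eigenvector has no zero and one sign, so a vector orthogonal to it must
    change sign. *)
Lemma connected_mixed : connected_graph G -> (1 < #|G|)%N ->
  exists2 x : G -> R, mixed x & forall u, adj x u = rho2 R G * x u.
Proof.
move=> conn G1.
have [lam [x1 [x2 [[lamge d1 d2 d12] [e1 e2 top _]]]]] := rho2_eigenvectors R G1.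
have pert (z : G -> R) : (forall u, 0 <= z u) -> 0 < dot z z ->
    lam * dot z z <= qform z -> forall u, 0 < z u.
  move=> z0 zz qz; apply: (perron_gt0 conn z0 zz (lam := lam)).
  by apply: maximizer_eigen => //; apply/le_anti; rewrite top.
exists x2 => //; apply/negPn/negP => m2.
have m1 : ~~ mixed x1.
  apply/negP => /andP[/existsP[u xu] /existsP[v xv]].
  have := pert _ (pos_part_ge0 x1) (dot_pos_part xu) (pos_part_form_ge e1) v.
  by rewrite pos_part_gt0; lra.
have n1 : forall u, 0 < `|x1 u|.
  apply: pert => //; first by rewrite dot_norm d1.
  by rewrite dot_norm; apply: le_trans (qform_norm _); rewrite (eigen_form e1).
have := not_mixed_dot m1 m2 d12 => /eqP.
rewrite psumr_eq0 => [/allP d0|u _]; last by rewrite mulr_ge0.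
have : dot x2 x2 = 0.
  rewrite -dot_norm /dot big1 // => u _; have := d0 u (mem_index_enum _).
  by rewrite /= mulf_eq0 (gt_eqF (n1 u)) /= => /eqP ->; rewrite mul0r.
by rewrite d2 => /eqP; rewrite oner_eq0.
Qed.

End Support.

(** * Splitting a graph of order [2m + 1] into two blocks *)

Section TwoBlocks.
Variables (R : realType) (G : sgraph) (pos : G -> nat) (m : nat) (lam : R).
Hypotheses (nc : noncrossing pos) (Gm : #|G| = (m + m).+1) (m0 : (0 < m)%N).
Hypothesis topl : @top_eigenvalue R (extremal_block m) lam.

Let G1 : (1 < #|G|)%N. Proof. by rewrite Gm ltnS addn_gt0 m0. Qed.
Let mG : (0 < m <= #|G|)%N. Proof. by rewrite m0 Gm; lia. Qed.

Lemma disjoint_support (A B : {set G}) : (forall u, u \in A -> u \in B -> False) ->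
  (#|A| + #|B| <= (m + m).+1)%N.
Proof.
move=> dis; have AB : A :&: B = set0.
  by apply/setP => u; rewrite !inE; apply/negP => /andP[/dis].
by have := cardsUI A B; rewrite AB cards0 addn0 -Gm => <-; rewrite max_card.
Qed.

Lemma rho2_le_block : rho2 R G <= lam.
Proof.
have [y [z [[y0 z0 yy zz] [dis qy qz]]]] := two_signs R G1.
have := @disjoint_support (psupp y) (psupp z).
have main (w : G -> R) : (forall u, 0 <= w u) -> 0 < dot w w ->
    rho2 R G * dot w w <= qform w -> (#|psupp w| <= m)%N -> rho2 R G <= lam.
  move=> w0 ww qw wm; rewrite leNgt; apply/negP => lt.
  have qw' : lam * dot w w <= qform w.
    by apply: le_trans qw; rewrite ler_wpM2r // ltW.
  have [_ _ qE] := support_block nc mG topl w0 ww qw' wm.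
  by move: qw; rewrite qE ler_pM2r // leNgt lt.
have [ym|ym] := leqP #|psupp y| m; first by move=> _; exact: main ym.
move=> h; apply: (main z) => //.
have {}h : (#|psupp y| + #|psupp z| <= (m + m).+1)%N.
  by apply: h => u; rewrite !inE => h1 h2; apply: dis h1 h2.
by move: ym h; clear; lia.
Qed.

Let F := extremal_block m.

Lemma rho2_eq_block : connected_graph G -> rho2 R G = lam ->
  exists S : {set disjoint_union F F}, isograph G (add_vertex S).
Proof.
move=> conn rl; have [x0 mx0 e0] := connected_mixed R conn G1.
(* Up to the sign of the eigenvector, the positive support is the smaller one. *)
have [x mx [e xm]] : exists2 x : G -> R, mixed x &
    (forall u, adj x u = lam * x u) /\ (#|psupp (pos_part x)| <= m)%N.
  rewrite rl in e0; have e0' := opp_eigen e0.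
  have := @disjoint_support (psupp (pos_part x0))
    (psupp (pos_part (fun v => - x0 v))).
  have [ym|ym h] := leqP #|psupp (pos_part x0)| m.
    by move=> _; exists x0.
  exists (fun v => - x0 v).
    move: mx0 => /andP[/existsP[u xu] /existsP[v xv]]; apply/andP; split.
      by apply/existsP; exists v; rewrite oppr_gt0.
    by apply/existsP; exists u; rewrite oppr_lt0.
  split=> //.
  have {}h := h (fun u => _); move: ym; rewrite ltnNge; apply: contraR; rewrite -ltnNge.
  move=> zm; have : (#|psupp (pos_part x0)| +
    #|psupp (pos_part (fun v => - x0 v)%R)| <= (m + m).+1)%N.
    by apply: disjoint_support => u; rewrite !inE; exact: pos_part_disjoint.
  by move: zm; clear; lia.
move: mx => /andP[/existsP[u0 xu0] /existsP[v0 xv0]].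
set y := pos_part x in xm; pose z := pos_part (fun v => - x v).
have ne := opp_eigen e.
have yy : 0 < dot y y by apply: dot_pos_part xu0.
have zz : 0 < dot z z by apply: (@dot_pos_part _ _ _ v0); rewrite oppr_gt0.
pose A := psupp y; pose B := psupp z.
have [Am isoA qy] := support_block nc mG topl (pos_part_ge0 x) yy (pos_part_form_ge e) xm.
have yAz : dot y (adj z) = 0.
  by have := pos_part_form e; rewrite -/y -/z qy; lra.
have noAB u v : u \in A -> v \in B -> sedge u v = false.
  rewrite !inE => yu zv; move/eqP: yAz; rewrite psumr_eq0 => [/allP h|w _]; last first.
    by rewrite mulr_ge0 ?adj_ge0 ?pos_part_ge0 // => w'; rewrite pos_part_ge0.
  have := h u (mem_index_enum _); rewrite /= mulf_eq0 (gt_eqF yu) /= => /eqP az.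
  apply/negP => uv; have := adj_ge_nbr (pos_part_ge0 (fun v => - x v)) uv.
  by rewrite -/z az leNgt zv.
have disAB u : u \in A -> u \in B -> False.
  by rewrite !inE; exact: pos_part_disjoint.
have ABm := disjoint_support disAB; rewrite Am in ABm.
have u0A : u0 \in A by rewrite inE pos_part_gt0.
have v0B : v0 \in B by rewrite inE pos_part_gt0 oppr_gt0.
(* With more than [m] vertices, [B] would be the whole complement of [A], and no edge would leave
   [A], against connectedness. *)
have [Bm|Bm] := leqP #|B| m; last first.
  exfalso; have ABT : A :|: B = setT.
    apply/eqP; rewrite eqEcard subsetT cardsT Gm.
    have := cardsUI A B; have -> : A :&: B = set0.
      by apply/setP => u; rewrite !inE; apply/negP => /andP[h1 h2];
        apply: (disAB u); rewrite inE.
    by rewrite cards0 addn0 => ->; rewrite Am; move: Bm; clear; lia.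
  have /connectP[p pth lst] := conn u0 v0.
  elim: p u0 u0A pth lst {xu0} => [|w p IH] u uA /=.
    by move=> _ vu; apply: (disAB u) => //; rewrite -vu.
  case/andP => uw pth lst; apply: (IH w) => //.
  have : w \in A :|: B by rewrite ABT inE.
  by rewrite inE => /orP[//|wB]; rewrite (noAB u w) in uw.
have [Bm' isoB _] := support_block nc mG topl (pos_part_ge0 _) zz (pos_part_form_ge ne) Bm.
rewrite -/A in isoA; rewrite -/z -/B in isoB Bm'.
have [c [cA cB]] : exists c, c \notin A /\ c \notin B.
  have : (0 < #|~: (A :|: B)|)%N.
    have := cardsC (A :|: B); have := cardsUI A B.
    by rewrite Am Bm' Gm; clear; lia.
  by case/card_gt0P => c; rewrite !inE negb_or => /andP[]; exists c; rewrite !inE.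
have [gA gAb gAE] := isograph_sym isoA; have [gB gBb gBE] := isograph_sym isoB.
pose h (w : option (F + F)) : G := match w with
  | Some (inl a) => val (gA a) | Some (inr b) => val (gB b) | None => c end.
pose S : {set disjoint_union F F} := [set w | sedge c (h (Some w))].
exists S; apply: isograph_sym; exists (h : add_vertex S -> G).
  apply: inj_card_bij.
    have inA a : val (gA a) \in A := valP (gA a).
    have inB b : val (gB b) \in B := valP (gB b).
    move=> [[a|b]|] [[a'|b']|] //= hE.
    - by do 2!congr (_ _); apply: (bij_inj gAb); apply: val_inj.
    - by case: (disAB (val (gA a))); rewrite // (hE : val (gA a) = val (gB b')).
    - by case/negP: cA; rewrite -(hE : val (gA a) = c).
    - by case: (disAB (val (gA a'))); rewrite // -(hE : val (gB b) = val (gA a')).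
    - by do 2!congr (_ _); apply: (bij_inj gBb); apply: val_inj.
    - by case/negP: cB; rewrite -(hE : val (gB b) = c).
    - by case/negP: cA; rewrite (hE : c = val (gA a')).
    - by case/negP: cB; rewrite (hE : c = val (gB b')).
  by rewrite card_bullet Gm card_extremal_block.
have inA a : val (gA a) \in A := valP (gA a).
have inB b : val (gB b) \in B := valP (gB b).
move=> [[a|b]|] [[a'|b']|] //=.
- exact: gAE.
- exact: (noAB _ _ (inA a) (inB b')).
- by rewrite inE sedge_sym.
- by rewrite sedge_sym; exact: (noAB _ _ (inA a') (inB b)).
- exact: gBE.
- by rewrite inE sedge_sym.
- by rewrite inE.
- by rewrite inE.
- by rewrite sedge_irrefl.
Qed.

End TwoBlocks.

Lemma block_of_bullet (R : realType) (F M : sgraph) (lam : R) : (0 < #|F|)%N ->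
  @top_eigenvalue R F lam -> in_two_bullet F M -> rho2 R M = lam.
Proof.
move=> F0 topl [_ [S iso]]; rewrite -(rho2_bullet S F0 topl); apply: rho2_iso (iso).
have [f fb _] := iso; rewrite (bij_eq_card fb) card_bullet ltnS addn_gt0.
by rewrite F0.
Qed.

Theorem theorem5p8 (R : realType) (n : nat) (G : sgraph)
    (G_outerplanar : outerplanar G) (G_order : #|G| = n) :
  ((3 <= n)%N -> odd n -> n <> 13%N ->
   forall M : sgraph, in_two_bullet (fan ((n - 3) %/ 2)) M ->
     rho2 R G <= rho2 R M /\
     (connected_graph G ->
      (rho2 R G = rho2 R M <->
       exists M' : sgraph,
         [/\ in_two_bullet (fan ((n - 3) %/ 2)) M', outerplanar M' & G ≅ M'])))
  /\
  (n = 13%N -> connected_graph G ->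
   (extremal R G <->
    exists M : sgraph, [/\ in_two_bullet G1 M, outerplanar M & G ≅ M])).
Proof.
have [pos nc] := outerplanar_noncrossing G_outerplanar.
split.
  move=> n3 nodd n13 M MH; pose m := ((n - 3) %/ 2).+1.
  have nm : n = (m + m).+1 by rewrite /m; lia.
  have Gm : #|G| = (m + m).+1 by rewrite G_order.
  have m6 : (m == 6) = false by apply/eqP => m6; apply: n13; rewrite nm m6.
  have blockE : extremal_block m = fan ((n - 3) %/ 2) by rewrite /extremal_block m6.
  have F0 : (0 < #|extremal_block m|)%N by rewrite card_extremal_block.
  have [lam topl] := top_eigenvalueP R F0.
  have rM : forall M', in_two_bullet (fan ((n - 3) %/ 2)) M' -> rho2 R M' = lam.
    by rewrite -blockE => M' M'H; exact: block_of_bullet topl M'H.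
  have G1 : (1 < #|G|)%N by rewrite G_order; apply: leq_trans n3.
  rewrite (rM M MH); split; first exact: (rho2_le_block nc Gm).
  move=> conn; split=> [Glam|[M' [M'H _ iso]]]; last by rewrite (rho2_iso R G1 iso) rM.
  have [S iso] := rho2_eq_block nc Gm (ltn0Sn _) topl conn Glam.
  exists G; split=> //; last exact: isograph_refl.
  by rewrite -blockE; split=> //; exists S.
move=> n13 conn; have Gm : #|G| = (6 + 6).+1 by rewrite G_order n13.
have F0 : (0 < #|Defs.G1|)%N by rewrite card_G1.
have [lam topl] := top_eigenvalueP R F0.
have topl' : @top_eigenvalue R (extremal_block 6) lam by exact: topl.
have G1' : (1 < #|G|)%N by rewrite Gm.
split=> [[_ ext]|[M [MH Mout iso]]]; last first.
  split=> // K Kout KG; rewrite (rho2_iso R G1' iso) (block_of_bullet F0 topl MH).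
  have [posK ncK] := outerplanar_noncrossing Kout.
  by apply: (rho2_le_block ncK _ _ topl'); rewrite // KG Gm.
have Glam : rho2 R G = lam.
  apply/le_anti/andP; split; first exact: (rho2_le_block nc Gm _ topl').
  (* Extremality is tested against [two_G1], an outerplanar graph of order 13 with second eigenvalue
     [lam]. *)
  rewrite -(rho2_bullet set0 F0 topl); apply: ext two_G1_outerplanar _.
  by rewrite card_bullet card_G1 Gm.
have [S iso] := rho2_eq_block nc Gm (isT : 0 < 6)%N topl' conn Glam.
by exists G; split=> //; [split=> //; exists S | exact: isograph_refl].
Qed.
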